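(* For every prime $p$, the $\textsc{Kneser}^p_{\mathrm{a\text{-}stab}}$ problem is polynomial-time reducible to the $\mathbb{Z}_p\textsc{-Tucker}$ problem.
   Context: A subset of $[n]$ is almost stable if it contains no two consecutive integers $j,j+1$ (it may contain both $1$ and $n$); $\binom{[n]}{k}_{\mathrm{a\text{-}stab}}$ is the family of almost stable $k$-subsets of $[n]$. Sets are identified with characteristic vectors in $\{0,1\}^n$. The $\textsc{Kneser}^p_{\mathrm{a\text{-}stab}}$ problem: given integers $n,k$ with $n\ge pk$ and a Boolean circuit $C:\{0,1\}^n\to[m]$ with $m=\lfloor\frac{n-p(k-1)-1}{p-1}\rfloor$ (representing a coloring of $\binom{[n]}{k}_{\mathrm{a\text{-}stab}}$), find $p$ pairwise disjoint $B_1,\dots,B_p\in\binom{[n]}{k}_{\mathrm{a\text{-}stab}}$ with $C(B_1)=\dots=C(B_p)$. The $\mathbb{Z}_p\textsc{-Tucker}$ problem: write the elements of $\mathbb{Z}_p$ multiplicatively as $\omega^t$, $t\in[p]$. For $X,Y\in(\mathbb{Z}_p\cup\{0\})^n$ write $X\preceq Y$ if $X_j\ne0$ implies $X_j=Y_j$ for all $j$. The input is integers $n,s$ with $s\le\lfloor\frac{n-1}{p-1}\rfloor$ and a Boolean circuit representing a map $\lambda=(\lambda_1,\lambda_2):(\mathbb{Z}_p\cup\{0\})^n\setminus\{0\}^n\to\mathbb{Z}_p\times[s]$ with $\lambda(\omega^tX)=(\omega^t\lambda_1(X),\lambda_2(X))$ for all $t\in[p]$. The goal is to find $X_1\preceq\dots\preceq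 X_p$ in $(\mathbb{Z}_p\cup\{0\})^n\setminus\{0\}^n$, a permutation $\pi$ of $[p]$ and $\ell\in[s]$ with $\lambda(X_t)=(\omega^{\pi(t)},\ell)$ for all $t\in[p]$. A polynomial-time reduction from $P$ to $Q$ consists of polynomial-time algorithms $f,g$ with $f$ mapping instances $x$ of $P$ to instances of $Q$ and $g(x,y)$ a solution of $x$ for every solution $y$ of $f(x)$. *)

(* Defs.v *)
From mathcomp Require Import all_boot.
Set Implicit Arguments. Unset Strict Implicit. Unset Printing Implicit Defensive.

Inductive move := MoveL | MoveR | Stay.

Record TM := {
  tm_nq : nat;
  tm_delta : 'I_tm_nq.+1 -> option bool -> 'I_tm_nq.+1 * option bool * move;
  tm_halt : 'I_tm_nq.+1 -> bool }.

(* configuration: state, cells left of the head (nearest first),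
   cells from the head rightwards; missing cells are blank (None). *)
Definition config (M : TM) := ('I_(tm_nq M).+1 * seq (option bool) * seq (option bool))%type.

Definition tm_step (M : TM) (c : config M) : config M :=
  let: (q, l, r) := c in
  if tm_halt q then c else
  let: (q', w, d) := tm_delta q (head None r) in
  match d with
  | MoveL => match l with
             | [::] => (q', [::], None :: w :: behead r)
             | a :: l' => (q', l', a :: w :: behead r)
             end
  | MoveR => (q', w :: l, behead r)
  | Stay => (q', l, w :: behead r)
  end.

Arguments tm_step : clear implicits.

Definition tm_init (M : TM) (x : seq bool) : config M := (ord0, [::], map Some x).

Definition tm_run (M : TM) (t : nat) (x : seq bool) : config M :=
  iter t (tm_step M) (tm_init M x).

Fixpoint out_bits (r : seq (option bool)) : seq bool :=
  if r is Some b :: r' then b :: out_bits r' else [::].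

Definition tm_computes_on (M : TM) (T : nat) (x y : seq bool) : Prop :=
  exists2 t, t <= T &
    let c := tm_run M t x in tm_halt c.1.1 /\ out_bits c.2 = y.

Definition poly_bound (c len : nat) : nat := c * len ^ c + c.

Inductive data := DNat of nat | DList of seq data.

Fixpoint enc (d : data) : seq bool :=
  match d with
  | DNat k => false :: rcons (nseq k true) false
  | DList l =>
      true :: rcons ((fix encl (l : seq data) : seq bool :=
                        match l with
                        | [::] => [::]
                        | d' :: l' => true :: (enc d' ++ encl l')
                        end) l) false
  end.

Definition bits_data (x : seq bool) : data := DList (map (fun b => DNat (nat_of_bool b)) x).

Definition pair_bits (x y : seq bool) : seq bool := enc (DList [:: bits_data x; bits_data y]).

Definition poly_time_computable (f : seq bool -> seq bool) : Prop :=
  exists (M : TM) (c : nat), forall x, tm_computes_on M (poly_bound c (size x)) x (f x).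

Definition poly_time_computable2 (g : seq bool -> seq bool -> seq bool) : Prop :=
  exists (M : TM) (c : nat), forall x y,
    tm_computes_on M (poly_bound c (size (pair_bits x y))) (pair_bits x y) (g x y).

Record search_problem := {
  sp_instance : seq bool -> Prop;
  sp_solution : seq bool -> seq bool -> Prop (* y is a solution of x *) }.

Definition poly_reducible (P Q : search_problem) : Prop :=
  exists (f : seq bool -> seq bool) (g : seq bool -> seq bool -> seq bool),
    poly_time_computable f /\ poly_time_computable2 g /\
    forall x, sp_instance P x ->
      sp_instance Q (f x) /\
      forall y, sp_solution Q (f x) y -> sp_solution P x (g x y).

(* gate i may refer to input bits (GIn j) and to earlier gates by index;
   references to non-existing bits/gates read as false. *)
Inductive gate :=
| GIn of nat | GConst of bool | GNot of nat | GAnd of nat & nat | GOr of nat & nat.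

(* c_outs : a list of output numbers, each given by a list of gate
   indices read as a little-endian binary number *)
Record circuit := { c_gates : seq gate; c_outs : seq (seq nat) }.

Definition gate_val (inp vals : seq bool) (g : gate) : bool :=
  match g with
  | GIn j => nth false inp j
  | GConst b => b
  | GNot a => ~~ nth false vals a
  | GAnd a b => nth false vals a && nth false vals b
  | GOr a b => nth false vals a || nth false vals b
  end.

Definition circ_vals (C : circuit) (inp : seq bool) : seq bool :=
  foldl (fun vals g => rcons vals (gate_val inp vals g)) [::] (c_gates C).

Definition bits_to_nat (s : seq bool) : nat := foldr (fun (b : bool) (acc : nat) => nat_of_bool b + acc.*2) 0 s.

Definition circ_eval (C : circuit) (inp : seq bool) : seq nat :=
  let vals := circ_vals C inp in
  map (fun o => bits_to_nat (map (fun i => nth false vals i) o)) (c_outs C).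

Definition gate_data (g : gate) : data :=
  match g with
  | GIn j => DList [:: DNat 0; DNat j]
  | GConst b => DList [:: DNat 1; DNat (nat_of_bool b)]
  | GNot a => DList [:: DNat 2; DNat a]
  | GAnd a b => DList [:: DNat 3; DNat a; DNat b]
  | GOr a b => DList [:: DNat 4; DNat a; DNat b]
  end.

Definition circuit_data (C : circuit) : data :=
  DList [:: DList (map gate_data (c_gates C));
            DList (map (fun o => DList (map DNat o)) (c_outs C))].

(* 5. Kneser^p_{a-stab}.  Colors [m] are represented by 0..m-1.         *)

(* characteristic vector B (of length n) has no two consecutive j, j+1;
   {1, n} is allowed (no cyclic condition) *)
Definition almost_stable (B : seq bool) : Prop :=
  forall j, j.+1 < size B -> ~~ (nth false B j && nth false B j.+1).

(* m = floor((n - p(k-1) - 1)/(p-1)); for n >= p k, n - p(k-1) - 1 = (n - p k) + p - 1 *)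
Definition kneser_m (p n k : nat) : nat := (n - p * k + p - 1) %/ (p - 1).

Definition kneser_color (C : circuit) (B : seq bool) : nat := nth 0 (circ_eval C B) 0.

Definition kneser_enc (n k : nat) (C : circuit) : seq bool :=
  enc (DList [:: DNat n; DNat k; circuit_data C]).

Definition kneser_valid (p n k : nat) (C : circuit) : Prop :=
  p * k <= n /\ size (c_outs C) = 1 /\
  forall B : seq bool, size B = n -> kneser_color C B < kneser_m p n k.

Definition kneser_sol_data (Bs : seq (seq bool)) : seq bool :=
  enc (DList (map bits_data Bs)).

Definition kneser_is_sol (p n k : nat) (C : circuit) (Bs : seq (seq bool)) : Prop :=
  size Bs = p /\
  (forall i, i < p ->
     let B := nth [::] Bs i in
     size B = n /\ almost_stable B /\ count id B = k) /\
  (forall i j, i < j -> j < p ->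
     forall t, ~~ (nth false (nth [::] Bs i) t && nth false (nth [::] Bs j) t)) /\
  (forall i, i < p -> kneser_color C (nth [::] Bs i) = kneser_color C (nth [::] Bs 0)).

Definition Kneser_astab (p : nat) : search_problem := {|
  sp_instance := fun x => exists n k C, x = kneser_enc n k C /\ kneser_valid p n k C;
  sp_solution := fun x y => exists n k C, x = kneser_enc n k C /\
       exists Bs, y = kneser_sol_data Bs /\ kneser_is_sol p n k C Bs |}.

(* 6. Z_p-Tucker.  An element of Z_p U {0} is an option nat:           *)
(*    None = 0, Some e (e < p) = omega^e (so omega^p = omega^0).        *)
(*    [s] is represented by 0..s-1.                                     *)

(* input encoding of X : one block of p bits per coordinate (one-hot,
   all-zero for 0) *)
Definition tucker_input (p : nat) (X : seq (option nat)) : seq bool :=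
  flatten (map (fun o => match o with
                         | None => nseq p false
                         | Some e => [seq i == e | i <- iota 0 p]
                         end) X).

Definition tucker_lam (p : nat) (C : circuit) (X : seq (option nat)) : nat * nat :=
  let v := circ_eval C (tucker_input p X) in (nth 0 v 0, nth 0 v 1).

Definition nonzero_vec (p n : nat) (X : seq (option nat)) : Prop :=
  size X = n /\ (forall j e, nth None X j = Some e -> e < p) /\ exists j, nth None X j != None.

Definition omega_mul (p t : nat) (X : seq (option nat)) : seq (option nat) :=
  map (fun o => match o with None => None | Some e => Some ((e + t) %% p) end) X.

Definition vprec (X Y : seq (option nat)) : Prop :=
  forall j, nth None X j != None -> nth None X j = nth None Y j.

Definition tucker_enc (n s : nat) (C : circuit) : seq bool :=
  enc (DList [:: DNat n; DNat s; circuit_data C]).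

(* s <= floor((n-1)/(p-1)) over the integers, i.e. s (p-1) <= n - 1 *)
Definition tucker_valid (p n s : nat) (C : circuit) : Prop :=
  s * (p - 1) + 1 <= n /\ size (c_outs C) = 2 /\
  forall X, nonzero_vec p n X ->
    (tucker_lam p C X).1 < p /\ (tucker_lam p C X).2 < s /\
    forall t, t < p ->
      tucker_lam p C (omega_mul p t X) =
        (((tucker_lam p C X).1 + t) %% p, (tucker_lam p C X).2).

Definition zvec_data (X : seq (option nat)) : data :=
  DList (map (fun o => match o with None => DNat 0 | Some e => DNat e.+1 end) X).

Definition tucker_sol_data (Xs : seq (seq (option nat))) (pi : seq nat) (l : nat) : seq bool :=
  enc (DList [:: DList (map zvec_data Xs); DList (map DNat pi); DNat l]).

Definition tucker_is_sol (p n s : nat) (C : circuit)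
    (Xs : seq (seq (option nat))) (pi : seq nat) (l : nat) : Prop :=
  size Xs = p /\
  (forall t, t < p -> nonzero_vec p n (nth [::] Xs t)) /\
  (forall t, t.+1 < p -> vprec (nth [::] Xs t) (nth [::] Xs t.+1)) /\
  perm_eq pi (iota 0 p) /\ l < s /\
  (forall t, t < p -> tucker_lam p C (nth [::] Xs t) = (nth 0 pi t, l)).

Definition Zp_Tucker (p : nat) : search_problem := {|
  sp_instance := fun x => exists n s C, x = tucker_enc n s C /\ tucker_valid p n s C;
  sp_solution := fun x y => exists n s C, x = tucker_enc n s C /\
       exists Xs pi l, y = tucker_sol_data Xs pi l /\ tucker_is_sol p n s C Xs pi l |}.

(* Main.v *)
(** Read the coordinates of X from left to right and call a position a start of
    the sign e if it carries e and the last nonzero sign before it is not e.  Two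
    starts of the same sign are never consecutive, so the starts of a sign form an
    almost stable set.  If some sign has k starts among the first n coordinates,
    label X by the first sign e that reaches k starts and by the color of these
    starts of e; otherwise label X by its first nonzero sign and by
    m + (alt(X) - 1) / (p - 1), where alt(X) counts all starts.  Take a chain of p
    vectors with distinct signs and a common second label.  If this label is below
    m, the p selected sets are disjoint, because they carry distinct signs in the
    largest vector.  It cannot be m or more: alt is monotone along the chain and
    grows whenever the first sign changes, so it would grow by at least p - 1.
    Without a sign having k starts, alt is at most p (k - 1) plus the number of
    coordinates beyond n, and (k - 1) (p - 2) such coordinates make this bound
    the multiple 2 (k - 1) of p - 1 required by the bound on the number of labels.

    A circuit for the labelling simulates the scan one input bit at a time, as a
    table of multiplexers whose address arithmetic is uniform.  Polynomial time is
    shown by closure properties of the functions computed by programs on finitely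
    many stacks, which a one-tape machine simulates with the stacks interleaved. *)

From Stdlib Require Import ZArith FunctionalExtensionality.
Require Import Defs.
From mathcomp Require Import all_boot zify.
Set Implicit Arguments. Unset Strict Implicit. Unset Printing Implicit Defensive.

(** * Structured one-tape programs *)

(** The label count leaves no slack: [(p - 1) * ncol] may be as large as [n - p * k + p - 1], and
    adding [(p - 1) * nu + 1] then gives exactly [dim]. Without the additional coordinates the
    alternation labels would number the ceiling of [p * (k - 1) / (p - 1)], and the rounding alone
    could violate the bound of the Tucker problem. The labelling has to be printed as a circuit, so
    it depends only on the state of a scan. Taking the first sign to reach [k] starts also avoids
    ties: only one sign can get there at a given coordinate, so the choice commutes with rotating
    the signs and no ordering of the signs is needed. The backward map evaluates no circuit. Since
    every vector of a solution turns out to have a winning sign, this sign is the entry of the given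
    permutation, and the sets are read off the vectors by bounded quantifiers and counting. Numbers
    are encoded in unary, so arithmetic on their values is polynomial in the input, and counting
    loops together with length-bounded iteration suffice for both maps. *)

Definition tape := ((Z -> option bool) * Z)%type.

Definition updz (f : Z -> option bool) (h : Z) (a : option bool) : Z -> option bool :=
  fun z => if Z.eqb z h then a else f z.

Definition mvz (d : move) (h : Z) : Z :=
  match d with MoveL => (h - 1)%Z | MoveR => (h + 1)%Z | Stay => h end.

Inductive wcmd :=
| WSkip
| WAct of (option bool -> option bool) & move
| WSeq of wcmd & wcmd
| WBr of bool & wcmd & wcmd & wcmd & wcmd.

(* [WBr again pre cN c0 c1] runs [pre] and branches on the scanned cell; with
   [again] the branches [c0] and [c1] jump back to [pre]. *)
Inductive wex : wcmd -> tape -> nat -> tape -> Prop :=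
| wex_skip x : wex WSkip x 0 x
| wex_act w d f h : wex (WAct w d) (f, h) 1 (updz f h (w (f h)), mvz d h)
| wex_seq c1 c2 x t1 y t2 z :
    wex c1 x t1 y -> wex c2 y t2 z -> wex (WSeq c1 c2) x (t1 + t2) z
| wex_brN g pre cN c0 c1 x t1 y t2 z :
    wex pre x t1 y -> y.1 y.2 = None -> wex cN y t2 z ->
    wex (WBr g pre cN c0 c1) x (t1 + t2.+2) z
| wex_brS pre cN c0 c1 x t1 y b t2 z :
    wex pre x t1 y -> y.1 y.2 = Some b -> wex (if b then c1 else c0) y t2 z ->
    wex (WBr false pre cN c0 c1) x (t1 + t2.+2) z
| wex_brL pre cN c0 c1 x t1 y b t2 z t3 u :
    wex pre x t1 y -> y.1 y.2 = Some b -> wex (if b then c1 else c0) y t2 z ->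
    wex (WBr true pre cN c0 c1) z t3 u ->
    wex (WBr true pre cN c0 c1) x (t1 + t2.+2 + t3) u.

Definition instr := option bool -> nat * option bool * move.

Definition jmp (n : nat) : instr := fun a => (n, a, Stay).
Definition branch (nN n0 n1 : nat) : instr :=
  fun a => (match a with None => nN | Some false => n0 | Some true => n1 end, a, Stay).

Fixpoint wlen (c : wcmd) : nat :=
  match c with
  | WSkip => 0
  | WAct _ _ => 1
  | WSeq c1 c2 => wlen c1 + wlen c2
  | WBr _ pre cN c0 c1 => wlen pre + (wlen cN + (wlen c0 + (wlen c1).+1).+1).+2
  end.

(** Jump targets are absolute: [s] is the address of the first instruction, and control always
    leaves a block at the address following it. *)
Fixpoint wcode (c : wcmd) (s : nat) : seq instr :=
  match c with
  | WSkip => [::]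
  | WAct w d => [:: fun a => (s.+1, w a, d)]
  | WSeq c1 c2 => wcode c1 s ++ wcode c2 (s + wlen c1)
  | WBr g pre cN c0 c1 =>
      let sN := (s + wlen pre).+1 in
      let s0 := (sN + wlen cN).+1 in
      let s1 := (s0 + wlen c0).+1 in
      let e := (s1 + wlen c1).+1 in
      let back := if g then s else e in
      wcode pre s ++ branch sN s0 s1 :: wcode cN sN ++ jmp e ::
      wcode c0 s0 ++ jmp back :: wcode c1 s1 ++ [:: jmp back]
  end.

Lemma size_wcode c s : size (wcode c s) = wlen c.
Proof.
elim: c s => //= [c1 IH1 c2 IH2|g pre IHp cN IHN c0 IH0 c1 IH1] s.
  by rewrite size_cat IH1 IH2.
by do 5! rewrite ?size_cat /= ?(IHp, IHN, IH0, IH1) /=; lia.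
Qed.

(** The halting state is the address just past the code, so a program halts by running off its
    end. *)
Definition mach (code : seq instr) : TM :=
  {| tm_nq := size code;
     tm_delta := fun q a => let: (s, w, d) := nth (jmp 0) code q a in (inord s, w, d);
     tm_halt := fun q => q == size code :> nat |}.

(** Missing list entries read as blanks, which makes trailing blanks irrelevant; configurations need
    no normal form. *)
Definition rep (l r : seq (option bool)) (x : tape) : Prop :=
  (forall i, nth None r i = x.1 (x.2 + Z.of_nat i)%Z) /\
  (forall i, nth None l i = x.1 (x.2 - 1 - Z.of_nat i)%Z).

Definition reach (code : seq instr) (t s : nat) (x : tape) (s' : nat) (x' : tape) : Prop :=
  forall l r, rep l r x -> exists l' r',
    iter t (tm_step (mach code)) (inord s, l, r) = (inord s', l', r') /\ rep l' r' x'.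

Lemma reach0 code s x : reach code 0 s x s x.
Proof. by move=> l r H; exists l, r. Qed.

Lemma reach_trans code t1 t2 s1 s2 s3 x1 x2 x3 :
  reach code t1 s1 x1 s2 x2 -> reach code t2 s2 x2 s3 x3 ->
  reach code (t1 + t2) s1 x1 s3 x3.
Proof.
move=> H1 H2 l r /H1[l1 [r1 [E1 /H2[l2 [r2 [E2 R]]]]]].
by exists l2, r2; split=> //; rewrite addnC iterD E1.
Qed.

Lemma reach_step code s s' w d x :
  s < size code -> nth (jmp 0) code s (x.1 x.2) = (s', w, d) ->
  reach code 1 s x s' (updz x.1 x.2 w, mvz d x.2).
Proof.
case: x => f h Hs E l r [Hr Hl]; move: E Hr Hl; rewrite /fst /snd => E Hr Hl.
have E0 : head None r = f h by rewrite -nth0 Hr; congr f; lia.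
have Eb i : nth None (behead r) i = f (h + 1 + Z.of_nat i)%Z.
  by rewrite nth_behead Hr; congr f; lia.
have st : tm_step (mach code) (inord s, l, r) =
    match d with
    | MoveL => match l with
               | [::] => (inord s', [::], None :: w :: behead r)
               | a :: l' => (inord s', l', a :: w :: behead r)
               end
    | MoveR => (inord s', w :: l, behead r)
    | Stay => (inord s', l, w :: behead r)
    end.
  by rewrite /tm_step /= inordK ?ltnS 1?ltnW // (ltn_eqF Hs) E0 E.
rewrite /iter st; case: d {st E} => /=.
(* At the left end of the list the machine creates a blank, which the infinite tape already has
   there. *)
- case: l Hl => [|a l] Hl.
    exists [::], (None :: w :: behead r); split=> //; split=> -[|[|i]] /=.
    + rewrite /updz; case: Z.eqb_spec => [|_]; first by lia.
      by have := Hl 0 => /= ->; congr f; lia.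
    + by rewrite /updz; case: Z.eqb_spec => //; lia.
    + rewrite Eb /updz; case: Z.eqb_spec => [|_]; first by lia.
      by congr f; lia.
    + rewrite /updz; case: Z.eqb_spec => [|_]; first by lia.
      by have := Hl 1 => /= ->; congr f; lia.
    + rewrite /updz; case: Z.eqb_spec => [|_]; first by lia.
      by have := Hl 2 => /= ->; congr f; lia.
    + rewrite /updz; case: Z.eqb_spec => [|_]; first by lia.
      by have := Hl i.+3 => /= ->; congr f; lia.
  exists l, (a :: w :: behead r); split=> //; split=> [[|[|i]]|i] /=.
  + rewrite /updz; case: Z.eqb_spec => [|_]; first by lia.
    by have := Hl 0 => /= ->; congr f; lia.
  + by rewrite /updz; case: Z.eqb_spec => //; lia.
  + rewrite Eb /updz; case: Z.eqb_spec => [|_]; first by lia.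
    by congr f; lia.
  + rewrite /updz; case: Z.eqb_spec => [|_]; first by lia.
    by have := Hl i.+1 => /= ->; congr f; lia.
- exists (w :: l), (behead r); split=> //; split=> [i|[|i]] /=.
  + rewrite Eb /updz; case: Z.eqb_spec => [|_]; first by lia.
    by congr f; lia.
  + by rewrite /updz; case: Z.eqb_spec => //; lia.
  + rewrite Hl /updz; case: Z.eqb_spec => [|_]; first by lia.
    by congr f; lia.
- exists l, (w :: behead r); split=> //; split=> [[|i]|i] /=.
  + by rewrite /updz; case: Z.eqb_spec => //; lia.
  + rewrite Eb /updz; case: Z.eqb_spec => [|_]; first by lia.
    by congr f; lia.
  + rewrite Hl /updz; case: Z.eqb_spec => [|_]; first by lia.
    by congr f; lia.
Qed.

Definition emb (code : seq instr) (s : nat) (L : seq instr) : Prop :=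
  exists P Q, code = P ++ L ++ Q /\ size P = s.

Lemma emb_cat code s L1 L2 :
  emb code s (L1 ++ L2) -> emb code s L1 /\ emb code (s + size L1) L2.
Proof.
case=> P [Q [-> <-]]; split; first by exists P, (L2 ++ Q); rewrite -catA.
by exists (P ++ L1), Q; rewrite size_cat -!catA.
Qed.

Lemma emb_cons code s i L : emb code s (i :: L) ->
  [/\ s < size code, nth (jmp 0) code s = i & emb code s.+1 L].
Proof.
case=> P [Q [-> <-]]; split; first by rewrite size_cat /= -addSnnS leq_addr.
  by rewrite nth_cat ltnn subnn.
by exists (rcons P i), Q; rewrite size_rcons cat_rcons.
Qed.

Lemma updz_id f h : updz f h (f h) = f.
Proof. by apply: functional_extensionality => z; rewrite /updz; case: Z.eqb_spec => [->|]. Qed.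

Lemma reach_goto code s i s' x :
  s < size code -> nth (jmp 0) code s = i -> i (x.1 x.2) = (s', x.1 x.2, Stay) ->
  reach code 1 s x s' x.
Proof.
move=> Hs E H; rewrite -E in H; have := reach_step Hs H.
by rewrite updz_id /=; case: x {H}.
Qed.

(** Induction on the execution with the position of the block left free. The two additional steps of
    a branch are the test and the jump closing the chosen block; in a loop this jump leads back to
    [s], where the induction hypothesis for the rest of the loop applies. *)
Lemma wex_sound c x t y : wex c x t y -> forall code s,
  emb code s (wcode c s) -> reach code t s x (s + wlen c) y.
Proof.
elim=> {c x t y}.
- by move=> x code s _ /=; rewrite addn0; apply: reach0.
- move=> w d f h code s /emb_cons[Hs E _] /=; rewrite addn1.
  by apply: (reach_step (x := (f, h)) Hs); rewrite E.
- move=> c1 c2 x t1 y t2 z _ IH1 _ IH2 code s /= /emb_cat[E1].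
  rewrite size_wcode addnA => E2.
  by apply: reach_trans (IH2 _ _ E2); apply: IH1.
- move=> g pre cN c0 c1 x t1 y t2 z _ IHp Ey _ IHN code s /= /emb_cat[E1].
  rewrite size_wcode => /emb_cons[H2 E2] /emb_cat[E3].
  rewrite size_wcode => /emb_cons[H4 E4 _].
  apply: reach_trans; first exact: IHp E1.
  have -> : t2.+2 = 1 + t2 + 1 by lia.
  apply: reach_trans; last by apply: (reach_goto H4 E4); rewrite /jmp; congr (_, _, _); lia.
  apply: reach_trans (IHN _ _ E3).
  by apply: (reach_goto H2 E2); rewrite /branch Ey.
- move=> pre cN c0 c1 x t1 y b t2 z _ IHp Ey _ IHb code s /= /emb_cat[E1].
  rewrite size_wcode => /emb_cons[H2 E2] /emb_cat[_].
  rewrite size_wcode => /emb_cons[_ _] /emb_cat[E3].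
  rewrite size_wcode => /emb_cons[H4 E4] /emb_cat[E5].
  rewrite size_wcode => /emb_cons[H6 E6 _].
  apply: reach_trans; first exact: IHp E1.
  have -> : t2.+2 = 1 + t2 + 1 by lia.
  case: b Ey IHb => Ey IHb.
    apply: reach_trans; last by apply: (reach_goto H6 E6); rewrite /jmp; congr (_, _, _); lia.
    by apply: reach_trans (IHb _ _ E5); apply: (reach_goto H2 E2); rewrite /branch Ey.
  apply: reach_trans; last by apply: (reach_goto H4 E4); rewrite /jmp; congr (_, _, _); lia.
  by apply: reach_trans (IHb _ _ E3); apply: (reach_goto H2 E2); rewrite /branch Ey.
- move=> pre cN c0 c1 x t1 y b t2 z t3 u _ IHp Ey _ IHb _ IHl code s E.
  apply: reach_trans (IHl _ _ E).
  move: E => /= /emb_cat[E1].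
  rewrite size_wcode => /emb_cons[H2 E2] /emb_cat[_].
  rewrite size_wcode => /emb_cons[_ _] /emb_cat[E3].
  rewrite size_wcode => /emb_cons[H4 E4] /emb_cat[E5].
  rewrite size_wcode => /emb_cons[H6 E6 _].
  apply: reach_trans; first exact: IHp E1.
  have -> : t2.+2 = 1 + t2 + 1 by lia.
  case: b Ey IHb => Ey IHb.
    apply: reach_trans; last by apply: (reach_goto H6 E6).
    by apply: reach_trans (IHb _ _ E5); apply: (reach_goto H2 E2); rewrite /branch Ey.
  apply: reach_trans; last by apply: (reach_goto H4 E4).
  by apply: reach_trans (IHb _ _ E3); apply: (reach_goto H2 E2); rewrite /branch Ey.
Qed.

(** * Stack programs *)

Definition regs := nat -> seq bool.

Definition upd (s : regs) (r : nat) (w : seq bool) : regs := fun x => if x == r then w else s x.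

Inductive scmd :=
| SSkip
| SPush of nat & bool
| SSeq of scmd & scmd
| SBr of bool & nat & scmd & scmd & scmd.

(* [SBr again r cN c0 c1] pops register [r] and branches on the result; with
   [again] it is repeated until [r] is empty. *)
Inductive sex : scmd -> regs -> nat -> regs -> Prop :=
| sex_skip s : sex SSkip s 0 s
| sex_push r b s : sex (SPush r b) s 1 (upd s r (b :: s r))
| sex_seq c1 c2 s1 t1 s2 t2 s3 :
    sex c1 s1 t1 s2 -> sex c2 s2 t2 s3 -> sex (SSeq c1 c2) s1 (t1 + t2) s3
| sex_brN g r cN c0 c1 s t s' :
    s r = [::] -> sex cN s t s' -> sex (SBr g r cN c0 c1) s t.+1 s'
| sex_brS r cN c0 c1 s b w t s' :
    s r = b :: w -> sex (if b then c1 else c0) (upd s r w) t s' ->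
    sex (SBr false r cN c0 c1) s t.+1 s'
| sex_brL r cN c0 c1 s b w t s' t' s'' :
    s r = b :: w -> sex (if b then c1 else c0) (upd s r w) t s' ->
    sex (SBr true r cN c0 c1) s' t' s'' ->
    sex (SBr true r cN c0 c1) s (t + t').+1 s''.

Fixpoint smax (c : scmd) : nat :=
  match c with
  | SSkip => 0
  | SPush r _ => r.+1
  | SSeq c1 c2 => maxn (smax c1) (smax c2)
  | SBr _ r cN c0 c1 => maxn r.+1 (maxn (smax cN) (maxn (smax c0) (smax c1)))
  end.

(** A step pushes at most one bit. This turns time bounds into bounds on the stack heights, on which
    the cost of the simulation depends. *)
Lemma sex_size c s t s' : sex c s t s' -> forall r, size (s' r) <= size (s r) + t.
Proof.
have H s0 r0 w b r : s0 r0 = b :: w -> size (upd s0 r0 w r) <= size (s0 r).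
  by rewrite /upd; case: eqP => // -> ->.
elim=> {c s t s'} //=.
- by move=> s r; rewrite addn0.
- by move=> r b s r'; rewrite /upd; case: eqP => [->|_] /=; rewrite addn1.
- by move=> c1 c2 s1 t1 s2 t2 s3 _ H1 _ H2 r; move: (H1 r) (H2 r); lia.
- by move=> g r cN c0 c1 s t s' _ _ H1 r'; move: (H1 r'); lia.
- by move=> r cN c0 c1 s b w t s' E _ H1 r'; move: (H1 r') (H _ _ _ _ r' E); lia.
- move=> r cN c0 c1 s b w t s' t' s'' E _ H1 _ H2 r'.
  by move: (H1 r') (H2 r') (H _ _ _ _ r' E); lia.
Qed.

Definition wexle (c : wcmd) (x : tape) (t : nat) (y : tape) : Prop :=
  exists2 t', t' <= t & wex c x t' y.

Lemma wexle_seq c1 c2 x t1 y t2 z t :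
  wexle c1 x t1 y -> wexle c2 y t2 z -> t1 + t2 <= t -> wexle (WSeq c1 c2) x t z.
Proof.
case=> u1 h1 e1 [u2 h2 e2] h; exists (u1 + u2); last exact: wex_seq e1 e2.
by apply: leq_trans h; apply: leq_add.
Qed.

Lemma wexle_leq c x t1 t2 y : wexle c x t1 y -> t1 <= t2 -> wexle c x t2 y.
Proof. by case=> u h e h2; exists u => //; apply: leq_trans h2. Qed.

Fixpoint wmoves (n : nat) (d : move) : wcmd :=
  if n is n'.+1 then WSeq (WAct id d) (wmoves n' d) else WSkip.

Lemma wexle_move d f h : wexle (WAct id d) (f, h) 1 (f, mvz d h).
Proof. by exists 1 => //; have := wex_act id d f h; rewrite updz_id. Qed.

Lemma wexle_movesL n f h : wexle (wmoves n MoveL) (f, h) n (f, h - Z.of_nat n)%Z.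
Proof.
elim: n h => [|n IH] h; first by exists 0 => //; rewrite Z.sub_0_r; constructor.
have -> : (h - Z.of_nat n.+1 = h - 1 - Z.of_nat n)%Z by lia.
exact: wexle_seq (wexle_move MoveL f h) (IH _) _.
Qed.

Lemma wexle_movesR n f h : wexle (wmoves n MoveR) (f, h) n (f, h + Z.of_nat n)%Z.
Proof.
elim: n h => [|n IH] h; first by exists 0 => //; rewrite Z.add_0_r; constructor.
have -> : (h + Z.of_nat n.+1 = h + 1 + Z.of_nat n)%Z by lia.
exact: wexle_seq (wexle_move MoveR f h) (IH _) _.
Qed.

Definition wwhile (c : wcmd) : wcmd := WBr true WSkip WSkip c c.

Lemma wexle_while0 c f h : f h = None -> wexle (wwhile c) (f, h) 2 (f, h).
Proof.
move=> E; exists (0 + 0.+2) => //.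
by apply: wex_brN (wex_skip _) _ (wex_skip _).
Qed.

Lemma wexle_whileS c f h t1 y t2 z t : f h <> None ->
  wexle c (f, h) t1 y -> wexle (wwhile c) y t2 z -> t1 + t2 + 2 <= t ->
  wexle (wwhile c) (f, h) t z.
Proof.
case E: (f h) => [b|] // _ [u1 h1 e1] [u2 h2 e2] ht.
exists (0 + u1.+2 + u2); first by lia.
by apply: (wex_brL (b := b) (t2 := u1) (wex_skip _) _ _ e2) => //; rewrite if_same.
Qed.

(** * Stacks interleaved on one tape *)

Section Layout.
Variable K : nat.

(* Register [r] occupies the cells [lv r 1], [lv r 2], ... from bottom to top,
   and [lv r 0] stays blank. Register 0 holds the input and the output at the
   nonnegative cells, the others are interleaved with stride [K] to the left. *)
Definition lv (r i : nat) : Z :=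
  (- Z.of_nat r.+1 + (if r == 0%N then 1 else - Z.of_nat K) * Z.of_nat i)%Z.

(** The head of the list is the top of the stack and lies farthest from the blank base, so a push or
    a pop changes a single cell. *)
Definition col (w : seq bool) : seq (option bool) := None :: map Some (rev w).

Definition srep (s : regs) (f : Z -> option bool) : Prop :=
  forall r i, r < K -> f (lv r i) = nth None (col (s r)) i.

(** Register 0 uses the cells from -1 on; the others lie below -1 and differ by their residues
    modulo [K]. *)
Lemma lv_inj r i r' i' : r < K -> r' < K -> lv r i = lv r' i' -> r = r' /\ i = i'.
Proof.
rewrite /lv; case: eqP => [->|r0]; case: eqP => [->|r0'] rK rK' E.
- by split=> //; lia.
- by have := Z.mul_nonneg_nonneg (Z.of_nat K) (Z.of_nat i'); lia.
- by have := Z.mul_nonneg_nonneg (Z.of_nat K) (Z.of_nat i); lia.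
- case: (ltngtP i i') => Hi.
  + have : (Z.of_nat K * (Z.of_nat i + 1) <= Z.of_nat K * Z.of_nat i')%Z
      by apply: Z.mul_le_mono_nonneg_l; lia.
    by lia.
  + have : (Z.of_nat K * (Z.of_nat i' + 1) <= Z.of_nat K * Z.of_nat i)%Z
      by apply: Z.mul_le_mono_nonneg_l; lia.
    by lia.
  + by subst i'; split=> //; lia.
Qed.

Definition fwd (r : nat) : wcmd := if r == 0 then WAct id MoveR else wmoves K MoveL.
Definition bwd (r : nat) : wcmd := if r == 0 then WAct id MoveL else wmoves K MoveR.

Lemma lvS r i : lv r i.+1 = (lv r i + if r == 0%N then 1 else - Z.of_nat K)%Z.
Proof. by rewrite /lv; case: eqP => _; lia. Qed.

Lemma wexle_fwd r f i : r < K -> wexle (fwd r) (f, lv r i) K (f, lv r i.+1).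
Proof.
move=> rK; rewrite /fwd lvS; case: eqP => r0; last exact: wexle_movesL.
by apply: wexle_leq (leq_ltn_trans (leq0n r) rK); apply: wexle_move.
Qed.

Lemma wexle_bwd r f i : r < K -> wexle (bwd r) (f, lv r i.+1) K (f, lv r i).
Proof.
move=> rK; rewrite /bwd; have := lvS r i; case: eqP => r0 E.
  apply: wexle_leq (leq_ltn_trans (leq0n r) rK).
  have -> : lv r i = mvz MoveL (lv r i.+1) by rewrite E /=; lia.
  exact: wexle_move.
have -> : lv r i = (lv r i.+1 + Z.of_nat K)%Z by rewrite E; lia.
exact: wexle_movesR.
Qed.

Lemma wexle_up r f m i : r < K ->
  (forall j, j < m -> f (lv r (i + j)) <> None) -> f (lv r (i + m)) = None ->
  wexle (wwhile (fwd r)) (f, lv r i) (m * (K + 2) + 2) (f, lv r (i + m)).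
Proof.
move=> rK; elim: m i => [|m IH] i Hj Hm.
  by rewrite addn0 in Hm *; apply: wexle_while0.
apply: wexle_whileS (wexle_fwd f i rK) _ _.
- by have := Hj 0 isT; rewrite addn0.
- rewrite addnS -addSn; apply: IH; last by rewrite addSnnS.
  by move=> j jm; rewrite addSnnS; apply: Hj.
- by rewrite mulSn; lia.
Qed.

Lemma wexle_down r f i : r < K ->
  (forall j, j < i -> f (lv r j.+1) <> None) -> f (lv r 0) = None ->
  wexle (wwhile (bwd r)) (f, lv r i) (i * (K + 2) + 2) (f, lv r 0).
Proof.
move=> rK; elim: i => [|i IH] Hj H0; first exact: wexle_while0.
apply: wexle_whileS (wexle_bwd f i rK) _ _.
- exact: Hj.
- by apply: IH => // j ji; apply: Hj; apply: ltnW.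
- by rewrite mulSn; lia.
Qed.

(** The base is blank, so the search for a blank starts one cell further. Stepping back from the
    blank found leads to the top entry, or to the base if the stack is empty; the scanned cell thus
    tells the two cases apart. *)
Definition goto_top (r : nat) : wcmd :=
  WSeq (wmoves r MoveL) (WSeq (fwd r) (WSeq (wwhile (fwd r)) (bwd r))).

Definition ret (r : nat) : wcmd := WSeq (wwhile (bwd r)) (wmoves r MoveR).

Definition opcost (h : nat) : nat := (2 * h + 8) * (K + 2).

Lemma col_some w j : j < size w -> nth None (col w) j.+1 <> None.
Proof.
by move=> jw; rewrite /= (nth_map false) // size_rev.
Qed.

Lemma col_none w j : size w < j -> nth None (col w) j = None.
Proof. by move=> jw; rewrite nth_default //= size_map size_rev. Qed.

Lemma wexle_goto_top r f w : r < K -> (forall i, f (lv r i) = nth None (col w) i) ->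
  wexle (goto_top r) (f, -1)%Z ((size w + 3) * (K + 2)) (f, lv r (size w)).
Proof.
move=> rK Hf.
apply: wexle_seq (wexle_movesL r f (-1)%Z) _ _.
  have -> : (-1 - Z.of_nat r = lv r 0)%Z by rewrite /lv; case: eqP; lia.
  apply: wexle_seq (wexle_fwd f 0 rK) _ (leqnn _).
  apply: wexle_seq (@wexle_up r f (size w) 1 rK _ _) (wexle_bwd f _ rK) (leqnn _).
  + by move=> j jw; rewrite add1n Hf; apply: col_some.
  + by rewrite add1n Hf; apply: col_none.
by rewrite mulnDl; lia.
Qed.

Lemma wexle_ret r f i : r < K ->
  (forall j, j < i -> f (lv r j.+1) <> None) -> f (lv r 0) = None ->
  wexle (ret r) (f, lv r i) ((i + 1) * (K + 2)) (f, -1)%Z.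
Proof.
move=> rK Hi H0; apply: wexle_seq (wexle_down rK Hi H0) _ _.
  have -> : (-1 = lv r 0 + Z.of_nat r)%Z by rewrite /lv; case: eqP; lia.
  exact: wexle_movesR.
by rewrite mulnDl; lia.
Qed.

Lemma srep_upd s f r i a w : r < K -> srep s f ->
  (forall j, nth None (col w) j = if j == i then a else nth None (col (s r)) j) ->
  srep (upd s r w) (updz f (lv r i) a).
Proof.
move=> rK Hs Hw r' j rK'; rewrite /updz /upd.
case: Z.eqb_spec => [/(lv_inj rK' rK)[-> ->]|H]; first by rewrite eqxx Hw eqxx.
case: eqP H => [->|_] H; last exact: Hs.
by rewrite Hw; case: eqP H => [->|_ _] //; apply: Hs.
Qed.

Definition wpush (r : nat) (b : bool) : wcmd :=
  WSeq (goto_top r) (WSeq (fwd r) (WSeq (WAct (fun=> Some b) Stay) (ret r))).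

Definition werase (r : nat) : wcmd :=
  WSeq (WAct (fun=> None) Stay) (WSeq (bwd r) (ret r)).

Lemma srep_push s f r b : r < K -> srep s f ->
  srep (upd s r (b :: s r)) (updz f (lv r (size (s r)).+1) (Some b)).
Proof.
move=> rK Hs; apply: srep_upd => // -[|j] //.
rewrite /= rev_cons map_rcons nth_rcons size_map size_rev eqSS.
by case: ltngtP => // jw; rewrite nth_default // size_map size_rev; apply: ltnW.
Qed.

Lemma srep_pop s f r b w : r < K -> s r = b :: w -> srep s f ->
  srep (upd s r w) (updz f (lv r (size w).+1) None).
Proof.
move=> rK E Hs; apply: srep_upd => // -[|j] //.
rewrite /= E rev_cons map_rcons nth_rcons size_map size_rev eqSS.
by case: ltngtP => // jw; rewrite nth_default // size_map size_rev // ?jw // ltnW.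
Qed.

Lemma wexle_push s f r b : r < K -> srep s f ->
  wexle (wpush r b) (f, -1)%Z (opcost (size (s r)))
    (updz f (lv r (size (s r)).+1) (Some b), -1)%Z.
Proof.
move=> rK Hs; have Hp := srep_push b rK Hs.
apply: wexle_seq (wexle_goto_top rK (fun i => Hs r i rK)) _ _.
  apply: wexle_seq (wexle_fwd f _ rK) _ (leqnn _).
  apply: (@wexle_seq _ _ _ 1 _ _ _ _ _ _ (leqnn _)).
    by exists 1 => //; apply: (wex_act (fun=> Some b) Stay).
  apply: (@wexle_ret r _ _ rK); last by rewrite Hp // /upd eqxx.
  by move=> j jw; rewrite Hp // /upd eqxx; apply: col_some.
rewrite /opcost !mulnDl; lia.
Qed.

Lemma wexle_erase s f r b w : r < K -> s r = b :: w -> srep s f ->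
  wexle (werase r) (f, lv r (size w).+1) ((size w + 2) * (K + 2))
    (updz f (lv r (size w).+1) None, -1)%Z.
Proof.
move=> rK E Hs; have Hp := srep_pop rK E Hs.
apply: (@wexle_seq _ _ _ 1 _ _ _ _).
- by exists 1 => //; apply: (wex_act (fun=> None) Stay).
- apply: wexle_seq (wexle_bwd _ _ rK) _ (leqnn _).
  apply: (@wexle_ret r _ _ rK); last by rewrite Hp // /upd eqxx.
  by move=> j jw; rewrite Hp // /upd eqxx; apply: col_some.
by rewrite !mulnDl; lia.
Qed.

Fixpoint compile (c : scmd) : wcmd :=
  match c with
  | SSkip => WSkip
  | SPush r b => wpush r b
  | SSeq c1 c2 => WSeq (compile c1) (compile c2)
  | SBr g r cN c0 c1 =>
      WBr g (goto_top r) (WSeq (wmoves r MoveR) (compile cN))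
        (WSeq (werase r) (compile c0)) (WSeq (werase r) (compile c1))
  end.

Lemma opcost_leq h1 h2 : h1 <= h2 -> opcost h1 <= opcost h2.
Proof. by move=> h; rewrite /opcost leq_mul2r; lia. Qed.

Lemma opcost_add h t1 t2 t : t1 + t2 <= t ->
  t1 * opcost (h + t1) + t2 * opcost (h + t1 + t2) <= t * opcost (h + t).
Proof.
move=> ht; apply: (@leq_trans ((t1 + t2) * opcost (h + t))).
  by rewrite mulnDl leq_add // leq_mul2l opcost_leq ?orbT //; lia.
by rewrite leq_mul2r ht orbT.
Qed.

(** Between commands the head rests at -1, the base of register 0. All heights stay at most [h + t],
    so each of the [t] stack steps costs at most [opcost (h + t)], and [opcost_add] lets these
    bounds add up along sequences and loops. *)
Lemma compile_sound c s t s' : sex c s t s' -> smax c <= K ->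
  forall h f, (forall r, size (s r) <= h) -> srep s f ->
  exists2 f', srep s' f' & wexle (compile c) (f, -1)%Z (t * opcost (h + t)) (f', -1)%Z.
Proof.
have popsz s0 r w b h : s0 r = b :: w -> (forall r, size (s0 r) <= h) ->
    forall r', size (upd s0 r w r') <= h.
  move=> E H r'; rewrite /upd; case: eqP => // _.
  by apply: leq_trans (H r); rewrite E.
elim=> {c s t s'} /=.
- by move=> s _ h f _ Hs; exists f => //; exists 0 => //; constructor.
- move=> r b s rK h f Hh Hs; exists (updz f (lv r (size (s r)).+1) (Some b)).
    exact: srep_push.
  apply: wexle_leq (wexle_push b rK Hs) _; rewrite mul1n; apply: opcost_leq.
  by rewrite addn1; apply: leqW.
- move=> c1 c2 s1 t1 s2 t2 s3 e1 IH1 _ IH2; rewrite geq_max => /andP[K1 K2] h f Hh Hs.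
  have [f1 Hs1 W1] := IH1 K1 h f Hh Hs.
  have Hh1 r : size (s2 r) <= h + t1.
    by apply: leq_trans (sex_size e1 r) _; rewrite leq_add2r.
  have [f2 Hs2 W2] := IH2 K2 _ f1 Hh1 Hs1.
  by exists f2 => //; apply: wexle_seq W1 W2 _; apply: opcost_add.
- move=> g r cN c0 c1 s t s' E _ IH; rewrite !geq_max => /and4P[rK KN _ _] h f Hh Hs.
  have [f1 Hs1 [u1 hu1 W1]] := IH KN h f Hh Hs.
  exists f1 => //.
  have [u2 hu2 W2] := wexle_goto_top rK (fun i => Hs r i rK).
  have [u3 hu3 W3] := wexle_movesR r f (lv r 0).
  have E0 : (lv r 0 + Z.of_nat r = -1)%Z by rewrite /lv; case: eqP; lia.
  rewrite E0 in W3; rewrite E /= in W2 hu2.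
  exists (u2 + (u3 + u1).+2).
    rewrite mulSn; apply: (@leq_trans (opcost (h + t.+1) + t * opcost (h + t))).
      rewrite {1}/opcost !mulnDl; lia.
    by rewrite leq_add2l leq_mul2l opcost_leq ?orbT //; lia.
  apply: wex_brN W2 _ (wex_seq W3 W1).
  by rewrite /= Hs //.
- move=> r cN c0 c1 s b w t s' E _ IH; rewrite !geq_max => /and4P[rK _ K0 K1] h f Hh Hs.
  have Hp := srep_pop rK E Hs.
  have Hw : (size w).+1 <= h by have := Hh r; rewrite E.
  have [|f1 Hs1 [u1 hu1 W1]] := IH _ h _ (popsz _ _ _ _ _ E Hh) Hp; first by case: (b).
  exists f1 => //.
  have [u2 hu2 W2] := wexle_goto_top rK (fun i => Hs r i rK).
  have [u3 hu3 W3] := wexle_erase rK E Hs.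
  rewrite E /= in W2 hu2.
  exists (u2 + (u3 + u1).+2).
    rewrite mulSn; apply: (@leq_trans (opcost (h + t.+1) + t * opcost (h + t))).
      have : (size w).+1 * (K + 2) <= h * (K + 2) by rewrite leq_mul2r Hw orbT.
      rewrite {1}/opcost !mulnDl !mulSn; lia.
    by rewrite leq_add2l leq_mul2l opcost_leq ?orbT //; lia.
  apply: (wex_brS _ (b := b) W2); first by rewrite /= Hs // E /= rev_cons map_rcons nth_rcons size_map size_rev ltnn eqxx.
  by case: (b) W1 => W1; apply: wex_seq W3 W1.
- move=> r cN c0 c1 s b w t s' t' s'' E e1 IH1 _ IH2 HK h f Hh Hs.
  move: (HK); rewrite !geq_max => /and4P[rK _ K0 K1].
  have Hp := srep_pop rK E Hs.
  have Hw : (size w).+1 <= h by have := Hh r; rewrite E.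
  have [|f1 Hs1 [u1 hu1 W1]] := IH1 _ h _ (popsz _ _ _ _ _ E Hh) Hp; first by case: (b).
  have Hh1 r' : size (s' r') <= h + t.
    by apply: leq_trans (sex_size e1 r') _; rewrite leq_add2r (popsz _ _ _ _ _ E Hh).
  have [f2 Hs2 [u4 hu4 W4]] := IH2 HK _ f1 Hh1 Hs1.
  exists f2 => //.
  have [u2 hu2 W2] := wexle_goto_top rK (fun i => Hs r i rK).
  have [u3 hu3 W3] := wexle_erase rK E Hs.
  rewrite E /= in W2 hu2.
  exists (u2 + (u3 + u1).+2 + u4).
    rewrite mulSn; apply: (@leq_trans (opcost (h + (t + t').+1) + (t * opcost (h + t) + t' * opcost (h + t + t')))).
      have : (size w).+1 * (K + 2) <= h * (K + 2) by rewrite leq_mul2r Hw orbT.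
      rewrite {1}/opcost !mulnDl !mulSn; lia.
    rewrite leq_add2l; apply: leq_trans (opcost_add _ (leqnn _)) _.
    by rewrite leq_mul2l opcost_leq ?orbT //; lia.
  apply: (wex_brL (b := b) W2 _ _ W4); first by rewrite /= Hs // E /= rev_cons map_rcons nth_rcons size_map size_rev ltnn eqxx.
  by case: (b) W1 => W1; apply: wex_seq W3 W1.
Qed.

End Layout.

(** * Polynomial bounds and the passage to Turing machines *)

Definition polyb (g : nat -> nat) : Prop := exists B, forall n, g n <= (n + 2) ^ B.

Lemma polyb_leq g h : polyb g -> (forall n, h n <= g n) -> polyb h.
Proof. by case=> B H E; exists B => n; apply: leq_trans (E n) (H n). Qed.

Lemma leq_expl m n e : m <= n -> m ^ e <= n ^ e.
Proof. by case: e => // e mn; rewrite leq_exp2r. Qed.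

Lemma polyb_const c : polyb (fun=> c).
Proof.
exists c => n; apply: leq_trans (ltnW (ltn_expl c (isT : 1 < 2))) _.
by apply: leq_expl; lia.
Qed.

Lemma polyb_id : polyb id.
Proof. by exists 1 => n; rewrite expn1 leq_addr. Qed.

Lemma polyb_mul g h : polyb g -> polyb h -> polyb (fun n => g n * h n).
Proof. by case=> B H [C H']; exists (B + C) => n; rewrite expnD leq_mul. Qed.

Lemma polyb_add g h : polyb g -> polyb h -> polyb (fun n => g n + h n).
Proof.
case=> B H [C H']; exists (B + C).+1 => n.
have E k : k <= B + C -> (n + 2) ^ k <= (n + 2) ^ (B + C) by move=> ?; rewrite leq_pexp2l //; lia.
have := E B; have := E C; rewrite leq_addr leq_addl expnS => /(_ isT) h1 /(_ isT) h2.
apply: leq_trans (leq_add (leq_trans (H n) h2) (leq_trans (H' n) h1)) _.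
by rewrite addnn -mul2n leq_mul2r; lia.
Qed.

Lemma polyb_pow g B : polyb g -> polyb (fun n => g n ^ B).
Proof.
move=> Hg; elim: B => [|B IH]; first exact: polyb_const.
by apply: polyb_leq (polyb_mul Hg IH) _ => n; rewrite expnS.
Qed.

Ltac polyb := repeat first
  [ exact: polyb_id | exact: polyb_const | apply: polyb_add | apply: polyb_mul
  | apply: polyb_pow | assumption ].

(** Bounds are kept as powers of [n + 2] because a base of at least 2 absorbs constants and sums
    into the exponent. For positive [n] the conversion uses [n + 2 <= 3 * n]; for [n = 0] the
    additive constant suffices. *)
Lemma poly_bound_geq B n : (n + 2) ^ B <= poly_bound (3 ^ B) n.
Proof.
have hB : B <= 3 ^ B by apply: ltnW; apply: ltn_expl.
rewrite /poly_bound; case: n => [|n].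
  by rewrite add0n; apply: leq_trans (leq_addl _ _); apply: leq_expl.
apply: leq_trans (leq_addr _ _).
apply: (@leq_trans ((3 * n.+1) ^ B)); first by apply: leq_expl; lia.
by rewrite expnMn leq_mul2l leq_pexp2l ?orbT.
Qed.

Lemma out_bits_some r y : (forall i, nth None r i = nth None (map Some y) i) -> out_bits r = y.
Proof.
elim: y r => [|b y IH] [|a r] H //=.
- by have := H 0 => /= ->.
- by have := H 0.
- by have := H 0 => /= ->; rewrite IH // => i; have := H i.+1.
Qed.

(** The initial tape already represents register 0 with content [rev x] and all other registers
    empty, and the output is read from the same cells; only the head has to pass from cell 0 to -1
    and back. *)
Lemma stack_tm (c : scmd) (F : seq bool -> seq bool) (g : nat -> nat) : polyb g ->
  (forall x, exists t s, [/\ t <= g (size x),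
     sex c (upd (fun=> [::]) 0 (rev x)) t s & s 0 = rev (F x)]) ->
  exists (M : TM) (B : nat), forall x, tm_computes_on M (poly_bound B (size x)) x (F x).
Proof.
move=> Hg Hc; set K := (smax c).+1.
set w := WSeq (WAct id MoveL) (WSeq (compile K c) (WAct id MoveR)).
have [B HB] : polyb (fun n => 2 + g n * opcost K (n + g n)) by rewrite /opcost; polyb.
exists (mach (wcode w 0)), (3 ^ B) => x.
have [t [s [Ht Hs Es]]] := Hc x.
set f := fun z => if (z <? 0)%Z then None else nth None (map Some x) (Z.to_nat z).
have Hf : srep K (upd (fun=> [::]) 0 (rev x)) f.
  move=> r i rK; rewrite /f /lv /upd; case: eqP => r0.
    case: i => [|i]; case: Z.ltb_spec => //; try lia.
    by move=> _; rewrite /col revK; rewrite (_ : Z.to_nat _ = i) //; lia.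
  case: Z.ltb_spec => [_|]; first by rewrite /col /=; case: i => [|[|i]].
  by have := Z.mul_nonneg_nonneg (Z.of_nat K) (Z.of_nat i); lia.
have Hh r : size (upd (fun=> [::]) 0 (rev x) r) <= size x.
  by rewrite /upd; case: eqP => // _; rewrite size_rev.
have [f' Hf' W] := compile_sound Hs (leqnSn _) Hh Hf.
have [u hu Wu] : wexle w (f, 0%Z) (2 + t * opcost K (size x + t)) (f', 0%Z).
  apply: (wexle_seq (wexle_move MoveL f 0%Z) _ (leqnn _)).
  by apply: wexle_seq W (wexle_move MoveR f' (-1)%Z) _; rewrite addn1.
have R0 : rep [::] (map Some x) (f, 0%Z).
  split=> i; rewrite /fst /snd /f; case: Z.ltb_spec => //; try lia.
    by move=> _; rewrite (_ : Z.to_nat _ = i) //; lia.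
  by rewrite nth_nil.
have E0 : emb (wcode w 0) 0 (wcode w 0) by exists [::], [::]; rewrite cats0.
have [l' [r' [E [R' _]]]] := wex_sound Wu E0 R0.
have I0 : inord 0 = ord0 :> 'I_(size (wcode w 0)).+1 by apply: val_inj; rewrite /= inordK.
exists u.
  apply: leq_trans hu _; apply: leq_trans (poly_bound_geq B _).
  apply: leq_trans (HB _); rewrite leq_add2l; apply: leq_mul => //.
  by apply: opcost_leq; rewrite leq_add2l.
rewrite /tm_run /tm_init -I0 E; split.
  by change (nat_of_ord (inord (0 + wlen w) : 'I_(size (wcode w 0)).+1) == size (wcode w 0));
    rewrite inordK size_wcode.
apply: out_bits_some => i; rewrite R'.
have := Hf' 0 i.+1 isT; rewrite Es /col revK /= => <-.
by congr f'; rewrite /lv eqxx /snd; lia.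
Qed.

Definition move_reg (r s : nat) : scmd := SBr true r SSkip (SPush s false) (SPush s true).
Definition clear (r : nat) : scmd := SBr true r SSkip SSkip SSkip.

Lemma upd_same s r w : upd s r w r = w.
Proof. by rewrite /upd eqxx. Qed.

Lemma upd_other s r w x : x <> r -> upd s r w x = s x.
Proof. by rewrite /upd; case: eqP. Qed.

Ltac regs_at := rewrite /upd;
  repeat (case: eqP => ?; subst => //=); try lia; try congruence.
Ltac regs_ext := apply: functional_extensionality => ?; regs_at.

Lemma sex_eq c s t t' s1 s2 : sex c s t s1 -> t = t' -> s1 = s2 -> sex c s t' s2.
Proof. by move=> H <- <-. Qed.

Lemma sex_move r s σ : r <> s ->
  sex (move_reg r s) σ (2 * size (σ r)).+1 (upd (upd σ r [::]) s (rev (σ r) ++ σ s)).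
Proof.
move=> rs; move E: (σ r) => w; elim: w σ E => [|b w IH] σ E.
  by apply: sex_eq (sex_brN _ _ _ E (sex_skip _)) _ _ => //; regs_ext.
have H : sex (if b then SPush s true else SPush s false) (upd σ r w) 1 (upd (upd σ r w) s (b :: upd σ r w s)).
  by case: b {E}; constructor.
have := IH (upd (upd σ r w) s (b :: upd σ r w s)).
rewrite upd_other // upd_same => /(_ erefl) H'.
apply: sex_eq (sex_brL E H H') _ _; first by rewrite /=; lia.
rewrite upd_same upd_other 1?eq_sym; last by move=> e; apply: rs.
by regs_ext; rewrite rev_cons cat_rcons.
Qed.

Lemma sex_clear r σ : sex (clear r) σ (size (σ r)).+1 (upd σ r [::]).
Proof.
move E: (σ r) => w; elim: w σ E => [|b w IH] σ E.
  by apply: sex_eq (sex_brN _ _ _ E (sex_skip _)) _ _ => //; regs_ext.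
have H : sex (if b then SSkip else SSkip) (upd σ r w) 0 (upd σ r w).
  by case: b {E}; constructor.
have := IH (upd σ r w); rewrite upd_same => /(_ erefl) H'.
by apply: sex_eq (sex_brL E H H') _ _; last by regs_ext.
Qed.

(** * Polynomial-time functions *)

Definition input_size (A : Type) (xs : seq (A -> seq bool)) (a : A) : nat :=
  \sum_(x <- xs) size (x a).

(* A stack program computes [F a] from the values of [xs] at [a] in polynomial
   time: the values of [xs] are kept in the registers [rho v] below [d], all
   registers from [d] on are free, and [F a] is prepended to register [o]. *)
Definition pts (A : Type) (xs : seq (A -> seq bool)) (F : A -> seq bool) : Prop :=
  forall (rho : nat -> nat) (d o : nat),
    (forall v, v < size xs -> rho v < d /\ rho v <> o) -> o < d ->
  exists (c : scmd) (B : nat), forall a σ,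
    (forall v, v < size xs -> σ (rho v) = nth (fun=> [::]) xs v a) ->
    (forall r, d <= r -> σ r = [::]) ->
    exists2 t, t <= (input_size xs a + 2) ^ B & sex c σ t (upd σ o (F a ++ σ o)).

Lemma pts_ext A xs (F G : A -> seq bool) : pts xs F -> (forall a, F a = G a) -> pts xs G.
Proof.
move=> H E rho d o H1 H2; have [c [B Hc]] := H rho d o H1 H2.
by exists c, B => a σ h1 h2; rewrite -E; apply: Hc.
Qed.

(** Register 1 holds the input and register 2 receives the result; the moves out of and into
    register 0 undo the reversals caused by the tape layout. *)
Lemma pts_poly_time (F : seq bool -> seq bool) : pts [:: id] F ->
  exists (M : TM) (B : nat), forall x, tm_computes_on M (poly_bound B (size x)) x (F x).
Proof.
move=> H.
have [|//|c [B Hc]] := H (fun=> 1) 3 2; first by move=> [].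
pose g n := (2 * n).+1 + ((n + 2) ^ B + (2 * (n + 2) ^ B).+1).
apply: (@stack_tm (SSeq (move_reg 0 1) (SSeq c (move_reg 2 0))) F g).
  rewrite /g; have -> : (fun n => (2 * n).+1 + ((n + 2) ^ B + (2 * (n + 2) ^ B).+1)) =
     (fun n => (1 + 2 * n) + ((n + 2) ^ B + (1 + 2 * (n + 2) ^ B))) by [].
  by polyb.
move=> x; set s0 := upd _ 0 _.
have := @sex_move 0 1 s0 (@O_S 0).
rewrite {2 3 4}/s0 !upd_same revK (_ : s0 1 = [::]) // cats0 size_rev => H1.
set s1 := upd (upd s0 0 [::]) 1 x in H1.
have [||t Ht H2] := Hc x s1; first by move=> [].
  by move=> [|[|[|r]]].
have := sex_size H2 2; rewrite upd_same (_ : s1 2 = [::]) // cats0 add0n => Hs.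
rewrite (_ : s1 2 = [::]) // cats0 in H2.
have := @sex_move 2 0 (upd s1 2 (F x)) (@PeanoNat.Nat.neq_succ_0 1); rewrite upd_same (_ : upd s1 2 (F x) 0 = [::]) // cats0 => H3.
exists ((2 * size x).+1 + (t + (2 * size (F x)).+1)), (upd (upd (upd s1 2 (F x)) 2 [::]) 0 (rev (F x))); split=> //.
  rewrite /g leq_add2l; move: Ht; rewrite /input_size big_seq1; lia.
by apply: sex_seq H1 (sex_seq H2 H3).
Qed.

Lemma input_size_nth A (xs : seq (A -> seq bool)) a v : v < size xs ->
  size (nth (fun=> [::]) xs v a) <= input_size xs a.
Proof.
by rewrite /input_size => vs; rewrite (big_nth (fun=> [::])) big_mkord (bigD1 (Ordinal vs)) //= leq_addr.
Qed.

(** A stack is read only by emptying it. The value is moved to the free register [d] and from there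
    pushed both onto the output and back onto its own register; the two reversals cancel. *)
Lemma pts_var A (xs : seq (A -> seq bool)) v : v < size xs -> pts xs (nth (fun=> [::]) xs v).
Proof.
move=> vs rho d o Hr od; have [rd ro] := Hr v vs.
pose dup b := SSeq (SPush (rho v) b) (SPush o b).
exists (SSeq (move_reg (rho v) d) (SBr true d SSkip (dup false) (dup true))).
have [B HB] : polyb (fun n => (1 + 2 * n) + (1 + 3 * n)) by polyb.
exists B => a σ Hσ Hd; set w := nth _ _ _ _.
have rnd : rho v <> d by move=> e; move: rd; rewrite e ltnn.
have := sex_move σ rnd; rewrite Hσ // -/w (Hd d) // cats0 => H1.
have L u x σ1 : σ1 d = u -> σ1 (rho v) = x ->
    sex (SBr true d SSkip (dup false) (dup true)) σ1 (3 * size u).+1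
      (upd (upd (upd σ1 d [::]) (rho v) (rev u ++ x)) o (rev u ++ σ1 o)).
  elim: u x σ1 => [|b u IH] x σ1 Eu Ex.
    by apply: sex_eq (sex_brN _ _ _ Eu (sex_skip _)) _ _ => //; regs_ext.
  have Hb : sex (if b then dup true else dup false) (upd σ1 d u) (1 + 1)
     (upd (upd (upd σ1 d u) (rho v) (b :: x)) o (b :: σ1 o)).
    have -> : (if b then dup true else dup false) = dup b by case: (b).
    apply: sex_seq; first exact: sex_push.
    apply: sex_eq (sex_push _ _ _) _ _ => //.
    rewrite (@upd_other _ d) // Ex (@upd_other _ (rho v)); last by move=> e; apply: ro.
    by rewrite upd_other //; regs_at.
  apply: sex_eq (sex_brL Eu Hb (IH (b :: x) _ _ _)) _ _.
  - by regs_at.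
  - by regs_at.
  - by rewrite /=; lia.
  - rewrite upd_same; regs_ext; by rewrite rev_cons cat_rcons.
have := L (rev w) [::] (upd (upd σ (rho v) [::]) d (rev w)) (upd_same _ _ _).
have -> : upd (upd σ (rho v) [::]) d (rev w) (rho v) = [::] by regs_at.
move=> /(_ erefl) H2.
exists ((2 * size w).+1 + (3 * size (rev w)).+1).
  apply: leq_trans (HB _); rewrite size_rev.
  by have := input_size_nth a vs; rewrite -/w; lia.
apply: sex_eq (sex_seq H1 H2) _ _ => //.
rewrite revK cats0 (_ : upd (upd σ _ _) _ _ o = σ o); last by regs_at.
by regs_ext; rewrite ?Hσ ?Hd.
Qed.

Lemma pts_nil A (xs : seq (A -> seq bool)) : pts xs (fun=> [::]).
Proof.
move=> rho d o _ _; exists SSkip, 0 => a σ _ _; exists 0 => //.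
by apply: sex_eq (sex_skip _) _ _ => //; regs_ext.
Qed.

Lemma pts_bit A (xs : seq (A -> seq bool)) b : pts xs (fun=> [:: b]).
Proof.
move=> rho d o _ _; exists (SPush o b), 0 => a σ _ _; exists 1 => //.
exact: sex_push.
Qed.

(** Results are prepended to the output register, so the second factor is computed first. *)
Lemma pts_cat A (xs : seq (A -> seq bool)) F G : pts xs F -> pts xs G ->
  pts xs (fun a => F a ++ G a).
Proof.
move=> HF HG rho d o Hr od.
have [c1 [B1 H1]] := HF rho d o Hr od; have [c2 [B2 H2]] := HG rho d o Hr od.
have [B HB] : polyb (fun n => (n + 2) ^ B1 + (n + 2) ^ B2) by polyb.
exists (SSeq c2 c1), B => a σ Hσ Hd.
have [t2 ht2 e2] := H2 a σ Hσ Hd.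
have [||t1 ht1 e1] := H1 a (upd σ o (G a ++ σ o)).
- by move=> v vs; rewrite upd_other; [exact: Hσ | case: (Hr v vs)].
- by move=> r dr; rewrite upd_other; [exact: Hd | lia].
exists (t2 + t1); first by apply: leq_trans (HB _); lia.
apply: sex_eq (sex_seq e2 e1) _ _ => //.
by rewrite upd_same catA; regs_ext.
Qed.

Definition sexle (c : scmd) (s : regs) (t : nat) (s' : regs) : Prop :=
  exists2 u, u <= t & sex c s u s'.

Lemma sexle_seq c1 c2 s1 t1 s2 t2 s3 t : sexle c1 s1 t1 s2 -> sexle c2 s2 t2 s3 ->
  t1 + t2 <= t -> sexle (SSeq c1 c2) s1 t s3.
Proof.
case=> u1 h1 e1 [u2 h2 e2] h; exists (u1 + u2); last exact: sex_seq e1 e2.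
by apply: leq_trans h; apply: leq_add.
Qed.

Lemma sexle_eq c s t t' s1 s2 : sexle c s t s1 -> t <= t' -> s1 = s2 -> sexle c s t' s2.
Proof. by case=> u h e h2 <-; exists u => //; apply: leq_trans h2. Qed.

Lemma sexle_brN g r cN c0 c1 s t s' : s r = [::] -> sexle cN s t s' ->
  sexle (SBr g r cN c0 c1) s t.+1 s'.
Proof. by move=> E [u h e]; exists u.+1 => //; apply: sex_brN. Qed.

Lemma sexle_brS r cN c0 c1 s b w t s' : s r = b :: w ->
  sexle (if b then c1 else c0) (upd s r w) t s' -> sexle (SBr false r cN c0 c1) s t.+1 s'.
Proof. by move=> E [u h e]; exists u.+1 => //; apply: sex_brS E e. Qed.

Lemma sexle_brL r cN c0 c1 s b w t s' t' s'' T : s r = b :: w ->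
  sexle (if b then c1 else c0) (upd s r w) t s' ->
  sexle (SBr true r cN c0 c1) s' t' s'' -> t + t' < T ->
  sexle (SBr true r cN c0 c1) s T s''.
Proof.
move=> E [u h e] [u' h' e'] hT; exists (u + u').+1; last exact: sex_brL E e e'.
by apply: leq_ltn_trans hT; apply: leq_add.
Qed.

Lemma sexle_skip s : sexle SSkip s 0 s.
Proof. by exists 0 => //; constructor. Qed.

Lemma sexle_push r b s : sexle (SPush r b) s 1 (upd s r (b :: s r)).
Proof. by exists 1 => //; constructor. Qed.

Lemma sexle_move r s σ : r <> s ->
  sexle (move_reg r s) σ (2 * size (σ r)).+1 (upd (upd σ r [::]) s (rev (σ r) ++ σ s)).
Proof. by exists (2 * size (σ r)).+1 => //; apply: sex_move. Qed.

Lemma sexle_clear r σ : sexle (clear r) σ (size (σ r)).+1 (upd σ r [::]).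
Proof. by exists (size (σ r)).+1 => //; apply: sex_clear. Qed.

Definition vars (A : Type) (xs : seq (A -> seq bool)) (rho : nat -> nat) (σ : regs) (a : A) :=
  forall v, v < size xs -> σ (rho v) = nth (fun=> [::]) xs v a.

Definition free (d : nat) (σ : regs) := forall r, d <= r -> σ r = [::].

Definition inscope (A : Type) (xs : seq (A -> seq bool)) (rho : nat -> nat) (d : nat) :=
  forall v, v < size xs -> rho v < d.

Lemma pts_eval A (xs : seq (A -> seq bool)) F rho d : pts xs F -> inscope xs rho d ->
  exists (c : scmd) (B : nat), forall a σ, vars xs rho σ a -> free d σ ->
    size (F a) <= (input_size xs a + 2) ^ B /\
    sexle c σ ((input_size xs a + 2) ^ B) (upd σ d (F a)).
Proof.
move=> H Hr; have [|//|c [B Hc]] := H rho d.+1 d.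
  by move=> v /Hr; lia.
exists c, B => a σ Hv Hf; have [|t ht e] := Hc a σ Hv; first by move=> r dr; apply: Hf; lia.
rewrite (Hf d) // cats0 in e; split; last by exists t.
by have := sex_size e d; rewrite upd_same (Hf d) // => h; apply: leq_trans ht.
Qed.

(** The binder rule in the style of de Bruijn: a bound value enters the environment as its first
    variable, encoded by [rp]. *)
Definition lift (A T : Type) (rp : T -> seq bool) (xs : seq (A -> seq bool)) :
    seq (A * T -> seq bool) :=
  (fun p => rp p.2) :: [seq (fun p => x p.1) | x <- xs].

Definition rho_ext (rho : nat -> nat) (d v : nat) : nat := if v is v'.+1 then rho v' else d.

Lemma input_size_lift A T (rp : T -> seq bool) (xs : seq (A -> seq bool)) a s :
  input_size (lift rp xs) (a, s) = size (rp s) + input_size xs a.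
Proof. by rewrite /input_size big_cons big_map. Qed.

Lemma vars_lift A T (rp : T -> seq bool) (xs : seq (A -> seq bool)) rho d σ a s :
  vars xs rho σ a -> σ d = rp s -> vars (lift rp xs) (rho_ext rho d) σ (a, s).
Proof.
move=> H E [|v] //=; rewrite ltnS size_map => vs.
by rewrite (nth_map (fun=> [::])) // H.
Qed.

Lemma vars_upd A (xs : seq (A -> seq bool)) rho d σ a r w : inscope xs rho d -> d <= r ->
  vars xs rho σ a -> vars xs rho (upd σ r w) a.
Proof. by move=> Hr dr H v vs; rewrite upd_other ?H //; have := Hr v vs; lia. Qed.

Lemma pts_body A T (rp : T -> seq bool) (xs : seq (A -> seq bool)) (F : A -> T -> seq bool)
    rho d e f o : pts (lift rp xs) (fun p => F p.1 p.2) ->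
  (forall v, v < size xs -> rho v < d /\ rho v <> o) -> d <= f -> e < f -> o < f -> o <> e ->
  exists (c : scmd) (B : nat), forall a s σ, vars xs rho σ a -> σ e = rp s -> free f σ ->
    sexle c σ ((size (rp s) + input_size xs a + 2) ^ B) (upd σ o (F a s ++ σ o)).
Proof.
move=> H Hr df ef of_ oe; have [| |c [B Hc]] := H (rho_ext rho e) f o.
- move=> [|v] /=; first by move=> _; split=> // eqo; apply: oe.
  by rewrite ltnS size_map => /Hr[]; lia.
- by [].
exists c, B => a s σ Hv E Hf.
have [t ht et] := Hc (a, s) σ (vars_lift Hv E) Hf.
by exists t => //; rewrite -input_size_lift.
Qed.

Lemma pts_case A (xs : seq (A -> seq bool)) F G0 (G1 G2 : A -> seq bool -> seq bool) :
  pts xs F -> pts xs G0 ->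
  pts (lift id xs) (fun p => G1 p.1 p.2) -> pts (lift id xs) (fun p => G2 p.1 p.2) ->
  pts xs (fun a => if F a is b :: s then if b then G2 a s else G1 a s else G0 a).
Proof.
move=> HF H0 H1 H2 rho d o Hr od.
have sc : inscope xs rho d by move=> v /Hr[].
have [cF [BF EF]] := pts_eval HF sc.
have [c0 [B0 E0]] := H0 rho d o Hr od.
have odn : o <> d by lia.
have [c1 [B1 E1]] := pts_body H1 Hr (leqnSn d) (leqnn _) (ltnW od : o < d.+1) odn.
have [c2 [B2 E2]] := pts_body H2 Hr (leqnSn d) (leqnn _) (ltnW od : o < d.+1) odn.
have [B HB] : polyb (fun n => (n + 2) ^ BF + (1 + ((n + 2) ^ B0 +
   (((n + 2) ^ BF + n + 2) ^ B1 + ((n + 2) ^ BF + n + 2) ^ B2 + (1 + (n + 2) ^ BF))))) by polyb.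
exists (SSeq cF (SBr false d c0 (SSeq c1 (clear d)) (SSeq c2 (clear d)))), B => a σ Hv Hf.
set N := input_size xs a.
have [hF eF] := EF a σ Hv Hf.
suff : sexle (SBr false d c0 (SSeq c1 (clear d)) (SSeq c2 (clear d))) (upd σ d (F a))
   (1 + ((N + 2) ^ B0 +
   (((N + 2) ^ BF + N + 2) ^ B1 + ((N + 2) ^ BF + N + 2) ^ B2 + (1 + (N + 2) ^ BF))))
   (upd σ o ((if F a is b :: s then if b then G2 a s else G1 a s else G0 a) ++ σ o)).
  by move=> H; have [t ht et] := sexle_seq eF H (leqnn _); exists t => //; apply: leq_trans (HB _).
case EFa : (F a) => [|b w].
  have [t ht et] := E0 a σ Hv Hf.
  apply: sexle_eq (sexle_brN _ _ _ (upd_same _ _ _) (t := t) (s' := upd σ o (G0 a ++ σ o)) _) _ _ => //.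
    have -> : upd σ d [::] = σ by regs_ext; rewrite Hf.
    by exists t.
  by rewrite -add1n leq_add2l; apply: leq_trans ht (leq_addr _ _).
have vw : vars xs rho (upd (upd σ d (b :: w)) d w) a.
  by apply: (vars_upd _ sc) => //; apply: (vars_upd _ sc).
have fw : free d.+1 (upd (upd σ d (b :: w)) d w).
  by move=> r dr; rewrite !upd_other ?Hf //; lia.
rewrite EFa /= in hF.
have hpow k : (size w + N + 2) ^ k <= ((N + 2) ^ BF + N + 2) ^ k.
  by apply: leq_expl; rewrite !leq_add2r; apply: ltnW.
have e1 := E1 a w _ vw (upd_same _ _ _) fw; have e2 := E2 a w _ vw (upd_same _ _ _) fw.
have Esz X : size (upd (upd (upd σ d (b :: w)) d w) o X d) = size w by rewrite upd_other ?upd_same //; lia.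
case: b EFa hF vw fw e1 e2 Esz => EFa hF vw fw e1 e2 Esz.
- apply: sexle_eq; first by apply: sexle_brS (upd_same _ _ _) _; exact: sexle_seq e2 (sexle_clear d _) (leqnn _).
  + by rewrite Esz; move: (hpow B2) hF; rewrite -/N; lia.
  + by regs_ext; rewrite ?Hf.
- apply: sexle_eq; first by apply: sexle_brS (upd_same _ _ _) _; exact: sexle_seq e1 (sexle_clear d _) (leqnn _).
  + by rewrite Esz; move: (hpow B1) hF; rewrite -/N; lia.
  + by regs_ext; rewrite ?Hf.
Qed.

Definition unary (n : nat) : seq bool := nseq n true.

(** The value of [F] is turned into a unary counter. After each pop the counter equals the current
    index, which therefore descends to 0; as results are prepended, they end up in ascending
    order. *)
Lemma pts_for A (xs : seq (A -> seq bool)) F (G : A -> nat -> seq bool) :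
  pts xs F -> pts (lift unary xs) (fun p => G p.1 p.2) ->
  pts xs (fun a => flatten (mkseq (G a) (size (F a)))).
Proof.
move=> HF HG rho d o Hr od.
have sc : inscope xs rho d by move=> v /Hr[].
have [cF [BF EF]] := pts_eval HF sc.
have [||||cG [BG EG]] := @pts_body _ _ _ _ _ _ d d.+1 d.+2 o HG Hr; try lia.
pose cU := SBr true d SSkip (SPush d.+1 true) (SPush d.+1 true).
pose cL := SBr true d.+1 SSkip cG cG.
have [B HB] : polyb (fun n => (n + 2) ^ BF + ((1 + 2 * (n + 2) ^ BF) +
   (1 + (n + 2) ^ BF * (1 + ((n + 2) ^ BF + n + 2) ^ BG)))) by polyb.
exists (SSeq cF (SSeq cU cL)), B => a σ Hv Hf; set N := input_size xs a.
have [hF eF] := EF a σ Hv Hf.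
have HU w m σ1 : σ1 d = w -> σ1 d.+1 = unary m ->
    sexle cU σ1 (1 + 2 * size w) (upd (upd σ1 d [::]) d.+1 (unary (m + size w))).
  elim: w m σ1 => [|b w IH] m σ1 E E'.
    by apply: sexle_eq (sexle_brN _ _ _ E (sexle_skip _)) _ _ => //; regs_ext; rewrite E' addn0.
  apply: sexle_brL E _ (sexle_eq (IH m.+1 (upd (upd σ1 d w) d.+1 (unary m.+1)) _ _) (leqnn _) _) _.
  - rewrite if_same; apply: sexle_eq (sexle_push _ _ _) (leqnn _) _.
    by rewrite upd_other ?E' //; lia.
  - by regs_at.
  - by rewrite upd_same.
  - by rewrite addSnnS; regs_ext.
  - by rewrite /=; lia.
have HL m w σ1 : vars xs rho σ1 a -> free d.+2 σ1 -> σ1 d.+1 = unary m -> σ1 o = w ->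
    m <= (N + 2) ^ BF ->
    sexle cL σ1 (1 + m * (1 + ((N + 2) ^ BF + N + 2) ^ BG))
      (upd (upd σ1 d.+1 [::]) o (flatten (mkseq (G a) m) ++ w)).
  elim: m w σ1 => [|m IH] w σ1 V Fr E Eo hm.
    by apply: sexle_eq (sexle_brN _ _ _ E (sexle_skip _)) _ _ => //; regs_ext.
  have V' : vars xs rho (upd σ1 d.+1 (unary m)) a by apply: (vars_upd _ sc).
  have Fr' : free d.+2 (upd σ1 d.+1 (unary m)).
    by move=> r dr; rewrite upd_other ?Fr //; lia.
  have e := EG a m _ V' (upd_same _ _ _) Fr'.
  apply: sexle_brL E _ (sexle_eq (IH (G a m ++ w) (upd (upd σ1 d.+1 (unary m)) o (G a m ++ w)) _ _ _ _ _) (leqnn _) _) _.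
  - by apply: sexle_eq e (leqnn _) _; rewrite upd_other ?Eo //; lia.
  - by move=> v vs; rewrite upd_other ?V' //; case: (Hr v vs).
  - by move=> r dr; rewrite upd_other ?Fr' //; lia.
  - by rewrite upd_other ?upd_same //; lia.
  - by rewrite upd_same.
  - exact: ltnW.
  - by rewrite mkseqS flatten_rcons -catA; regs_ext.
  - have : (size (unary m) + N + 2) ^ BG <= ((N + 2) ^ BF + N + 2) ^ BG.
      by apply: leq_expl; rewrite size_nseq !leq_add2r; apply: ltnW.
    by rewrite -/N mulSn; lia.
have e1 := HU (F a) 0 (upd σ d (F a)) (upd_same _ _ _).
rewrite upd_other ?Hf // in e1; last by lia.
set σ2 := upd _ d.+1 _ in e1.
have e2 := HL (size (F a)) (σ o) σ2.
have [||||t ht et] := sexle_seq eF (sexle_seq (e1 erefl) (e2 _ _ _ _ hF) (leqnn _)) (leqnn _).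
- by do 3! [apply: (vars_upd _ sc) => //].
- by move=> r dr; rewrite /σ2 !upd_other ?Hf //; lia.
- by rewrite /σ2 upd_same.
- by rewrite /σ2 !upd_other //; lia.
exists t.
  apply: leq_trans ht _; apply: leq_trans (HB _); rewrite leq_add2l -/N.
  have : size (F a) * (1 + ((N + 2) ^ BF + N + 2) ^ BG) <=
     (N + 2) ^ BF * (1 + ((N + 2) ^ BF + N + 2) ^ BG) by rewrite leq_mul2r hF orbT.
  by move: hF; rewrite -/N; lia.
have <- : upd (upd σ2 d.+1 [::]) o (flatten (mkseq (G a) (size (F a))) ++ σ o) =
  upd σ o (flatten (mkseq (G a) (size (F a))) ++ σ o) by rewrite /σ2; regs_ext; rewrite ?Hf.
exact: et.
Qed.

Lemma size_iter_take (n m k : nat) (f : seq bool -> seq bool) w :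
  size w <= m -> k <= m -> size (iter n (fun v => take k (f v)) w) <= m.
Proof.
move=> wm km; case: n => [|n] //=.
by rewrite size_take; case: ltnP => // h; apply: leq_trans h km.
Qed.

(** Bounded recursion as in Cobham's characterization: truncating after every step keeps the
    iterates polynomially long, which repeated application of [S] alone would not. *)
Lemma pts_iter A (xs : seq (A -> seq bool)) Fn Fb F0 (S : A -> seq bool -> seq bool) :
  pts xs Fn -> pts xs Fb -> pts xs F0 -> pts (lift id xs) (fun p => S p.1 p.2) ->
  pts xs (fun a => iter (size (Fn a)) (fun v => take (size (Fb a)) (S a v)) (F0 a)).
Proof.
move=> Hn Hb H0 HS rho d o Hr od.
have sc k : d <= k -> inscope xs rho k by move=> dk v /Hr[]; lia.
have [|cn [Bn En]] := @pts_eval _ _ _ rho d Hn; first exact: sc.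
have [|cb [Bb Eb]] := @pts_eval _ _ _ rho d.+1 Hb; first by apply: sc; lia.
have [|c0 [B0 E0]] := @pts_eval _ _ _ rho d.+2 H0; first by apply: sc; lia.
have [|||||cS [BS ES]] := @pts_body _ _ _ _ _ rho d d.+2 d.+4 d.+3 HS; try lia.
  by move=> v /Hr[]; lia.
(* Truncation moves one bit of the value, if any is left, for every bit popped from the bound; the
   bits of the bound are saved to restore it. *)
pose X b := SSeq (SPush d.+4 b) (SBr false d.+3 SSkip (SPush d.+4.+1 false) (SPush d.+4.+1 true)).
pose clamp := SBr true d.+1 SSkip (X false) (X true).
pose body := SSeq cS (SSeq (clear d.+2) (SSeq clamp (SSeq (clear d.+3)
  (SSeq (move_reg d.+4 d.+1) (move_reg d.+4.+1 d.+2))))).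
pose loop := SBr true d SSkip body body.
pose fin := SSeq (clear d.+1) (SSeq (move_reg d.+2 d.+3) (move_reg d.+3 o)).
pose M n := (n + 2) ^ Bb + (n + 2) ^ B0.
pose TB n := (M n + n + 2) ^ BS + (1 + M n + (1 + 4 * M n + (1 + (M n + n + 2) ^ BS + (1 + 2 * M n + (1 + 2 * M n))))).
pose TL n := 1 + (n + 2) ^ Bn * (1 + TB n).
pose TF n := 1 + M n + (1 + 2 * M n + (1 + 2 * M n)).
have [B HB] : polyb (fun n => (n + 2) ^ Bn + ((n + 2) ^ Bb + ((n + 2) ^ B0 + (TL n + TF n)))).
  by rewrite /TL /TB /TF /M; polyb.
exists (SSeq cn (SSeq cb (SSeq c0 (SSeq loop fin)))), B => a σ Hv Hf.
set N := input_size xs a.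
(* Contents of the scratch registers: the counter, the bound, the current value, its image under
   [S], and the reversed copies of the bound and of the truncated image. *)
pose st n b v u p q := upd (upd (upd (upd (upd (upd σ d n) d.+1 b) d.+2 v) d.+3 u) d.+4 p) d.+4.+1 q.
have V n b v u p q : vars xs rho (st n b v u p q) a.
  by rewrite /st; do 6! [apply: (vars_upd _ (sc d (leqnn d))); first lia].
have Hclamp n b v u p q : sexle clamp (st n b v u p q) (1 + 4 * size b)
    (st n [::] v (drop (size b) u) (rev b ++ p) (rev (take (size b) u) ++ q)).
  elim: b u p q => [|x b IH] u p q.
    apply: sexle_eq (sexle_brN _ _ _ _ (sexle_skip _)) _ _ => //; first by rewrite /st; regs_at.
    by rewrite drop0 take0.
  have E : st n (x :: b) v u p q d.+1 = x :: b by rewrite /st; regs_at.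
  have H : sexle (if x then X true else X false) (upd (st n (x :: b) v u p q) d.+1 b) 3
     (st n b v (behead u) (x :: p) (if u is y :: _ then y :: q else q)).
    have -> : (if x then X true else X false) = X x by case: (x).
    apply: sexle_seq (sexle_push _ _ _) (_ : sexle _ _ 2 _) _ => //.
    case: u E => [|y u] _.
      apply: sexle_eq (sexle_brN _ _ _ _ (sexle_skip _)) _ _ => //; first by rewrite /st; regs_at.
      by rewrite /st; regs_ext.
    apply: sexle_eq; first apply: (@sexle_brS _ _ _ _ _ y u 1).
    + by rewrite /st; regs_at.
    + by case: (y); apply: sexle_push.
    + by [].
    + by rewrite /st; case: y; regs_ext.
  apply: sexle_brL E H (sexle_eq (IH _ _ _) (leqnn _) _) _; last by rewrite /=; lia.
  case: u => [|y u] /=; first by rewrite rev_cons cat_rcons.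
  by rewrite !rev_cons !cat_rcons.
have Hbody n b v m : size v <= m -> size b <= m ->
    sexle body (st n b v [::] [::] [::]) ((m + N + 2) ^ BS +
      (1 + m + (1 + 4 * m + (1 + (m + N + 2) ^ BS + (1 + 2 * m + (1 + 2 * m))))))
      (st n b (take (size b) (S a v)) [::] [::] [::]).
  move=> vm bm; set u := S a v.
  have [|//|t ht et] := ES a v _ (V n b v [::] [::] [::]); first by rewrite /st; regs_at.
    by move=> r dr; rewrite /st; regs_at; apply: Hf; lia.
  have pw : (size v + N + 2) ^ BS <= (m + N + 2) ^ BS by apply: leq_expl; rewrite !leq_add2r.
  have hu : size u <= (m + N + 2) ^ BS.
    have := sex_size et d.+3; rewrite upd_same (_ : st _ _ _ _ _ _ d.+3 = [::]); last by rewrite /st; regs_at.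
    by rewrite cats0 add0n => h; apply: leq_trans (leq_trans h ht) pw.
  have e1 : sexle cS (st n b v [::] [::] [::]) ((m + N + 2) ^ BS) (st n b v u [::] [::]).
    apply: (@sexle_eq _ _ t); [by exists t; last exact: et | exact: leq_trans ht pw |].
    rewrite (_ : st _ _ _ _ _ _ d.+3 = [::]) ?cats0; last by rewrite /st; regs_at.
    by rewrite /st; regs_ext.
  apply: sexle_seq e1 _ (leqnn _).
  apply: (@sexle_seq _ _ _ _ (st n b [::] u [::] [::])) _ (leqnn _).
    apply: sexle_eq (sexle_clear _ _) _ _; last by rewrite /st; regs_ext.
    by rewrite (_ : st _ _ _ _ _ _ d.+2 = v); [lia | rewrite /st; regs_at].
  apply: sexle_seq (sexle_eq (Hclamp _ _ _ _ _ _) _ (erefl _)) _ (leqnn _); first by lia.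
  apply: (@sexle_seq _ _ _ _ (st n [::] [::] [::] (rev b) (rev (take (size b) u)))) _ (leqnn _).
    apply: sexle_eq (sexle_clear _ _) _ _; last by rewrite /st !cats0; regs_ext.
    rewrite (_ : st _ _ _ _ _ _ d.+3 = drop (size b) u); last by rewrite /st; regs_at.
    by rewrite size_drop; lia.
  have sz : size (take (size b) u) <= m by rewrite size_take; case: ltnP => // h; lia.
  apply: (@sexle_seq _ _ _ _ (st n b [::] [::] [::] (rev (take (size b) u)))) _ (leqnn _).
    have ne : d.+4 <> d.+1 by lia.
    have := sexle_move (st n [::] [::] [::] (rev b) (rev (take (size b) u))) ne.
    rewrite (_ : st _ _ _ _ _ _ d.+4 = rev b); last by rewrite /st; regs_at.
    rewrite (_ : st _ _ _ _ _ _ d.+1 = [::]); last by rewrite /st; regs_at.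
    rewrite revK cats0 size_rev => e; apply: sexle_eq e _ _; first by lia.
    by rewrite /st; regs_ext.
  have ne : d.+4.+1 <> d.+2 by lia.
  have := sexle_move (st n b [::] [::] [::] (rev (take (size b) u))) ne.
  rewrite (_ : st _ _ _ _ _ _ d.+4.+1 = rev (take (size b) u)); last by rewrite /st; regs_at.
  rewrite (_ : st _ _ _ _ _ _ d.+2 = [::]); last by rewrite /st; regs_at.
  rewrite revK cats0 size_rev => e; apply: sexle_eq e _ _; first by lia.
  by rewrite /st; regs_ext.
have Hloop n b v m : size v <= m -> size b <= m ->
    sexle loop (st n b v [::] [::] [::]) (1 + size n * (1 + ((m + N + 2) ^ BS +
      (1 + m + (1 + 4 * m + (1 + (m + N + 2) ^ BS + (1 + 2 * m + (1 + 2 * m)))))))) 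
      (st [::] b (iter (size n) (fun v => take (size b) (S a v)) v) [::] [::] [::]).
  elim: n v => [|x n IH] v vm bm.
    by apply: sexle_eq (sexle_brN _ _ _ _ (sexle_skip _)) _ _ => //; rewrite /st; regs_at.
  rewrite [size _]/= iterSr.
  apply: (@sexle_brL d _ _ _ _ x n).
  - by rewrite /st; regs_at.
  - rewrite if_same (_ : upd _ d n = st n b v [::] [::] [::]); first exact: Hbody bm.
    by rewrite /st; regs_ext.
  - apply: IH => //; by rewrite size_take; case: ltnP => // h; apply: leq_trans h bm.
  - by rewrite mulSn; lia.
have [hn en] := En a σ Hv Hf.
have E1 : upd σ d (Fn a) = st (Fn a) [::] [::] [::] [::] [::] by rewrite /st; regs_ext; rewrite Hf //; lia.
rewrite E1 in en.
have [|hb eb] := Eb a _ (V (Fn a) [::] [::] [::] [::] [::]).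
  by move=> r dr; rewrite /st; regs_at; apply: Hf; lia.
rewrite (_ : upd (st _ _ _ _ _ _) _ _ = st (Fn a) (Fb a) [::] [::] [::] [::]) in eb;
  last by rewrite /st; regs_ext.
have [|h0 e0] := E0 a _ (V (Fn a) (Fb a) [::] [::] [::] [::]).
  by move=> r dr; rewrite /st; regs_at; apply: Hf; lia.
rewrite (_ : upd (st _ _ _ _ _ _) _ _ = st (Fn a) (Fb a) (F0 a) [::] [::] [::]) in e0;
  last by rewrite /st; regs_ext.
have hm0 : size (F0 a) <= M N by apply: leq_trans h0 (leq_addl _ _).
have hmb : size (Fb a) <= M N by apply: leq_trans hb (leq_addr _ _).
set w := iter _ _ _; have hw : size w <= M N by apply: size_iter_take.
have el := Hloop (Fn a) (Fb a) (F0 a) _ hm0 hmb.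
have ef : sexle fin (st [::] (Fb a) w [::] [::] [::]) (TF N) (upd σ o (w ++ σ o)).
  apply: (@sexle_seq _ _ _ _ (st [::] [::] w [::] [::] [::])) _ (leqnn _).
    apply: sexle_eq (sexle_clear _ _) _ _; last by rewrite /st; regs_ext.
    by rewrite (_ : st _ _ _ _ _ _ d.+1 = Fb a); [lia | rewrite /st; regs_at].
  apply: (@sexle_seq _ _ _ _ (st [::] [::] [::] (rev w) [::] [::])) _ (leqnn _).
    have ne : d.+2 <> d.+3 by lia.
    have := sexle_move (st [::] [::] w [::] [::] [::]) ne.
    rewrite (_ : st _ _ _ _ _ _ d.+2 = w); last by rewrite /st; regs_at.
    rewrite (_ : st _ _ _ _ _ _ d.+3 = [::]); last by rewrite /st; regs_at.
    rewrite cats0 => e; apply: sexle_eq e _ _; first by lia.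
    by rewrite /st; regs_ext.
  have ne : d.+3 <> o by lia.
  have := sexle_move (st [::] [::] [::] (rev w) [::] [::]) ne.
  rewrite (_ : st _ _ _ _ _ _ d.+3 = rev w); last by rewrite /st; regs_at.
  rewrite (_ : st _ _ _ _ _ _ o = σ o); last by rewrite /st; regs_at.
  rewrite revK size_rev => e; apply: sexle_eq e _ _; first by lia.
  by rewrite /st; regs_ext; rewrite Hf //; lia.
have [t ht et] := sexle_seq en (sexle_seq eb (sexle_seq e0 (sexle_seq el ef (leqnn _)) (leqnn _)) (leqnn _)) (leqnn _).
exists t => //; apply: leq_trans ht _; apply: leq_trans (HB _); rewrite -/N !leq_add2l leq_add2r.
by rewrite /TL leq_add2l leq_mul2r hn orbT.
Qed.

Lemma pts_weak A T (rp : T -> seq bool) (xs : seq (A -> seq bool)) F :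
  pts xs F -> pts (lift rp xs) (fun p => F p.1).
Proof.
move=> H rho d o Hr od.
have Hr' v : v < size xs -> rho v.+1 < d /\ rho v.+1 <> o.
  by move=> vs; apply: (Hr v.+1); rewrite /= ltnS size_map.
have [c [B Hc]] := H (fun v => rho v.+1) d o Hr' od.
exists c, B => -[a s] σ Hv Hf.
have Hv' v : v < size xs -> σ (rho v.+1) = nth (fun=> [::]) xs v a.
  by move=> vs; rewrite (Hv v.+1) /= ?ltnS ?size_map // (nth_map (fun=> [::])).
have [t ht et] := Hc a σ Hv' Hf.
exists t => //; apply: leq_trans ht _; apply: leq_expl.
by rewrite input_size_lift leq_add2r leq_addl.
Qed.

Lemma pts_top A T (rp : T -> seq bool) (xs : seq (A -> seq bool)) :
  pts (lift rp xs) (fun p => rp p.2).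
Proof. exact: (@pts_var _ (lift rp xs) 0). Qed.

Arguments pts_nil {A xs}.
Arguments pts_bit {A xs} b.
Arguments pts_top {A T rp xs}.
Arguments pts_weak {A T rp xs F} _.

Opaque pts.

(** Unary values agree with the encoding of [DNat] and make concatenation an addition and a loop a
    sum. *)
Definition ptn (A : Type) (xs : seq (A -> seq bool)) (N : A -> nat) : Prop :=
  pts xs (fun a => unary (N a)).

Definition ptb (A : Type) (xs : seq (A -> seq bool)) (b : A -> bool) : Prop :=
  ptn xs (fun a => nat_of_bool (b a)).

(** * Arithmetic and logic on unary values *)

Section NatClosure.
Variables (A : Type) (xs : seq (A -> seq bool)).
Implicit Types (N : A -> nat) (F : A -> seq bool) (b : A -> bool).

Lemma ptn_ext N1 N2 : ptn xs N1 -> (forall a, N1 a = N2 a) -> ptn xs N2.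
Proof. by move=> H E; apply: pts_ext H _ => a; rewrite E. Qed.

Lemma ptb_ext b1 b2 : ptb xs b1 -> (forall a, b1 a = b2 a) -> ptb xs b2.
Proof. by move=> H E; apply: ptn_ext H _ => a; rewrite E. Qed.

Lemma ptn_const c : ptn xs (fun=> c).
Proof. by elim: c => [|c IH]; [exact: pts_nil | by apply: pts_ext (pts_cat (pts_bit true) IH) _]. Qed.

Lemma ptb_const c : ptb xs (fun=> c).
Proof. exact: ptn_const. Qed.

Lemma ptn_add N1 N2 : ptn xs N1 -> ptn xs N2 -> ptn xs (fun a => N1 a + N2 a).
Proof. by move=> H1 H2; apply: pts_ext (pts_cat H1 H2) _ => a; rewrite /unary nseqD. Qed.

Lemma ptn_succ N : ptn xs N -> ptn xs (fun a => (N a).+1).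
Proof. by move=> H; apply: pts_ext (pts_cat (pts_bit true) H) _. Qed.

Lemma pts_flatten N (G : A -> nat -> seq bool) : ptn xs N ->
  pts (lift unary xs) (fun p => G p.1 p.2) ->
  pts xs (fun a => flatten (mkseq (G a) (N a))).
Proof. by move=> H1 H2; apply: pts_ext (pts_for H1 H2) _ => a; rewrite size_nseq. Qed.

Lemma flatten_unary (f : nat -> nat) n :
  flatten (mkseq (fun i => unary (f i)) n) = unary (\sum_(i < n) f i).
Proof.
elim: n => [|n IH]; first by rewrite big_ord0.
by rewrite mkseqS flatten_rcons IH big_ord_recr /unary nseqD.
Qed.

Lemma ptn_sum N (G : A -> nat -> nat) : ptn xs N ->
  ptn (lift unary xs) (fun p => G p.1 p.2) ->
  ptn xs (fun a => \sum_(i < N a) G a i).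
Proof.
move=> H1 H2; apply: pts_ext (pts_flatten H1 (G := fun a i => unary (G a i)) H2) _ => a.
exact: flatten_unary.
Qed.

Lemma ptn_size F : pts xs F -> ptn xs (fun a => size (F a)).
Proof.
move=> H; apply: pts_ext (pts_for H (G := fun _ _ => unary 1) (pts_bit true)) _ => a.
by rewrite flatten_unary sum1_card card_ord.
Qed.

Lemma ptn_mul N1 N2 : ptn xs N1 -> ptn xs N2 -> ptn xs (fun a => N1 a * N2 a).
Proof.
move=> H1 H2; apply: ptn_ext (ptn_sum (G := fun a _ => N2 a) H1 (pts_weak H2)) _ => a.
by rewrite sum_nat_const card_ord.
Qed.

Lemma pts_if b F G : ptb xs b -> pts xs F -> pts xs G -> pts xs (fun a => if b a then F a else G a).
Proof.
move=> Hb HF HG.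
apply: pts_ext (pts_case (G1 := fun a _ => F a) (G2 := fun a _ => F a) Hb HG (pts_weak HF) (pts_weak HF)) _ => a.
by case: (b a).
Qed.

Lemma ptn_if b N1 N2 : ptb xs b -> ptn xs N1 -> ptn xs N2 -> ptn xs (fun a => if b a then N1 a else N2 a).
Proof. by move=> Hb H1 H2; apply: pts_ext (pts_if Hb H1 H2) _ => a; case: (b a). Qed.

Lemma ptb_if b b1 b2 : ptb xs b -> ptb xs b1 -> ptb xs b2 -> ptb xs (fun a => if b a then b1 a else b2 a).
Proof. by move=> Hb H1 H2; apply: ptn_ext (ptn_if Hb H1 H2) _ => a; case: (b a). Qed.

Lemma ptb_not b : ptb xs b -> ptb xs (fun a => ~~ b a).
Proof. by move=> H; apply: ptb_ext (ptb_if H (ptb_const false) (ptb_const true)) _ => a; case: (b a). Qed.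

Lemma ptb_and b1 b2 : ptb xs b1 -> ptb xs b2 -> ptb xs (fun a => b1 a && b2 a).
Proof. by move=> H1 H2; apply: ptb_ext (ptb_if H1 H2 (ptb_const false)) _. Qed.

Lemma ptb_or b1 b2 : ptb xs b1 -> ptb xs b2 -> ptb xs (fun a => b1 a || b2 a).
Proof. by move=> H1 H2; apply: ptb_ext (ptb_if H1 (ptb_const true) H2) _. Qed.

Lemma pts_behead F : pts xs F -> pts xs (fun a => behead (F a)).
Proof.
move=> H; apply: pts_ext (pts_case (G1 := fun _ s => s) (G2 := fun _ s => s) H pts_nil pts_top pts_top) _ => a.
by case: (F a) => [|[]].
Qed.

Lemma ptb_head F : pts xs F -> ptb xs (fun a => head false (F a)).
Proof.
move=> H; apply: pts_ext (pts_case (G1 := fun _ _ => [::]) (G2 := fun _ _ => [:: true]) H pts_nil pts_nil (pts_bit true)) _ => a.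
by case: (F a) => [|[]].
Qed.

(** If the step never lengthens its argument, no iterate is longer than the start value, and
    truncation to that length changes nothing. *)
Lemma pts_iter_shrink N F (S : A -> seq bool -> seq bool) :
  ptn xs N -> pts xs F -> pts (lift id xs) (fun p => S p.1 p.2) ->
  (forall a v, size (S a v) <= size v) -> pts xs (fun a => iter (N a) (S a) (F a)).
Proof.
move=> HN HF HS Hs; apply: pts_ext (pts_iter HN HF HF HS) _ => a; rewrite size_nseq.
have sz n : size (iter n (S a) (F a)) <= size (F a).
  by elim: n => //= n; apply: leq_trans.
by elim: (N a) => //= n ->; rewrite take_oversize // (sz n.+1).
Qed.

Lemma ptb_pos N : ptn xs N -> ptb xs (fun a => 0 < N a).
Proof. by move=> H; apply: ptb_ext (ptb_head H) _ => a; case: (N a). Qed.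

End NatClosure.

Arguments ptn_const {A xs} c.
Arguments ptb_const {A xs} c.

Lemma pts_drop A (xs : seq (A -> seq bool)) N F : ptn xs N -> pts xs F -> pts xs (fun a => drop (N a) (F a)).
Proof.
move=> HN HF; apply: pts_ext (pts_iter_shrink (S := fun _ v => behead v) HN HF (pts_behead pts_top) _) _.
  by move=> _ v; rewrite size_behead leq_pred.
move=> a; elim: (N a) => [|n IH]; first by rewrite drop0.
by rewrite [LHS]/= IH -drop1 drop_drop.
Qed.

Section NatClosure2.
Variables (A : Type) (xs : seq (A -> seq bool)).
Implicit Types (N : A -> nat) (F : A -> seq bool) (b : A -> bool).

Lemma ptn_sub N1 N2 : ptn xs N1 -> ptn xs N2 -> ptn xs (fun a => N1 a - N2 a).
Proof. by move=> H1 H2; apply: pts_ext (pts_drop H2 H1) _ => a; rewrite drop_nseq. Qed.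

Lemma ptb_leq N1 N2 : ptn xs N1 -> ptn xs N2 -> ptb xs (fun a => N1 a <= N2 a).
Proof.
move=> H1 H2; apply: ptb_ext (ptb_not (ptb_pos (ptn_sub H1 H2))) _ => a.
by rewrite subn_gt0 -leqNgt.
Qed.

Lemma ptb_eqn N1 N2 : ptn xs N1 -> ptn xs N2 -> ptb xs (fun a => N1 a == N2 a).
Proof.
by move=> H1 H2; apply: ptb_ext (ptb_and (ptb_leq H1 H2) (ptb_leq H2 H1)) _ => a; rewrite eqn_leq.
Qed.

Lemma ptn_count N (P : A -> nat -> bool) : ptn xs N -> ptb (lift unary xs) (fun p => P p.1 p.2) ->
  ptn xs (fun a => count (P a) (iota 0 (N a))).
Proof.
move=> H1 H2; apply: ptn_ext (ptn_sum (G := fun a i => nat_of_bool (P a i)) H1 H2) _ => a.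
rewrite -(big_mkord xpredT (fun i => nat_of_bool (P a i))) /index_iota subn0.
by elim: (iota _ _) => [|i s IH]; rewrite ?big_nil // big_cons IH.
Qed.

Lemma ptb_has N (P : A -> nat -> bool) : ptn xs N -> ptb (lift unary xs) (fun p => P p.1 p.2) ->
  ptb xs (fun a => has (P a) (iota 0 (N a))).
Proof.
move=> H1 H2; apply: ptb_ext (ptb_pos (ptn_sum (G := fun a i => nat_of_bool (P a i)) H1 H2)) _ => a.
rewrite lt0n sum_nat_eq0; apply/forallPn/hasP => [[i]|[i]].
  by rewrite eqb0 negbK => Hi; exists (val i) => //; rewrite mem_iota ltn_ord.
by rewrite mem_iota => /andP[_ Hi] Pi; exists (Ordinal Hi); rewrite eqb0 negbK.
Qed.

Lemma ptb_all N (P : A -> nat -> bool) : ptn xs N -> ptb (lift unary xs) (fun p => P p.1 p.2) ->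
  ptb xs (fun a => all (P a) (iota 0 (N a))).
Proof.
move=> H1 H2; apply: ptb_ext (ptb_not (ptb_has H1 (P := fun a i => ~~ P a i) (ptb_not H2))) _ => a.
by rewrite -all_predC; apply: eq_all => i /=; rewrite negbK.
Qed.

Lemma pts_cons b F : ptb xs b -> pts xs F -> pts xs (fun a => b a :: F a).
Proof.
move=> Hb HF; apply: pts_ext (pts_cat (pts_if Hb (pts_bit true) (pts_bit false)) HF) _ => a.
by case: (b a).
Qed.

Lemma pts_rcons b F : ptb xs b -> pts xs F -> pts xs (fun a => rcons (F a) (b a)).
Proof.
by move=> Hb HF; apply: pts_ext (pts_cat HF (pts_cons Hb pts_nil)) _ => a; rewrite cats1.
Qed.

End NatClosure2.

Lemma pts_mkseq A (xs : seq (A -> seq bool)) N (b : A -> nat -> bool) : ptn xs N -> ptb (lift unary xs) (fun p => b p.1 p.2) ->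
  pts xs (fun a => mkseq (b a) (N a)).
Proof.
move=> HN Hb; apply: pts_ext (pts_flatten HN (G := fun a i => [:: b a i]) (pts_cons Hb pts_nil)) _ => a.
by elim: (N a) => [|n IH] //; rewrite !mkseqS flatten_rcons IH cats1.
Qed.

(** The quotient counts the positive multiples of [d] up to [n]; in this form division follows from
    closure under sums and comparisons. *)
Lemma divn_sum n d : 0 < d -> n %/ d = \sum_(i < n) (i.+1 * d <= n).
Proof.
move=> d0; rewrite -(big_mkord xpredT (fun i => nat_of_bool (i.+1 * d <= n))).
have E : n = n %/ d + (n - n %/ d) by rewrite subnKC // leq_div.
rewrite {2}E (big_cat_nat (n := n %/ d)) //= ?leq_addr //.
rewrite big_nat (eq_bigr (fun=> 1)); last by move=> i /andP[_ hi]; rewrite -leq_divRL // hi.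
rewrite -big_nat sum_nat_const_nat subn0 muln1 big_nat big1 ?addn0 // => i /andP[hi _].
by rewrite -leq_divRL // ltnNge hi.
Qed.

Lemma ptn_weak A T (rp : T -> seq bool) (xs : seq (A -> seq bool)) N :
  ptn xs N -> ptn (lift rp xs) (fun p => N p.1).
Proof. exact: pts_weak. Qed.

Lemma ptn_top A (xs : seq (A -> seq bool)) : ptn (lift unary xs) (fun p => p.2).
Proof. exact: pts_top. Qed.

Lemma pts_id A (xs : seq (A -> seq bool)) : pts (lift id xs) (fun p => p.2).
Proof. exact: pts_top. Qed.

Lemma pts_input : pts [:: id] (fun x => x).
Proof. exact: (@pts_var _ [:: id] 0). Qed.

Arguments ptn_weak {A T rp xs N} _.
Arguments ptn_top {A xs}.
Arguments pts_id {A xs}.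

Section NatClosure3.
Variables (A : Type) (xs : seq (A -> seq bool)).
Implicit Types (N : A -> nat) (F : A -> seq bool) (b : A -> bool).

Lemma ptn_div N D : ptn xs N -> ptn xs D -> (forall a, 0 < D a) -> ptn xs (fun a => N a %/ D a).
Proof.
move=> HN HD H.
have H2 : ptb (lift unary xs) (fun p => p.2.+1 * D p.1 <= N p.1).
  exact: ptb_leq (ptn_mul (ptn_succ ptn_top) (ptn_weak HD)) (ptn_weak HN).
apply: ptn_ext (ptn_sum (G := fun a i => nat_of_bool (i.+1 * D a <= N a)) HN H2) _ => a.
by rewrite divn_sum.
Qed.

Lemma ptn_mod N D : ptn xs N -> ptn xs D -> (forall a, 0 < D a) -> ptn xs (fun a => N a %% D a).
Proof.
move=> HN HD H; apply: ptn_ext (ptn_sub HN (ptn_mul (ptn_div HN HD H) HD)) _ => a.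
by rewrite {1}(divn_eq (N a) (D a)) addKn.
Qed.

Lemma ptb_odd N : ptn xs N -> ptb xs (fun a => odd (N a)).
Proof.
move=> H; apply: ptn_ext (ptn_mod H (ptn_const 2) (fun=> isT)) _ => a.
by rewrite modn2.
Qed.

End NatClosure3.

Lemma ptn_iter_half A (xs : seq (A -> seq bool)) N M : ptn xs N -> ptn xs M -> ptn xs (fun a => iter (N a) half (M a)).
Proof.
move=> HN HM.
apply: pts_ext (pts_iter_shrink (S := fun _ v => unary (size v)./2) HN HM _ _) _.
- apply: pts_ext (ptn_div (ptn_size pts_id) (ptn_const 2) (fun=> isT)) _ => -[a v] /=.
  by rewrite divn2.
- by move=> _ v; rewrite size_nseq; lia.
- by move=> a; elim: (N a) => //= n ->; rewrite size_nseq.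
Qed.

(* Tries [t], then [w t], [w (w t)] and so on: [t] is lifted through the variables
   bound since it was stated. *)
Ltac try_weak w t n := first
  [ exact t
  | lazymatch n with S ?m => let t' := uconstr:(w t) in try_weak w t' m end ].

Ltac pt_leaf := lazymatch goal with
  | |- ptn _ _ => first
      [ try_weak uconstr:(ptn_weak) uconstr:(ptn_top) 6
      | match goal with H : ptn _ _ |- _ => try_weak uconstr:(ptn_weak) uconstr:(H) 6 end ]
  | |- ptb _ _ => assumption
  | |- pts _ _ => first
      [ try_weak uconstr:(pts_weak) uconstr:(pts_id) 6
      | try_weak uconstr:(pts_weak) uconstr:(pts_input) 6
      | match goal with H : pts _ _ |- _ => try_weak uconstr:(pts_weak) uconstr:(H) 6 end ]
  end.

(** A hook of the syntax-directed search, redefined whenever closure lemmas for further functions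
    are available. *)
Ltac pt_user := fail.

Ltac pt_step_with user := cbv beta; lazymatch goal with
  | |- ptn _ (fun _ => ?c) => exact (ptn_const c)
  | |- ptn _ (fun a => S (@?F a)) => apply (ptn_succ (N := F))
  | |- ptn _ (fun a => @?F a + @?G a) => apply (ptn_add (N1 := F) (N2 := G))
  | |- ptn _ (fun a => @?F a * @?G a) => apply (ptn_mul (N1 := F) (N2 := G))
  | |- ptn _ (fun a => @?F a - @?G a) => apply (ptn_sub (N1 := F) (N2 := G))
  | |- ptn _ (fun a => @?F a %/ @?G a) => apply (ptn_div (N := F) (D := G)); [ | | try done]
  | |- ptn _ (fun a => @?F a %% @?G a) => apply (ptn_mod (N := F) (D := G)); [ | | try done]
  | |- ptn _ (fun a => iter (@?F a) half (@?G a)) => apply (ptn_iter_half (N := F) (M := G))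
  | |- ptn _ (fun a => size (@?F a)) => apply (ptn_size (F := F))
  | |- ptn _ (fun a => count (@?P a) (iota 0 (@?F a))) => apply (ptn_count (P := P) (N := F))
  | |- ptn _ (fun a => nat_of_bool (@?b a)) => change (ptb _ b)
  | |- ptn _ (fun _ => if _ then _ else _) => apply ptn_if
  | |- ptb _ (fun _ => ?c) => exact (ptb_const c)
  | |- ptb _ (fun a => ~~ (@?F a)) => apply (ptb_not (b := F))
  | |- ptb _ (fun a => @?F a && @?G a) => apply (ptb_and (b1 := F) (b2 := G))
  | |- ptb _ (fun a => @?F a || @?G a) => apply (ptb_or (b1 := F) (b2 := G))
  | |- ptb _ (fun a => @?F a <= @?G a) => apply (ptb_leq (N1 := F) (N2 := G))
  | |- ptb _ (fun a => @eq_op Datatypes_nat__canonical__eqtype_Equality (@?F a) (@?G a)) => apply (ptb_eqn (N1 := F) (N2 := G))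
  | |- ptb _ (fun a => odd (@?F a)) => apply (ptb_odd (N := F))
  | |- ptb _ (fun a => head _ (@?F a)) => apply (ptb_head (F := F))
  | |- ptb _ (fun a => has (@?P a) (iota 0 (@?F a))) => apply (ptb_has (P := P) (N := F))
  | |- ptb _ (fun a => all (@?P a) (iota 0 (@?F a))) => apply (ptb_all (P := P) (N := F))
  | |- ptb _ (fun _ => if _ then _ else _) => apply ptb_if
  | |- pts _ (fun a => @?b a :: @?F a) => apply (pts_cons (b := b) (F := F))
  | |- pts _ (fun a => rcons (@?F a) (@?b a)) => apply (pts_rcons (b := b) (F := F))
  | |- pts _ (fun a => @?F a ++ @?G a) => apply (pts_cat (F := F) (G := G))
  | |- pts _ (fun a => behead (@?F a)) => apply (pts_behead (F := F))
  | |- pts _ (fun a => drop (@?N a) (@?F a)) => apply (pts_drop (F := F) (N := N))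
  | |- pts _ (fun a => flatten (mkseq (@?G a) (@?N a))) => apply (pts_flatten (G := G) (N := N))
  | |- pts _ (fun a => mkseq (@?G a) (@?N a)) => apply (pts_mkseq (b := G) (N := N))
  | |- pts _ (fun _ => if _ then _ else _) => apply pts_if
  | _ => first [user tt | pt_leaf]
  end.

Ltac pt_with user := repeat pt_step_with user.
Ltac pt := pt_with ltac:(fun _ => pt_user).

(** * Reading encoded lists *)

(* [skipe] removes the first entry of an encoded list of numbers whose opening
   [true] has already been removed, and [endl] the whole list; [num] and [len]
   read it. [skipr], [endm], [row] and [nrows] do the same for a list of lists. *)
Definition strip (v : seq bool) : seq bool :=
  iter (size v) (fun v => if head false v then behead v else v) v.

Definition skipe (v : seq bool) : seq bool :=
  if head false v then behead (strip (behead (behead v))) else v.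

Definition numelt (v : seq bool) : nat :=
  size (behead (behead v)) - size (strip (behead (behead v))).

Definition num (v : seq bool) (j : nat) : nat := numelt (iter j skipe v).

Definition len (v : seq bool) : nat :=
  count (fun j => head false (iter j skipe v)) (iota 0 (size v)).

Definition endl (v : seq bool) : seq bool := behead (iter (size v) skipe v).

Definition skipr (v : seq bool) : seq bool :=
  if head false v then endl (behead (behead v)) else v.

Definition row (v : seq bool) (j : nat) : seq bool := behead (behead (iter j skipr v)).

Definition nrows (v : seq bool) : nat :=
  count (fun j => head false (iter j skipr v)) (iota 0 (size v)).

Definition endm (v : seq bool) : seq bool := behead (iter (size v) skipr v).

Lemma size_iter_leq (f : seq bool -> seq bool) n v :
  (forall v, size (f v) <= size v) -> size (iter n f v) <= size v.
Proof. by move=> H; elim: n => //= n; apply: leq_trans. Qed.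

Lemma size_strip v : size (strip v) <= size v.
Proof. by apply: size_iter_leq => -[|[] w] //=; apply: leqnSn. Qed.

Lemma size_skipe v : size (skipe v) <= size v.
Proof.
rewrite /skipe; case: ifP => // _; rewrite size_behead.
by have := size_strip (behead (behead v)); rewrite !size_behead; lia.
Qed.

Lemma size_endl v : size (endl v) <= size v.
Proof. by rewrite size_behead; have := size_iter_leq (size v) v size_skipe; lia. Qed.

Lemma size_skipr v : size (skipr v) <= size v.
Proof.
rewrite /skipr; case: ifP => // _.
by have := size_endl (behead (behead v)); rewrite !size_behead; lia.
Qed.

Section ParseClosure.
Variables (A : Type) (xs : seq (A -> seq bool)).
Implicit Types (F : A -> seq bool) (N : A -> nat).

Lemma pts_strip F : pts xs F -> pts xs (fun a => strip (F a)).
Proof.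
move=> H; apply: (pts_iter_shrink (S := fun _ v => if head false v then behead v else v)) => //.
- by pt.
- by pt.
- by move=> _ [|[] w] //=; apply: leqnSn.
Qed.
End ParseClosure.

Ltac pt_user ::= lazymatch goal with
  | |- pts _ (fun a => strip (@?F a)) => apply (pts_strip (F := F))
  end.

Lemma pts_skipe A (xs : seq (A -> seq bool)) F : pts xs F -> pts xs (fun a => skipe (F a)).
Proof. by move=> H; rewrite /skipe; pt. Qed.

Lemma ptn_numelt A (xs : seq (A -> seq bool)) F : pts xs F -> ptn xs (fun a => numelt (F a)).
Proof. by move=> H; rewrite /numelt; pt. Qed.

Lemma pts_iter_skipe A (xs : seq (A -> seq bool)) F N : pts xs F -> ptn xs N ->
  pts xs (fun a => iter (N a) skipe (F a)).
Proof.
move=> HF HN; apply: (pts_iter_shrink (S := fun _ v => skipe v)) => //.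
- exact: pts_skipe pts_id.
- by move=> _; apply: size_skipe.
Qed.

Ltac pt_user ::= lazymatch goal with
  | |- pts _ (fun a => iter (@?N a) skipe (@?F a)) => apply (pts_iter_skipe (F := F) (N := N))
  | |- ptn _ (fun a => numelt (@?F a)) => apply (ptn_numelt (F := F))
  end.

Lemma ptn_num A (xs : seq (A -> seq bool)) F N : pts xs F -> ptn xs N ->
  ptn xs (fun a => num (F a) (N a)).
Proof. by move=> HF HN; rewrite /num; pt. Qed.

Lemma ptn_len A (xs : seq (A -> seq bool)) F : pts xs F -> ptn xs (fun a => len (F a)).
Proof. by move=> HF; rewrite /len; pt. Qed.

Lemma pts_endl A (xs : seq (A -> seq bool)) F : pts xs F -> pts xs (fun a => endl (F a)).
Proof. by move=> HF; rewrite /endl; pt. Qed.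

Ltac pt_user ::= lazymatch goal with
  | |- pts _ (fun a => endl (@?F a)) => apply (pts_endl (F := F))
  end.

Lemma pts_iter_skipr A (xs : seq (A -> seq bool)) F N : pts xs F -> ptn xs N ->
  pts xs (fun a => iter (N a) skipr (F a)).
Proof.
move=> HF HN; apply: (pts_iter_shrink (S := fun _ v => skipr v)) => //.
- by rewrite /skipr; pt.
- by move=> _; apply: size_skipr.
Qed.

Ltac pt_user ::= lazymatch goal with
  | |- pts _ (fun a => iter (@?N a) skipr (@?F a)) => apply (pts_iter_skipr (F := F) (N := N))
  end.

Lemma pts_row A (xs : seq (A -> seq bool)) F N : pts xs F -> ptn xs N ->
  pts xs (fun a => row (F a) (N a)).
Proof. by move=> HF HN; rewrite /row; pt. Qed.

Lemma ptn_nrows A (xs : seq (A -> seq bool)) F : pts xs F -> ptn xs (fun a => nrows (F a)).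
Proof. by move=> HF; rewrite /nrows; pt. Qed.

Lemma pts_endm A (xs : seq (A -> seq bool)) F : pts xs F -> pts xs (fun a => endm (F a)).
Proof. by move=> HF; rewrite /endm; pt. Qed.

(** * Decoding inverts encoding *)

Definition encl (l : seq data) : seq bool := flatten [seq true :: enc d | d <- l].

Lemma encl_cons d l : encl (d :: l) = true :: enc d ++ encl l.
Proof. by []. Qed.

Lemma enc_list l : enc (DList l) = true :: rcons (encl l) false.
Proof.
by rewrite /=; congr (_ :: rcons _ _); elim: l => //= d l ->.
Qed.

Lemma strip_ones k r : strip (nseq k true ++ false :: r) = false :: r.
Proof.
rewrite /strip; have : k <= size (nseq k true ++ false :: r) by rewrite size_cat size_nseq leq_addr.
move: (size _) => m.
elim: m k => [|m IH] [|k] //; last by rewrite iterSr /= ltnS; apply: IH.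
by move=> _; rewrite iterSr; apply: (IH 0).
Qed.

Section Rows.
Variables (step : seq bool -> seq bool).
Hypothesis step0 : forall r, step (false :: r) = false :: r.
Variables (T : Type) (E : T -> data).
Hypothesis stepS : forall d r, step (true :: enc (E d) ++ r) = r.

(** At the closing bit the step is the identity, so iterating too often does no harm and the length
    of the whole string can serve as the number of iterations. *)
Lemma iter_rows j (l : seq T) r :
  iter j step (encl (map E l) ++ false :: r) = encl (map E (drop j l)) ++ false :: r.
Proof.
elim: j l => [|j IH] [|d l]; rewrite ?drop0 // iterSr.
  by rewrite [encl _]/= step0; apply: (IH [::]).
by rewrite /encl /= -catA stepS; apply: IH.
Qed.

Lemma size_encl_geq (l : seq T) : size l <= size (encl (map E l)).
Proof. by elim: l => //= d l; rewrite /encl /= size_cat; lia. Qed.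

Lemma head_rows j (l : seq T) r :
  head false (iter j step (encl (map E l) ++ false :: r)) = (j < size l).
Proof.
rewrite iter_rows -subn_gt0 -size_drop; by case: (drop j l).
Qed.

Lemma end_rows (l : seq T) r :
  behead (iter (size (encl (map E l) ++ false :: r)) step (encl (map E l) ++ false :: r)) = r.
Proof.
rewrite iter_rows drop_oversize // size_cat.
exact: leq_trans (size_encl_geq l) (leq_addr _ _).
Qed.

Lemma count_rows (l : seq T) r :
  count (fun j => head false (iter j step (encl (map E l) ++ false :: r)))
    (iota 0 (size (encl (map E l) ++ false :: r))) = size l.
Proof.
set n := size (_ ++ _); have hn : size l <= n.
  by rewrite /n size_cat; apply: leq_trans (size_encl_geq l) (leq_addr _ _).
under eq_count => j do rewrite head_rows.
rewrite -(subnKC hn) iotaD count_cat add0n.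
rewrite (eq_in_count (a2 := predT)); last by move=> j; rewrite mem_iota.
rewrite count_predT size_iota (eq_in_count (a2 := pred0)) ?count_pred0 ?addn0 // => j.
by rewrite mem_iota => /andP[h _]; rewrite ltnNge h.
Qed.
End Rows.

Lemma skipe_nil r : skipe (false :: r) = false :: r.
Proof. by []. Qed.

Lemma skipe_cons a r : skipe (true :: enc (DNat a) ++ r) = r.
Proof. by rewrite /skipe /= cat_rcons strip_ones. Qed.

Lemma numelt_cons a r : numelt (true :: enc (DNat a) ++ r) = a.
Proof. by rewrite /numelt /= cat_rcons strip_ones size_cat size_nseq addnK. Qed.

Definition nl (l : seq nat) (r : seq bool) : seq bool := encl (map DNat l) ++ false :: r.

Lemma num_nl l r j : j < size l -> num (nl l r) j = nth 0 l j.
Proof.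
move=> h; rewrite /num (iter_rows skipe_nil skipe_cons) (drop_nth 0 h) map_cons encl_cons cat_cons -catA.
exact: numelt_cons.
Qed.

Lemma len_nl l r : len (nl l r) = size l.
Proof. exact: (count_rows skipe_nil skipe_cons). Qed.

Lemma endl_nl l r : endl (nl l r) = r.
Proof. exact: (end_rows skipe_nil skipe_cons). Qed.

Definition list_data (l : seq nat) : data := DList (map DNat l).

Lemma enc_list_data l r : enc (list_data l) ++ r = true :: nl l r.
Proof. by rewrite enc_list /= cat_rcons. Qed.

Lemma skipr_nil r : skipr (false :: r) = false :: r.
Proof. by []. Qed.

Lemma skipr_cons l r : skipr (true :: enc (list_data l) ++ r) = r.
Proof. by rewrite enc_list_data /skipr endl_nl. Qed.

Definition ml (m : seq (seq nat)) (r : seq bool) : seq bool := encl (map list_data m) ++ false :: r.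

(** The remainder may stay unspecified because reading a row never looks beyond its closing bit. *)
Lemma row_ml m r j : j < size m -> exists r', row (ml m r) j = nl (nth [::] m j) r'.
Proof.
move=> h; rewrite /row (iter_rows skipr_nil skipr_cons) (drop_nth [::] h) map_cons encl_cons cat_cons -catA.
by rewrite enc_list_data; eexists.
Qed.

Lemma nrows_ml m r : nrows (ml m r) = size m.
Proof. exact: (count_rows skipr_nil skipr_cons). Qed.

Lemma endm_ml m r : endm (ml m r) = r.
Proof. exact: (end_rows skipr_nil skipr_cons). Qed.

(** * Printing encoded data *)

Definition ptd (A : Type) (xs : seq (A -> seq bool)) (D : A -> data) : Prop :=
  pts xs (fun a => enc (D a)).

(** Without the outer brackets, concatenating lists is concatenating codes, so long lists can be
    printed piecewise. *)
Definition ptl (A : Type) (xs : seq (A -> seq bool)) (L : A -> seq data) : Prop :=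
  pts xs (fun a => encl (L a)).

Ltac pt_user ::= lazymatch goal with
  | |- pts _ (fun a => unary (@?F a)) => change (ptn _ F)
  | |- pts _ (fun a => row (@?F a) (@?N a)) => apply (pts_row (F := F) (N := N))
  | |- pts _ (fun a => endl (@?F a)) => apply (pts_endl (F := F))
  | |- pts _ (fun a => endm (@?F a)) => apply (pts_endm (F := F))
  | |- pts _ (fun a => skipe (@?F a)) => apply (pts_skipe (F := F))
  | |- ptn _ (fun a => numelt (@?F a)) => apply (ptn_numelt (F := F))
  | |- ptn _ (fun a => num (@?F a) (@?N a)) => apply (ptn_num (F := F) (N := N))
  | |- ptn _ (fun a => len (@?F a)) => apply (ptn_len (F := F))
  | |- ptn _ (fun a => nrows (@?F a)) => apply (ptn_nrows (F := F))
  end.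

Section DataClosure.
Variables (A : Type) (xs : seq (A -> seq bool)).

Lemma ptd_nat N : ptn xs N -> ptd xs (fun a => DNat (N a)).
Proof.
move=> H; apply: (pts_ext (F := fun a => false :: rcons (unary (N a)) false)) => //.
by pt.
Qed.

Lemma ptd_list L : ptl xs L -> ptd xs (fun a => DList (L a)).
Proof.
move=> H; apply: (pts_ext (F := fun a => true :: rcons (encl (L a)) false)); last by move=> a; rewrite enc_list.
by apply: pts_cons; [pt | apply: pts_rcons; [pt | exact: H]].
Qed.

Lemma ptl_if b L1 L2 : ptb xs b -> ptl xs L1 -> ptl xs L2 -> ptl xs (fun a => if b a then L1 a else L2 a).
Proof. by move=> Hb H1 H2; apply: pts_ext (pts_if Hb H1 H2) _ => a; case: (b a). Qed.

Lemma ptl_nil : ptl xs (fun=> [::]).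
Proof. exact: pts_nil. Qed.

Lemma ptl_cons D L : ptd xs D -> ptl xs L -> ptl xs (fun a => D a :: L a).
Proof.
move=> HD HL; apply: (pts_ext (F := fun a => true :: enc (D a) ++ encl (L a))) => //.
by apply: pts_cons; [pt | apply: pts_cat].
Qed.

Lemma ptl_flatten N (L : A -> nat -> seq data) : ptn xs N ->
  ptl (lift unary xs) (fun p => L p.1 p.2) -> ptl xs (fun a => flatten (mkseq (L a) (N a))).
Proof.
move=> HN HL; apply: pts_ext (pts_flatten (G := fun a i => encl (L a i)) HN HL) _ => a.
elim: (N a) => [|n IH] //; rewrite !mkseqS !flatten_rcons IH.
by rewrite /encl map_cat flatten_cat.
Qed.
End DataClosure.

Arguments ptl_nil {A xs}.

Lemma ptl_mkseq A (xs : seq (A -> seq bool)) N (D : A -> nat -> data) : ptn xs N ->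
  ptd (lift unary xs) (fun p => D p.1 p.2) -> ptl xs (fun a => mkseq (D a) (N a)).
Proof.
move=> HN HD.
apply: pts_ext (ptl_flatten (L := fun a i => [:: D a i]) HN (ptl_cons HD ptl_nil)) _ => a.
by congr encl; elim: (N a) => [|n IH] //; rewrite !mkseqS flatten_rcons IH cats1.
Qed.

(** * Circuits of multiplexers *)

(** Given constant cells, every Boolean operation, copy and case distinction is a multiplexer, so
    few shapes of gate blocks have to be printed. *)
Inductive cell := CIn of nat | CConst of bool | CMux of nat & nat & nat.

Section Cells.
Variables (F : nat -> cell) (inp : seq bool).

Definition cell_val (vals : seq bool) (c : cell) : bool :=
  match c with
  | CIn j => nth false inp j
  | CConst b => b
  | CMux s a b => if nth false vals s then nth false vals a else nth false vals b
  end.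

Fixpoint cvals (m : nat) : seq bool :=
  if m is m'.+1 then rcons (cvals m') (cell_val (cvals m') (F m')) else [::].

Definition cval (j : nat) : bool := cell_val (cvals j) (F j).

Lemma size_cvals m : size (cvals m) = m.
Proof. by elim: m => //= m IH; rewrite size_rcons IH. Qed.

Lemma nth_cvals m j : nth false (cvals m) j = (j < m) && cval j.
Proof.
elim: m => [|m IH] /=; first by rewrite nth_nil.
by rewrite nth_rcons size_cvals ltnS IH; case: ltngtP => // ->.
Qed.

Lemma cval_in j i : F j = CIn i -> cval j = nth false inp i.
Proof. by rewrite /cval => ->. Qed.

Lemma cval_const j b : F j = CConst b -> cval j = b.
Proof. by rewrite /cval => ->. Qed.

(** A reference to a cell that is not earlier reads as false. The given circuit may contain such
    references, and their meaning has to be preserved. *)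
Lemma cval_mux_gen j s a b : F j = CMux s a b -> cval j =
  if (s < j) && cval s then (a < j) && cval a else (b < j) && cval b.
Proof. by rewrite {1}/cval => -> /=; rewrite !nth_cvals. Qed.

Lemma cval_mux j s a b : F j = CMux s a b -> s < j -> a < j -> b < j ->
  cval j = if cval s then cval a else cval b.
Proof. by move/cval_mux_gen => -> -> -> ->. Qed.

(* A cell takes four gates, the last of which carries its value. *)
Definition cell_gates (i : nat) (c : cell) : seq gate :=
  match c with
  | CIn j => [:: GConst false; GConst false; GConst false; GIn j]
  | CConst b => [:: GConst false; GConst false; GConst false; GConst b]
  | CMux s a b => [:: GNot (4 * s + 3); GAnd (4 * s + 3) (4 * a + 3);
                      GAnd (4 * i) (4 * b + 3); GOr (4 * i + 1) (4 * i + 2)]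
  end.

Definition cells_gates (m : nat) : seq gate := flatten (mkseq (fun i => cell_gates i (F i)) m).

Lemma nth_cells_gates m outs c :
  nth false (circ_vals {| c_gates := cells_gates m; c_outs := outs |} inp) (4 * c + 3) =
  (c < m) && cval c.
Proof.
rewrite /circ_vals /=; set run := foldl _ _.
have [_ H] : size (run (cells_gates m)) = 4 * m /\
    forall c, nth false (run (cells_gates m)) (4 * c + 3) = (c < m) && cval c.
  elim: m => [|m [sz IH]]; first by split=> // c'; rewrite nth_nil.
  rewrite /cells_gates mkseqS flatten_rcons -/(cells_gates m) /run foldl_cat -/run.
  set vs := run (cells_gates m) in sz IH *; set step := fun _ _ => _.
  (* While the block of cell [m] is incomplete, an index [4 * j + 3] meets only finished blocks, so
     references to cell [m] itself or beyond read as false. *)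
  have N3 w j : size w <= 3 -> nth false (vs ++ w) (4 * j + 3) = (j < m) && cval j.
    rewrite nth_cat sz -IH; case: ltnP => h hw //.
    by rewrite !nth_default ?sz //; lia.
  have N0 w j : nth false (vs ++ w) (4 * m + j) = nth false w j.
    by rewrite nth_cat sz ltnNge leq_addr /= addKn.
  have N0' w : nth false (vs ++ w) (4 * m) = nth false w 0 by rewrite -(N0 w 0) addn0.
  have St w g : step (vs ++ w) g = vs ++ rcons w (gate_val inp (vs ++ w) g).
    by rewrite /step rcons_cat.
  have [g [-> sg Hg]] : exists g, [/\ foldl step vs (cell_gates m (F m)) = vs ++ g,
      size g = 4 & nth false g 3 = cval m].
    rewrite /cval -{1}(cats0 vs); case: (F m) => [j|b|s a b] /=; rewrite !St /=;
      eexists; split; try reflexivity; rewrite //=.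
    by rewrite !(N3, N0, N0') //= !nth_cvals; case: ((s < m) && cval s); rewrite /= ?orbF.
  split=> [|c']; first by rewrite size_cat sz sg; lia.
  rewrite nth_cat sz; case: (ltngtP c' m) => h.
  - have -> : 4 * c' + 3 < 4 * m by lia.
    by rewrite IH h ltnS (ltnW h).
  - have -> : 4 * c' + 3 < 4 * m = false by lia.
    have -> : c' < m.+1 = false by lia.
    by rewrite nth_default // sg; lia.
  - subst c'; have -> : 4 * m + 3 < 4 * m = false by lia.
    by rewrite ltnSn /= -Hg addKn.
exact: H.
Qed.
End Cells.

(** * The circuit of the labelling *)

(* [s_last] and [s_first] are the last and the first nonzero sign, [s_alt] is the
   number of starts, [s_cnt] counts the selected starts of each sign, at most [k]
   of them, and [s_win] is the first sign to reach [k]. *)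
Record scan := Scan {
  s_last : option nat; s_first : option nat; s_alt : nat;
  s_cnt : nat -> nat; s_win : option nat }.

Definition scan0 : scan := Scan None None 0 (fun=> 0) None.

Definition fresh (e : nat) (s : scan) : bool := s_last s != Some e.
Definition selects (k e : nat) (s : scan) : bool := fresh e s && (s_cnt s e < k).

(** Counting continues after a winner is known and stops at [k] through [selects], so the winner
    keeps exactly its first [k] starts. *)
Definition scan_step (k : nat) (counted : bool) (e : nat) (s : scan) : scan :=
  let cnt x := s_cnt s x + [&& x == e, counted & selects k e s] in
  Scan (Some e) (if s_first s is Some f then Some f else Some e) (s_alt s + fresh e s) cnt
    (if s_win s is Some f then Some f else if k <= cnt e then Some e else None).

Definition bitn (v b : nat) : bool := odd (iter b half v).

(** The value at the largest selected index up to [e], or false if there is none; a run of cells,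
    each deferring to the one before, computes it. *)
Fixpoint chain (sel val : nat -> bool) (e : nat) : bool :=
  if sel e then val e else if e is e'.+1 then chain sel val e' else false.

Lemma chain_unique sel val x c e : (forall i, i <= e -> sel i = (i == x) && c) ->
  chain sel val e = [&& x <= e, c & val x].
Proof.
elim: e => [|e IH] H /=; rewrite H // 1?IH; last by move=> i ie; apply: H; apply: leqW.
  by rewrite leqn0 eq_sym; case: eqP => // ->; case: (c).
by case: (ltngtP x e.+1) => h /=; [rewrite -ltnS h | rewrite leqNgt (ltnW h) | rewrite h; case: (c); rewrite //= ltnn].
Qed.

(** Selectors in unary form are true up to a threshold, so the last true one sits there: the run is
    a table lookup at a number stored in unary. *)
Lemma chain_initial sel val w c e : (forall i, i <= e -> sel i = (i <= w) && c) ->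
  chain sel val e = c && val (minn e w).
Proof.
elim: e => [|e IH] H /=; rewrite H // 1?IH; try by move=> i ie; apply: H; apply: leqW.
  by rewrite min0n; case: (c).
case: (boolP (e < w)) => /= [h|]; last by rewrite -leqNgt => h; rewrite (minn_idPr h) (minn_idPr (leqW h)).
by rewrite (minn_idPl h); case: (c); rewrite ?andbF.
Qed.

Lemma eq_chain sel sel' val val' e : (forall i, i <= e -> sel i = sel' i /\ val i = val' i) ->
  chain sel val e = chain sel' val' e.
Proof.
elim: e => [|e IH] H /=; first by have [-> ->] := H 0 isT.
by have [-> ->] := H e.+1 (leqnn _); rewrite IH // => i ie; apply: H; apply: leqW.
Qed.

Definition gtype (g : gate) : nat :=
  match g with GIn _ => 0 | GConst _ => 1 | GNot _ => 2 | GAnd _ _ => 3 | GOr _ _ => 4 end.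
Definition garg1 (g : gate) : nat :=
  match g with GIn j => j | GConst b => b | GNot a => a | GAnd a _ => a | GOr a _ => a end.
Definition garg2 (g : gate) : nat :=
  match g with GAnd _ b => b | GOr _ b => b | _ => 0 end.

Section GateValues.
Variable inp : seq bool.
Let run := foldl (fun vals g => rcons vals (gate_val inp vals g)) [::].

Lemma nth_gate_run (l : seq gate) j : nth false (run l) j =
  (j < size l) && gate_val inp (run (take j l)) (nth (GConst false) l j).
Proof.
have run_rcons l' g : run (rcons l' g) = rcons (run l') (gate_val inp (run l') g).
  by rewrite /run foldl_rcons.
have sz l' : size (run l') = size l'.
  by elim/last_ind: l' => //= l' g IH; rewrite run_rcons !size_rcons IH.
elim/last_ind: l => [|l g IH]; first by rewrite /run /= nth_nil.
rewrite run_rcons !nth_rcons sz size_rcons ltnS IH.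
case: (ltngtP j (size l)) => //= [h|->]; first by rewrite -cats1 takel_cat // ltnW.
by rewrite -cats1 take_size_cat.
Qed.
End GateValues.

Lemma bits_to_nat_bitn v m : v < 2 ^ m -> bits_to_nat (mkseq (bitn v) m) = v.
Proof.
elim: m v => [|m IH] v; first by rewrite expn0 ltnS leqn0 => /eqP ->.
rewrite expnS => h; have -> : mkseq (bitn v) m.+1 = odd v :: mkseq (bitn v./2) m.
  rewrite /mkseq /= -[1]addn0 iotaDl -map_comp; congr (_ :: _).
  by apply: eq_map => b; rewrite /= add1n /bitn iterSr.
rewrite [LHS]/= -/(bits_to_nat _) IH ?odd_double_half //.
by rewrite -ltn_double -!mul2n; apply: leq_ltn_trans h; rewrite mul2n -{2}(odd_double_half v) leq_addl.
Qed.

Lemma bits_to_nat_false s m : bits_to_nat (s ++ nseq m false) = bits_to_nat s.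
Proof. by elim: s => [|b s /= ->] //; elim: m => //= m ->. Qed.

Section Circuit.
Variables (p n k : nat) (ty ga gb : nat -> nat) (ng : nat) (og : nat -> nat) (no : nat).
Hypotheses (p_gt1 : 1 < p) (k_gt0 : 0 < k).

(* The [dim - n] additional coordinates contribute to [s_alt] but are never
   selected, and [p * (k - 1) + (dim - n) = (p - 1) * nu]. *)
Definition nu : nat := 2 * (k - 1).
Definition dim : nat := n + (k - 1) * (p - 2).
Definition ncol : nat := kneser_m p n k.
(** The largest threshold consulted is [(p - 1) * nu + 1], by the last entry of the label lookup. *)
Definition nalt : nat := (p - 1) * nu + 2.

(* Row [t] of the table describes the scan after [t] input bits. Its cells 0, 1, 2
   are the input bit [t - 1], whether it is a start, and whether moreover its sign
   has fewer than [k] selected starts; the others encode the scan one-hot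
   ([cLAST], [cFIRST], [cWIN]) or in unary ([cALT], [cGE]). *)
Definition cLAST (e : nat) := 3 + e.
Definition cFIRST (e : nat) := 3 + p + e.
Definition cALT (c : nat) := 3 + p + p + c.
Definition cGE (e c : nat) := 3 + p + p + nalt + (e * k.+1 + c).
Definition cDONE := 3 + p + p + nalt + p * k.+1.
Definition cWIN (e : nat) := cDONE + 1 + e.
Definition width := cDONE + 1 + p.

(* Cell 0 of row 0 is false and cell [cALT 0] of row 0 is true. *)
Definition cTRUE := cALT 0.

(** A cell refers only to the previous row, to smaller columns of its own row, or to constants, so
    all references point backwards; [CMux 0 0] copies its last argument. *)
Definition rowcell (t i : nat) : cell :=
  let t' := t - 1 in
  let e := t' %% p in
  let r c := t * width + c in
  let r' c := t' * width + c in
  if t == 0 then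
    CConst ((i == cALT 0) || [&& cGE 0 0 <= i, i < cDONE & (i - cGE 0 0) %% k.+1 == 0])
  else if i == 0 then CIn t'
  else if i == 1 then CMux (r' (cLAST e)) 0 (r 0)
  else if i == 2 then CMux (r' (cGE e k)) 0 (r 1)
  else if i < cFIRST 0 then CMux (r 0) (if i == cLAST e then cTRUE else 0) (r' i)
  else if i < cALT 0 then CMux (r' (cALT 1)) (r' i) (if i == cFIRST e then r 0 else 0)
  else if i < cGE 0 0 then
    if i == cALT 0 then CConst true else CMux (r 1) (r' (i - 1)) (r' i)
  else if i < cDONE then
    if (i - cGE 0 0) %% k.+1 == 0 then CConst true
    else if ((i - cGE 0 0) %/ k.+1 == e) && (t' < n * p) then CMux (r 2) (r' (i - 1)) (r' i)
    else CMux 0 0 (r' i)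
  else if i == cDONE then CMux (r' cDONE) cTRUE (r (cGE e k))
  else CMux (r' cDONE) (r' i) (if i == cWIN e then r (cGE e k) else 0).

(* After the rows come the selected set ([bS]), the gates of the given circuit
   ([bC]), the sign in one-hot form ([bZ]) and in binary ([bO]), the second label
   when no sign wins ([bL]), and the second label ([bF]); a disjunction or a case
   distinction is a run of consecutive cells, each deferring to the one before. *)
Definition nrow := dim * p.
Definition bS := nrow.+1 * width.
Definition bC := bS + n * p.
Definition bZ := bC + ng.
Definition bO := bZ + p.
Definition bL := bO + p * p.
(** Since [N < 2 ^ N], this width holds every alternation label without computing logarithms; [no]
    makes room for the output bits of the given circuit. *)
Definition nbits := no + ncol + nu.
Definition bF := bL + nbits * nu.+1.
Definition ncells := bF + nbits.

Definition final (c : nat) : nat := nrow * width + c.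

(* [ty], [ga], [gb] list the type and the arguments of the gates of the given
   circuit, whose inputs are replaced by the cells of the selected set. *)
Definition gatecell (i : nat) : cell :=
  if ty i == 0 then
    if ga i < n then CMux (bS + (ga i * p + p.-1)) cTRUE 0 else CConst false
  else if ty i == 1 then CConst (0 < ga i)
  else if ty i == 2 then CMux (bC + ga i) 0 cTRUE
  else if ty i == 3 then CMux (bC + ga i) (bC + gb i) 0
  else CMux (bC + ga i) cTRUE (bC + gb i).

Definition cellf (j : nat) : cell :=
  if j < bS then rowcell (j %/ width) (j %% width)
  else if j < bC then
    CMux ((j - bS).+1 * width + 2) (final (cWIN ((j - bS) %% p)))
      (if (j - bS) %% p == 0 then 0 else j - 1)
  else if j < bZ then gatecell (j - bC)
  else if j < bO then CMux (final cDONE) (final (cWIN (j - bZ))) (final (cFIRST (j - bZ)))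
  else if j < bL then
    CMux (bZ + (j - bO) %% p) (if bitn ((j - bO) %% p) ((j - bO) %/ p) then cTRUE else 0)
      (if (j - bO) %% p == 0 then 0 else j - 1)
  else if j < bF then
    CMux (final (cALT ((p - 1) * ((j - bL) %% nu.+1) + 1)))
      (if bitn (ncol + (j - bL) %% nu.+1) ((j - bL) %/ nu.+1) then cTRUE else 0)
      (if (j - bL) %% nu.+1 == 0 then 0 else j - 1)
  else CMux (final cDONE) (if (j - bF < no) && (og (j - bF) < ng) then bC + og (j - bF) else 0)
    (bL + ((j - bF) * nu.+1 + nu)).

Definition tucker_circuit : circuit :=
  {| c_gates := cells_gates cellf ncells;
     c_outs := [:: mkseq (fun b => 4 * (bO + (b * p + p.-1)) + 3) p;
                   mkseq (fun b => 4 * (bF + b) + 3) nbits] |}.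

Lemma nalt_gt1 : 1 < nalt.
Proof. by rewrite /nalt addn2. Qed.

Ltac cols := rewrite /width /cWIN /cDONE /cGE /cALT /cFIRST /cLAST; have := nalt_gt1; lia.

Lemma cGE_bound e c : e < p -> c <= k -> cGE e c < cDONE.
Proof.
move=> ep ck; rewrite /cGE /cDONE ltn_add2l.
have : e.+1 * k.+1 <= p * k.+1 by rewrite leq_mul2r ep orbT.
by rewrite mulSn; lia.
Qed.

Lemma cGE_mod e c : c <= k -> (cGE e c - cGE 0 0) %% k.+1 = c.
Proof. by move=> ck; rewrite /cGE mul0n !addn0 addKn modnMDl modn_small. Qed.

Lemma cGE_div e c : c <= k -> (cGE e c - cGE 0 0) %/ k.+1 = e.
Proof. by move=> ck; rewrite /cGE mul0n !addn0 addKn divnMDl // divn_small ?addn0. Qed.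

Lemma cLAST_lt e : e < p -> cLAST e < width. Proof. cols. Qed.
Lemma cFIRST_lt e : e < p -> cFIRST e < width. Proof. cols. Qed.
Lemma cALT_lt c : c < nalt -> cALT c < width. Proof. cols. Qed.
Lemma cDONE_lt : cDONE < width. Proof. cols. Qed.
Lemma cWIN_lt e : e < p -> cWIN e < width. Proof. cols. Qed.
Lemma cGE_lt e c : e < p -> c <= k -> cGE e c < width.
Proof. by move=> ep ck; apply: ltn_trans (cGE_bound ep ck) cDONE_lt. Qed.
Lemma two_lt : 2 < width. Proof. cols. Qed.
Lemma cGE_gt2 e c : 2 < cGE e c. Proof. cols. Qed.
Lemma cALT_gt1 c : 1 < cALT c. Proof. cols. Qed.
Lemma cLAST_gt0 e : 0 < cLAST e. Proof. by []. Qed.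
Lemma cFIRST_gt0 e : 0 < cFIRST e. Proof. cols. Qed.
Lemma cGE_WIN e c e' : e < p -> c <= k -> cGE e c < cWIN e'.
Proof. by move=> ep ck; apply: ltn_trans (cGE_bound ep ck) _; cols. Qed.

Section RowCells.
Variable t : nat.
Let e := t %% p.
Let r c := t.+1 * width + c.
Let r' c := t * width + c.

Lemma rowcell_in : rowcell t.+1 0 = CIn t.
Proof. by rewrite /rowcell subSS subn0. Qed.

Lemma rowcell_fresh : rowcell t.+1 1 = CMux (r' (cLAST e)) 0 (r 0).
Proof. by rewrite /rowcell subSS subn0. Qed.

Lemma rowcell_sel : rowcell t.+1 2 = CMux (r' (cGE e k)) 0 (r 1).
Proof. by rewrite /rowcell subSS subn0. Qed.

Lemma rowcell_last x : x < p ->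
  rowcell t.+1 (cLAST x) = CMux (r 0) (if x == e then cTRUE else 0) (r' (cLAST x)).
Proof.
move=> xp; rewrite /rowcell subSS subn0.
have -> : (t.+1 == 0) = false by [].
have -> : (cLAST x < cFIRST 0) by cols.
by have -> : (cLAST x == cLAST e) = (x == e) by rewrite /cLAST eqn_add2l.
Qed.

Lemma rowcell_first x : x < p ->
  rowcell t.+1 (cFIRST x) = CMux (r' (cALT 1)) (r' (cFIRST x)) (if x == e then r 0 else 0).
Proof.
move=> xp; rewrite /rowcell subSS subn0.
have -> : (t.+1 == 0) = false by [].
have -> : (cFIRST x == 0) = false by cols.
have -> : (cFIRST x == 1) = false by cols.
have -> : (cFIRST x == 2) = false by cols.
have -> : (cFIRST x < cFIRST 0) = false by cols.
have -> : (cFIRST x < cALT 0) by cols.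
by have -> : (cFIRST x == cFIRST e) = (x == e) by rewrite /cFIRST eqn_add2l.
Qed.

Lemma rowcell_alt c : c < nalt -> rowcell t.+1 (cALT c) =
  if c == 0 then CConst true else CMux (r 1) (r' (cALT (c - 1))) (r' (cALT c)).
Proof.
move=> cn; rewrite /rowcell subSS subn0.
have -> : (t.+1 == 0) = false by [].
have -> : (cALT c == 0) = false by cols.
have -> : (cALT c == 1) = false by cols.
have -> : (cALT c == 2) = false by cols.
have -> : (cALT c < cFIRST 0) = false by cols.
have -> : (cALT c < cALT 0) = false by cols.
have -> : (cALT c < cGE 0 0) by cols.
have -> : (cALT c == cALT 0) = (c == 0) by rewrite /cALT eqn_add2l.
by case: eqP => // c0; have -> : cALT c - 1 = cALT (c - 1) by rewrite /cALT; lia.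
Qed.

Lemma rowcell_ge x c : x < p -> c <= k -> rowcell t.+1 (cGE x c) =
  if c == 0 then CConst true else
  if (x == e) && (t < n * p) then CMux (r 2) (r' (cGE x (c - 1))) (r' (cGE x c))
  else CMux 0 0 (r' (cGE x c)).
Proof.
move=> xp ck; have hb := cGE_bound xp ck; rewrite /rowcell subSS subn0.
have -> : (t.+1 == 0) = false by [].
have -> : (cGE x c == 0) = false by cols.
have -> : (cGE x c == 1) = false by cols.
have -> : (cGE x c == 2) = false by cols.
have -> : (cGE x c < cFIRST 0) = false by cols.
have -> : (cGE x c < cALT 0) = false by cols.
have -> : (cGE x c < cGE 0 0) = false by cols.
rewrite hb cGE_mod // cGE_div //; case: eqP => // c0.
by have -> : cGE x c - 1 = cGE x (c - 1) by rewrite /cGE; lia.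
Qed.

Lemma rowcell_done : rowcell t.+1 cDONE = CMux (r' cDONE) cTRUE (r (cGE e k)).
Proof.
rewrite /rowcell subSS subn0.
have -> : (t.+1 == 0) = false by [].
have -> : (cDONE == 0) = false by cols.
have -> : (cDONE == 1) = false by cols.
have -> : (cDONE == 2) = false by cols.
have -> : (cDONE < cFIRST 0) = false by cols.
have -> : (cDONE < cALT 0) = false by cols.
have -> : (cDONE < cGE 0 0) = false by cols.
by rewrite ltnn eqxx.
Qed.

Lemma rowcell_win x : x < p -> rowcell t.+1 (cWIN x) =
  CMux (r' cDONE) (r' (cWIN x)) (if x == e then r (cGE e k) else 0).
Proof.
move=> xp; rewrite /rowcell subSS subn0.
have -> : (t.+1 == 0) = false by [].
have -> : (cWIN x == 0) = false by cols.
have -> : (cWIN x == 1) = false by cols.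
have -> : (cWIN x == 2) = false by cols.
have -> : (cWIN x < cFIRST 0) = false by cols.
have -> : (cWIN x < cALT 0) = false by cols.
have -> : (cWIN x < cGE 0 0) = false by cols.
have -> : (cWIN x < cDONE) = false by cols.
have -> : (cWIN x == cDONE) = false by cols.
by have -> : (cWIN x == cWIN e) = (x == e) by rewrite /cWIN eqn_add2l.
Qed.
End RowCells.

(** * Values computed by the cells *)

Section Eval.
Variable inp : seq bool.
Let cv := cval cellf inp.

Fixpoint sscan (t : nat) : scan :=
  if t is t'.+1 then
    if nth false inp t' then scan_step k (t' < n * p) (t' %% p) (sscan t') else sscan t'
  else scan0.

Lemma width_gt c : c < width -> 0 < width.
Proof. by case: width. Qed.

Lemma cellf_row t i : t <= nrow -> i < width -> cellf (t * width + i) = rowcell t i.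
Proof.
move=> ht hi; have w0 := width_gt hi.
rewrite /cellf divnMDl // divn_small // addn0 modnMDl modn_small //.
have -> // : t * width + i < bS.
rewrite /bS mulSn addnC; apply: leq_ltn_trans (_ : width + nrow * width - 1 < _); last by lia.
have : t * width <= nrow * width by rewrite leq_mul2r ht orbT.
by lia.
Qed.

Record row_ok (t : nat) (s : scan) : Prop := RowOk {
  row_last : forall e, e < p -> cv (t * width + cLAST e) = (s_last s == Some e);
  row_first : forall e, e < p -> cv (t * width + cFIRST e) = (s_first s == Some e);
  row_alt : forall c, c < nalt -> cv (t * width + cALT c) = (c <= s_alt s);
  row_ge : forall e c, e < p -> c <= k -> cv (t * width + cGE e c) = (c <= s_cnt s e);
  row_done : cv (t * width + cDONE) = (s_win s != None);
  row_win : forall e, e < p -> cv (t * width + cWIN e) = (s_win s == Some e) }.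

Lemma row0_ok : row_ok 0 scan0.
Proof.
have E i : i < width -> cv (0 * width + i) =
    ((i == cALT 0) || [&& cGE 0 0 <= i, i < cDONE & (i - cGE 0 0) %% k.+1 == 0]).
  by move=> hi; apply: cval_const; rewrite cellf_row.
split=> /=.
- move=> e ep; rewrite E; last by cols.
  have -> : (cLAST e == cALT 0) = false by cols.
  by have -> : (cGE 0 0 <= cLAST e) = false by cols.
- move=> e ep; rewrite E; last by cols.
  have -> : (cFIRST e == cALT 0) = false by cols.
  by have -> : (cGE 0 0 <= cFIRST e) = false by cols.
- move=> c cn; rewrite E; last by cols.
  have -> : (cGE 0 0 <= cALT c) = false by cols.
  by rewrite orbF leqn0 /cALT eqn_add2l.
- move=> e c ep ck; have hb := cGE_bound ep ck; rewrite E; last by move: hb; cols.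
  rewrite cGE_mod // hb leqn0.
  have -> : (cGE 0 0 <= cGE e c) by cols.
  by have -> : (cGE e c == cALT 0) = false by cols.
- rewrite E; last by cols.
  by rewrite ltnn andbF orbF; have -> : (cDONE == cALT 0) = false by cols.
- move=> e ep; rewrite E; last by cols.
  have -> : (cWIN e < cDONE) = false by cols.
  by rewrite andbF orbF; have -> : (cWIN e == cALT 0) = false by cols.
Qed.

Lemma cv_false : cv 0 = false.
Proof.
by apply: cval_const; rewrite -[X in cellf X]/(0 * width + 0) cellf_row.
Qed.

Lemma cv_true : cv cTRUE = true.
Proof. by have := row_alt row0_ok (ltnW nalt_gt1). Qed.

(** This justifies using the cell [cALT 1] as the test for the presence of a first sign. *)
Lemma sscan_first t : (0 < s_alt (sscan t)) = (s_first (sscan t) != None).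
Proof.
have E u : s_first (sscan u) = None -> s_last (sscan u) = None.
  by elim: u => //= u IH; case: ifP => // _ /=; case: (s_first _).
elim: t => //= t IH; case: ifP => // _ /=; move: (E t) IH; rewrite /fresh.
case: (s_first _) => [f _|]; first by rewrite addn_gt0 => ->.
by move=> -> // _; rewrite addn1.
Qed.

(** The winner cells consult the counter of the current sign even if the input bit is off; the bound
    shows that the test cannot succeed then. *)
Lemma sscan_win t e : s_win (sscan t) = None -> s_cnt (sscan t) e < k.
Proof.
elim: t e => //= t IH e; case: ifP => [_|_] /=; last exact: IH.
case: (s_win _) IH => // IH; rewrite eqxx; case: ifP => // /negbT; rewrite -ltnNge => h _.
by case: (eqVneq e (t %% p)) => [->|_] //; rewrite addn0; apply: IH.
Qed.

Lemma row_lt t' c c' : c < width -> t' * width + c < t'.+1 * width + c'.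
Proof. by rewrite mulSn; lia. Qed.

Lemma row_gt0 t c : 0 < t.+1 * width + c.
Proof. by rewrite mulSn -addnA ltn_addr // (ltn_trans _ two_lt). Qed.

Lemma row_control t : t < nrow -> row_ok t (sscan t) ->
  [/\ cv (t.+1 * width + 0) = nth false inp t,
      cv (t.+1 * width + 1) = nth false inp t && fresh (t %% p) (sscan t) &
      cv (t.+1 * width + 2) = nth false inp t && selects k (t %% p) (sscan t)].
Proof.
move=> ht H; set e := t %% p; have ep : e < p by rewrite ltn_mod ltnW.
have R i : i < width -> cellf (t.+1 * width + i) = rowcell t.+1 i by move=> hi; apply: cellf_row.
have lt0 := row_gt0 t.
have ltR c c' : c < c' -> t.+1 * width + c < t.+1 * width + c' by rewrite ltn_add2l.
have w0 := ltn_trans (isT : 0 < 2) two_lt; have w1 := ltn_trans (isT : 1 < 2) two_lt.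
have Iin : cv (t.+1 * width + 0) = nth false inp t.
  by apply: cval_in; rewrite R // rowcell_in.
have Inl : cv (t.+1 * width + 1) = nth false inp t && fresh e (sscan t).
  rewrite /cv (cval_mux _ (etrans (R _ w1) (rowcell_fresh t))) // -/cv.
  - by rewrite (row_last H) // Iin cv_false /fresh; case: eqP; rewrite ?andbF ?andbT.
  - by apply: row_lt; apply: cLAST_lt.
  - exact: ltR.
have Isel : cv (t.+1 * width + 2) = nth false inp t && selects k e (sscan t).
  rewrite /cv (cval_mux _ (etrans (R _ two_lt) (rowcell_sel t))) // -/cv.
  - rewrite (row_ge H) // Inl cv_false /selects.
    by case: (leqP k); rewrite ?andbF ?andbT.
  - by apply: row_lt; apply: cGE_lt.
  - exact: ltR.
by [].
Qed.

Lemma row_ok_step t : t < nrow -> row_ok t (sscan t) -> row_ok t.+1 (sscan t.+1).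
Proof.
move=> ht H; set e := t %% p; have ep : e < p by rewrite ltn_mod ltnW.
have R i : i < width -> cellf (t.+1 * width + i) = rowcell t.+1 i by move=> hi; apply: cellf_row.
have lt0 := row_gt0 t; have ltT c : cTRUE < t.+1 * width + c.
  by rewrite mulSn -addnA ltn_addr // cALT_lt // (ltnW nalt_gt1).
have ltR c c' : c < c' -> t.+1 * width + c < t.+1 * width + c' by rewrite ltn_add2l.
have [Iin Inl Isel] := row_control ht H.
set s := sscan t in H Inl Isel *.
have Esc : sscan t.+1 = if nth false inp t then scan_step k (t < n * p) e s else s by [].
have Ige x c : x < p -> c <= k -> cv (t.+1 * width + cGE x c) = (c <= s_cnt (sscan t.+1) x).
  move=> xp ck; have := etrans (R _ (cGE_lt xp ck)) (rowcell_ge t xp ck).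
  case: eqP => [-> /cval_const E|c0]; first by rewrite /cv E.
  have h3 : t * width + cGE x c < t.+1 * width + cGE x c by apply: row_lt; apply: cGE_lt.
  case: ifP => [/andP[/eqP ee tn]|ne] E.
    have h1 : t.+1 * width + 2 < t.+1 * width + cGE x c by apply: ltR; apply: cGE_gt2.
    have h4 : c - 1 <= k by apply: leq_trans (leq_subr _ _) ck.
    have h2 : t * width + cGE x (c - 1) < t.+1 * width + cGE x c by apply: row_lt; apply: cGE_lt.
    rewrite /cv (cval_mux _ E) // -/cv Isel !(row_ge H) // Esc.
    case: (nth false inp t) => //=; rewrite ee eqxx tn /=.
    by case: (selects _ _ _) => /=; [rewrite leq_subLR addnC | rewrite addn0].
  rewrite /cv (cval_mux _ E) // -/cv cv_false (row_ge H) // Esc.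
  case: (nth false inp t) => //=.
  by move: ne; case: (x == e) => /= [->|_]; rewrite addn0.
(* The winner cells read the counter in their own row, that is, after its update. *)
have Igek : cv (t.+1 * width + cGE e k) = (k <= s_cnt (sscan t.+1) e) by apply: Ige.
split=> //.
- move=> x xp; rewrite /cv (cval_mux _ (etrans (R _ (cLAST_lt xp)) (rowcell_last t xp))) // -/cv.
  + rewrite Iin (row_last H) // Esc; case: (nth false inp t) => //=.
    rewrite [RHS]eq_sym /= -/e; case: (eqVneq x e) => [->|ne]; first by rewrite cv_true eqxx.
    by rewrite cv_false; apply/esym/eqP => -[] /eqP; rewrite (negbTE ne).
  + by apply: ltR; apply: cLAST_gt0.
  + by case: ifP.
  + by apply: row_lt; apply: cLAST_lt.
- move=> x xp; rewrite /cv (cval_mux _ (etrans (R _ (cFIRST_lt xp)) (rowcell_first t xp))) // -/cv.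
  + rewrite (row_alt H nalt_gt1) (row_first H) // sscan_first Esc -/s -/e.
    case: ifP => [|/negbFE/eqP h]; first by case: (nth false inp t); rewrite /=; case: (s_first s).
    case: (eqVneq x e) => [->|ne]; rewrite ?Iin ?cv_false.
      by case: (nth false inp t) => /=; rewrite h ?eqxx.
    case: (nth false inp t) => /=; rewrite h //.
    by apply/esym/eqP => -[] /eqP; rewrite eq_sym (negbTE ne).
  + by apply: row_lt; apply: cALT_lt; apply: nalt_gt1.
  + by apply: row_lt; apply: cFIRST_lt.
  + by case: ifP => // _; apply: ltR; apply: cFIRST_gt0.
- move=> c cn; have := etrans (R _ (cALT_lt cn)) (rowcell_alt t cn).
  case: eqP => [-> /cval_const E|c0 E]; first by rewrite /cv E.
  have h4 : c - 1 < nalt by apply: leq_ltn_trans (leq_subr _ _) cn.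
  have h1 : t.+1 * width + 1 < t.+1 * width + cALT c by apply: ltR; apply: cALT_gt1.
  have h2 : t * width + cALT (c - 1) < t.+1 * width + cALT c by apply: row_lt; apply: cALT_lt.
  have h3 : t * width + cALT c < t.+1 * width + cALT c by apply: row_lt; apply: cALT_lt.
  rewrite /cv (cval_mux _ E) // -/cv Inl !(row_alt H) // Esc.
  case: (nth false inp t) => //=.
  by case: (fresh _ _) => /=; [rewrite leq_subLR addnC | rewrite addn0].
- rewrite /cv (cval_mux _ (etrans (R _ cDONE_lt) (rowcell_done t))) // -/cv.
  + rewrite (row_done H) Igek cv_true Esc; case: (nth false inp t) => /=.
      by case: (s_win s) => //; case: (k <= _).
    by case E1: (s_win s) => //=; apply/negbTE; rewrite -ltnNge; apply: sscan_win.
  + by apply: row_lt; apply: cDONE_lt.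
  + by apply: ltR; apply: cGE_bound.
- move=> x xp; rewrite /cv (cval_mux _ (etrans (R _ (cWIN_lt xp)) (rowcell_win t xp))) // -/cv.
  + rewrite (row_done H) (row_win H) // Esc -/e; case: ifP => [|/negbFE/eqP h].
      by case: (nth false inp t) => //=; case: (s_win s).
    case: (eqVneq x e) => [->|ne]; rewrite ?Igek ?cv_false ?Esc.
      case: (nth false inp t) => /=; rewrite h; first by case: (k <= _) => //; rewrite eqxx.
      by apply/negbTE; rewrite -ltnNge; apply: sscan_win.
    case: (nth false inp t) => /=; rewrite h //; case: ifP => // _.
    by apply/esym/eqP => -[] /eqP; rewrite eq_sym (negbTE ne).
  + by apply: row_lt; apply: cDONE_lt.
  + by apply: row_lt; apply: cWIN_lt.
  + by case: ifP => // _; apply: ltR; apply: cGE_WIN.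
Qed.

Lemma rows_ok t : t <= nrow -> row_ok t (sscan t).
Proof.
by elim: t => [|t IH] ht; [exact: row0_ok | apply: row_ok_step => //; apply: IH; apply: ltnW].
Qed.

Lemma bSC : bS <= bC. Proof. exact: leq_addr. Qed.
Lemma bCZ : bC <= bZ. Proof. exact: leq_addr. Qed.
Lemma bZO : bZ <= bO. Proof. exact: leq_addr. Qed.
Lemma bOL : bO <= bL. Proof. exact: leq_addr. Qed.
Lemma bLF : bL <= bF. Proof. exact: leq_addr. Qed.
Lemma bSZ : bS <= bZ. Proof. exact: leq_trans bSC bCZ. Qed.
Lemma bSO : bS <= bO. Proof. exact: leq_trans bSZ bZO. Qed.
Lemma bSL : bS <= bL. Proof. exact: leq_trans bSO bOL. Qed.
Lemma bSF : bS <= bF. Proof. exact: leq_trans bSL bLF. Qed.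
Lemma bCO : bC <= bO. Proof. exact: leq_trans bCZ bZO. Qed.
Lemma bCL : bC <= bL. Proof. exact: leq_trans bCO bOL. Qed.
Lemma bCF : bC <= bF. Proof. exact: leq_trans bCL bLF. Qed.
Lemma bZL : bZ <= bL. Proof. exact: leq_trans bZO bOL. Qed.
Lemma bZF : bZ <= bF. Proof. exact: leq_trans bZL bLF. Qed.
Lemma bOF : bO <= bF. Proof. exact: leq_trans bOL bLF. Qed.

Lemma ltn_addl_false a b x : a <= b -> (b + x < a) = false.
Proof. by move=> h; apply/negbTE; rewrite -leqNgt; apply: leq_trans h (leq_addr _ _). Qed.

Lemma cellf_S x : x < n * p -> cellf (bS + x) =
  CMux (x.+1 * width + 2) (final (cWIN (x %% p))) (if x %% p == 0 then 0 else bS + x - 1).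
Proof.
by move=> h; rewrite /cellf (ltn_addl_false _ (leqnn bS)) {1}/bC ltn_add2l h addKn.
Qed.

Lemma cellf_C x : x < ng -> cellf (bC + x) = gatecell x.
Proof.
by move=> h; rewrite /cellf (ltn_addl_false _ bSC) (ltn_addl_false _ (leqnn bC)) {1}/bZ ltn_add2l h addKn.
Qed.

Lemma cellf_Z x : x < p -> cellf (bZ + x) =
  CMux (final cDONE) (final (cWIN x)) (final (cFIRST x)).
Proof.
by move=> h; rewrite /cellf (ltn_addl_false _ bSZ) (ltn_addl_false _ bCZ) (ltn_addl_false _ (leqnn bZ)) {1}/bO ltn_add2l h addKn.
Qed.

Lemma cellf_O x : x < p * p -> cellf (bO + x) =
  CMux (bZ + x %% p) (if bitn (x %% p) (x %/ p) then cTRUE else 0)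
    (if x %% p == 0 then 0 else bO + x - 1).
Proof.
by move=> h; rewrite /cellf (ltn_addl_false _ bSO) (ltn_addl_false _ bCO) (ltn_addl_false _ bZO) (ltn_addl_false _ (leqnn bO)) {1}/bL ltn_add2l h addKn.
Qed.

Lemma cellf_L x : x < nbits * nu.+1 -> cellf (bL + x) =
  CMux (final (cALT ((p - 1) * (x %% nu.+1) + 1)))
    (if bitn (ncol + x %% nu.+1) (x %/ nu.+1) then cTRUE else 0)
    (if x %% nu.+1 == 0 then 0 else bL + x - 1).
Proof.
by move=> h; rewrite /cellf (ltn_addl_false _ bSL) (ltn_addl_false _ bCL) (ltn_addl_false _ bZL) (ltn_addl_false _ bOL) (ltn_addl_false _ (leqnn bL)) {1}/bF ltn_add2l h addKn.
Qed.

Lemma cellf_F x : cellf (bF + x) =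
  CMux (final cDONE) (if (x < no) && (og x < ng) then bC + og x else 0) (bL + (x * nu.+1 + nu)).
Proof.
by rewrite /cellf (ltn_addl_false _ bSF) (ltn_addl_false _ bCF) (ltn_addl_false _ bZF) (ltn_addl_false _ bOF)
  (ltn_addl_false _ bLF) (ltn_addl_false _ (leqnn bF)) addKn.
Qed.

Lemma cv_chain base m (sel val : nat -> nat) :
  (forall i, i < m -> [/\ cellf (base + i) =
     CMux (sel i) (val i) (if i == 0 then 0 else base + i - 1), sel i < base & val i < base]) ->
  0 < base -> forall i, i < m ->
  cv (base + i) = chain (fun i => cv (sel i)) (fun i => cv (val i)) i.
Proof.
move=> H b0; elim=> [|i IH] im; have [E h1 h2] := H _ im.
  by rewrite /cv (cval_mux _ E) -/cv ?cv_false ?addn0.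
have hi : base + i.+1 - 1 < base + i.+1 by rewrite addnS subn1.
rewrite /cv (cval_mux _ E) -/cv ?(ltn_addr _ h1) ?(ltn_addr _ h2) //=.
by rewrite addnS subn1 /= IH // ltnW.
Qed.

Let fin := sscan nrow.

Definition selset : seq bool := mkseq (fun j => cv (bS + (j * p + p.-1))) n.

Lemma final_lt c : c < width -> final c < bS.
Proof. by move=> h; rewrite /final /bS mulSn addnC ltn_add2r. Qed.

Lemma row_lt_bS t c : t <= nrow -> c < width -> t * width + c < bS.
Proof.
move=> tn h; apply: leq_ltn_trans (final_lt h).
by rewrite leq_add2r leq_mul2r tn orbT.
Qed.

Lemma bS_gt0 : 0 < bS.
Proof. by rewrite /bS mulSn ltn_addr // (ltn_trans _ two_lt). Qed.

Lemma cTRUE_lt : cTRUE < bS.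
Proof. by apply: (@row_lt_bS 0) => //; apply: cALT_lt; apply: ltnW nalt_gt1. Qed.

Lemma n_dim : n * p <= nrow.
Proof. by rewrite /nrow leq_mul2r /dim leq_addr orbT. Qed.

Lemma pair_lt m j e : j < m -> e < p -> j * p + e < m * p.
Proof.
move=> jn ep; apply: (@leq_trans (j.+1 * p)); first by rewrite mulSn addnC ltn_add2r.
by rewrite leq_mul2r jn orbT.
Qed.

Lemma pair_mod j e : e < p -> (j * p + e) %% p = e.
Proof. by move=> ep; rewrite modnMDl modn_small. Qed.

Lemma pair_div j e : e < p -> (j * p + e) %/ p = j.
Proof. by move=> ep; rewrite divnMDl ?(ltnW p_gt1) // divn_small ?addn0. Qed.

Lemma cv_sel t : t < nrow ->
  cv (t.+1 * width + 2) = nth false inp t && selects k (t %% p) (sscan t).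
Proof. by move=> ht; have [] := row_control ht (rows_ok (ltnW ht)). Qed.

(** Whether a start is selected was decided when it was scanned, but the winner is known only in the
    last row; the run combines the two. *)
Lemma cv_select j e : j < n -> e < p -> cv (bS + (j * p + e)) =
  chain (fun i => nth false inp (j * p + i) && selects k i (sscan (j * p + i)))
    (fun i => s_win fin == Some i) e.
Proof.
move=> jn ep.
rewrite addnA (@cv_chain _ p (fun i => (j * p + i).+1 * width + 2) (fun i => final (cWIN i))) //.
- apply: eq_chain => i ie; have ip : i < p by apply: leq_ltn_trans ep.
  have hx : j * p + i < nrow by apply: leq_trans (pair_lt jn ip) n_dim.
  by rewrite cv_sel // pair_mod // (row_win (rows_ok (leqnn _))).
- move=> i ip; rewrite -addnA cellf_S ?pair_lt // pair_mod //; split=> //.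
  + apply: ltn_addr; apply: row_lt_bS two_lt.
    exact: leq_trans (pair_lt jn ip) n_dim.
  + by apply: ltn_addr; apply: final_lt; apply: cWIN_lt.
Qed.

Lemma cv_sign e : e < p -> cv (bZ + e) =
  ((if s_win fin is Some f then Some f else s_first fin) == Some e).
Proof.
move=> ep; have ok := rows_ok (leqnn nrow).
have lt c : c < width -> final c < bZ + e.
  by move=> /final_lt h; apply: ltn_addr; apply: leq_trans h bSZ.
rewrite /cv (cval_mux _ (cellf_Z ep)) ?lt ?cDONE_lt ?cWIN_lt ?cFIRST_lt // -/cv.
rewrite (row_done ok) (row_win ok) // (row_first ok) // -/fin.
by case: (s_win fin).
Qed.

Lemma cv_signbit b e : b < p -> e < p -> cv (bO + (b * p + e)) =
  chain (fun i => (if s_win fin is Some f then Some f else s_first fin) == Some i)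
    (fun i => bitn i b) e.
Proof.
move=> bp ep.
rewrite addnA (@cv_chain _ p (fun i => bZ + i) (fun i => if bitn i b then cTRUE else 0)) //.
- apply: eq_chain => i ie; have ip : i < p by apply: leq_ltn_trans ep.
  by rewrite cv_sign //; case: ifP; rewrite ?cv_true ?cv_false.
- move=> i ip; rewrite -addnA cellf_O ?pair_lt // pair_mod // pair_div //; split=> //.
  + by rewrite /bO ltn_addr // ltn_add2l.
  + apply: ltn_addr; apply: leq_trans bSO; by case: ifP; rewrite ?cTRUE_lt ?bS_gt0.
Qed.

(** The condition [(p - 1) * i + 1 <= s_alt fin] means [0 < s_alt fin] and
    [i <= (s_alt fin - 1) %/ (p - 1)], so the lookup replaces a division inside the circuit. *)
Lemma cv_altbit b v : b < nbits -> v <= nu -> cv (bL + (b * nu.+1 + v)) =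
  chain (fun i => (p - 1) * i + 1 <= s_alt fin) (fun i => bitn (ncol + i) b) v.
Proof.
move=> bn vn; have ok := rows_ok (leqnn nrow).
have an i : i <= nu -> (p - 1) * i + 1 < nalt.
  by move=> h; rewrite /nalt addn1 addn2 !ltnS leq_mul2l h orbT.
have md i : i <= nu -> (b * nu.+1 + i) %% nu.+1 = i by move=> h; rewrite modnMDl modn_small.
have dv i : i <= nu -> (b * nu.+1 + i) %/ nu.+1 = b by move=> h; rewrite divnMDl // divn_small ?addn0.
have bd i : i <= nu -> b * nu.+1 + i < nbits * nu.+1.
  move=> h; apply: (@leq_trans (b.+1 * nu.+1)); first by rewrite [b.+1 * _]mulSn addnC ltn_add2r.
  by rewrite leq_mul2r bn orbT.
rewrite addnA (@cv_chain _ nu.+1 (fun i => final (cALT ((p - 1) * i + 1)))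
   (fun i => if bitn (ncol + i) b then cTRUE else 0)) //.
- apply: eq_chain => i ie; have iu : i <= nu by apply: leq_trans vn.
  by rewrite (row_alt ok) ?an //; case: ifP; rewrite ?cv_true ?cv_false.
- move=> i iu; rewrite -addnA cellf_L ?bd // md // dv //; split=> //.
  + by apply: ltn_addr; apply: leq_trans bSL; apply: final_lt; apply: cALT_lt; apply: an.
  + apply: ltn_addr; apply: leq_trans bSL; by case: ifP; rewrite ?cTRUE_lt ?bS_gt0.
Qed.

Section GivenCircuit.
Variable C : circuit.
Let g j := nth (GConst false) (c_gates C) j.
Hypotheses (size_C : size (c_gates C) = ng)
  (tyE : forall i, i < ng -> ty i = gtype (g i))
  (gaE : forall i, i < ng -> ga i = garg1 (g i))
  (gbE : forall i, i < ng -> gb i = garg2 (g i)).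

Lemma cv_gate i : i < ng -> cv (bC + i) = nth false (circ_vals C selset) i.
Proof.
elim/ltn_ind: i => i IH ig.
rewrite /circ_vals nth_gate_run size_C ig /=; set vals := foldl _ _ _.
have Hv a : nth false vals a = (a < i) && cv (bC + a).
  rewrite /vals nth_gate_run size_take size_C ig; case: ltnP => //= ai.
  rewrite (IH a ai (ltn_trans ai ig)) /circ_vals nth_gate_run size_C (ltn_trans ai ig) /=.
  by rewrite take_takel ?nth_take // ltnW.
have E := cellf_C ig; move: E; rewrite /gatecell tyE // gaE // gbE // -/(g i).
have lti c : c <= bC -> (c < bC + i -> c < bC + i) by [].
have h0 : 0 < bC + i by rewrite ltn_addr // (leq_trans bS_gt0 bSC).
have hT : cTRUE < bC + i by rewrite ltn_addr // (leq_trans cTRUE_lt bSC).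
case: (g i) => [j|b|a|a b|a b] /= E.
- move: E; case: ltnP => jn E.
    have jp : bS + (j * p + p.-1) < bC + i.
      by rewrite ltn_addr // /bC ltn_add2l pair_lt // prednK // ltnW.
    rewrite /cv (cval_mux _ E) // -/cv cv_true cv_false /selset nth_mkseq //.
    by case: (cv _).
  (* An input index from [n] on lies outside the selected set, whose default value is false. *)
  by rewrite /cv (cval_const _ E) nth_default // size_mkseq.
- by rewrite /cv (cval_const _ E); case: (b).
- by rewrite /cv (cval_mux_gen _ E) -/cv Hv ltn_add2l hT h0 cv_true cv_false; case: (_ && _).
- by rewrite /cv (cval_mux_gen _ E) -/cv !Hv !ltn_add2l h0 cv_false; case: ((_ < i) && _).
- by rewrite /cv (cval_mux_gen _ E) -/cv !Hv !ltn_add2l hT cv_true; case: ((_ < i) && _).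
Qed.

Lemma cv_colbit b : b < nbits -> cv (bF + b) =
  if s_win fin is Some _ then (b < no) && nth false (circ_vals C selset) (og b)
  else (0 < s_alt fin) && bitn (ncol + minn nu ((s_alt fin - 1) %/ (p - 1))) b.
Proof.
move=> bn; have ok := rows_ok (leqnn nrow).
rewrite /cv (cval_mux _ (cellf_F b)) -/cv.
- rewrite (row_done ok) -/fin; case: (s_win fin) => [f|] /=.
    case: (b < no) => /=; last by rewrite cv_false.
    case: (ltnP (og b) ng) => h; first by rewrite cv_gate.
    by rewrite cv_false nth_gate_run size_C ltnNge h.
  rewrite cv_altbit // (@chain_initial _ _ ((s_alt fin - 1) %/ (p - 1)) (0 < s_alt fin)) //.
  move=> i _; rewrite leq_divRL ?subn_gt0 //; case: (s_alt fin) => [|a]; first by rewrite addn1 andbF.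
  by rewrite addn1 ltnS subSS subn0 andbT mulnC.
- by apply: ltn_addr; apply: leq_trans bSF; apply: final_lt; apply: cDONE_lt.
- case: ifP => [/andP[_ h]|_]; last by rewrite ltn_addr // (leq_trans bS_gt0 bSF).
  by rewrite ltn_addr // (leq_trans _ bZF) // /bZ ltn_add2l.
- apply: ltn_addr; rewrite /bF ltn_add2l.
  apply: (@leq_trans (b.+1 * nu.+1)); first by rewrite [b.+1 * _]mulSn addnC ltn_add2r.
  by rewrite leq_mul2r bn orbT.
Qed.

(** The minimum appears because the lookup has only [nu + 1] entries; the bound on the number of
    starts removes it in [color_alt]. *)
Lemma tucker_eval o x : c_outs C = [:: o] -> size o = no -> (forall b, b < no -> og b = nth 0 o b) ->
  (if s_win fin is Some f then Some f else s_first fin) = Some x -> x < p -> 0 < s_alt fin ->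
  circ_eval tucker_circuit inp =
    [:: x; if s_win fin is Some _ then kneser_color C selset
           else ncol + minn nu ((s_alt fin - 1) %/ (p - 1))].
Proof.
move=> Co so ogE Ex xp a0.
have gv c : c < ncells ->
    nth false (circ_vals tucker_circuit inp) (4 * c + 3) = cv c.
  by move=> h; rewrite nth_cells_gates h.
rewrite /circ_eval; move: (circ_vals _ _) gv => vals gv /=; congr [:: _; _].
  rewrite -[RHS](@bits_to_nat_bitn x p); last by apply: ltn_trans xp (ltn_expl _ _).
  congr bits_to_nat; rewrite /mkseq -map_comp; apply/eq_in_map => b; rewrite mem_iota add0n => /= bp.
  have pp : p.-1 < p by rewrite prednK // ltnW.
  rewrite gv; last first.
    by apply: (@leq_trans bL); [rewrite /bL ltn_add2l pair_lt | apply: leq_trans bLF (leq_addr _ _)].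
  rewrite cv_signbit // Ex (@chain_unique _ _ x true) /=; last by move=> i _; rewrite andbT eq_sym.
  by rewrite -ltnS prednK ?xp // ltnW.
have -> : [seq nth false vals i | i <- mkseq (fun b => 4 * (bF + b) + 3) nbits] =
    mkseq (fun b => cv (bF + b)) nbits.
  rewrite /mkseq -map_comp; apply/eq_in_map => b; rewrite mem_iota add0n => /= bp.
  by rewrite gv // ltn_add2l.
case Ew : (s_win fin) => [f|].
  rewrite /kneser_color /circ_eval Co /= -[RHS](bits_to_nat_false _ (ncol + nu)); congr bits_to_nat.
  apply: (@eq_from_nth _ false); first by rewrite size_mkseq size_cat size_map size_nseq so addnA.
  move=> b; rewrite size_mkseq => bn; rewrite nth_mkseq // cv_colbit // Ew nth_cat size_map so.
  case: ltnP => h /=; last by rewrite nth_nseq if_same.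
  by rewrite (nth_map 0) ?so // ogE.
rewrite -[RHS](@bits_to_nat_bitn _ nbits); last first.
  apply: leq_ltn_trans (ltn_expl _ (isT : 1 < 2)); rewrite /nbits -addnA addnCA leq_add2l.
  exact: leq_trans (geq_minl _ _) (leq_addl _ _).
congr bits_to_nat; apply/eq_in_map => b; rewrite mem_iota add0n => /= bp.
by rewrite cv_colbit // Ew a0.
Qed.
End GivenCircuit.

End Eval.
End Circuit.

(** * The labelling *)

Section Combinatorics.
Variables (p n k : nat).
Hypotheses (p_gt1 : 1 < p) (k_gt0 : 0 < k).

Definition labels (X : seq (option nat)) : Prop := forall j e, nth None X j = Some e -> e < p.

Fixpoint cscan (X : seq (option nat)) (i : nat) : scan :=
  if i is i'.+1 then
    if nth None X i' is Some e then scan_step k (i' < n) e (cscan X i') else cscan X i'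
  else scan0.

Definition selected (X : seq (option nat)) (j : nat) : bool :=
  if nth None X j is Some e then selects k e (cscan X j) && (s_win (cscan X (size X)) == Some e)
  else false.

Lemma nth_tucker_input X i e : labels X -> i < size X -> e < p ->
  nth false (tucker_input p X) (i * p + e) = (nth None X i == Some e).
Proof.
move=> HX iX ep; rewrite /tucker_input; move: HX iX.
set blk := fun o : option nat => _.
have sz o : size (blk o) = p by case: o => [x|] /=; rewrite ?size_nseq // size_map size_iota.
elim: X i => //= o X IH [|i] HX iX.
  rewrite nth_cat sz ep; case: o HX => [x|] HX /=; last by rewrite nth_nseq if_same.
  by rewrite (nth_map 0) ?size_iota // nth_iota // add0n eq_sym; apply/eqP/eqP => [->|[]].
rewrite mulSn -addnA nth_cat sz ltnNge leq_addr /= addKn IH // => j; exact: (HX j.+1).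
Qed.

(** A block is one-hot or zero, so at most one of its bits triggers a step: within the block the
    scan of the coordinate is either still pending or complete. *)
Lemma sscan_coord X i e : labels X -> i < size X -> e <= p ->
  sscan p n k (tucker_input p X) (i * p) = cscan X i ->
  sscan p n k (tucker_input p X) (i * p + e) =
    if nth None X i is Some x then if x < e then scan_step k (i < n) x (cscan X i) else cscan X i
    else cscan X i.
Proof.
move=> HX iX ep E; elim: e ep => [|e IH] ep.
  by rewrite addn0 E; case: (nth None X i).
rewrite addnS /= nth_tucker_input // IH ?(ltnW ep) //.
rewrite modnMDl modn_small //.
have -> : (i * p + e < n * p) = (i < n).
  case: (ltnP i n) => h; first by apply: pair_lt.
  by apply/negbTE; rewrite -leqNgt; apply: leq_trans (leq_addr _ _); rewrite leq_mul2r h orbT.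
case Ex : (nth None X i) => [x|] //; case: eqP => [[->]|h]; first by rewrite ltnn ltnSn.
by rewrite ltnS [x <= e]leq_eqVlt; case: eqP => // xe; case: h; rewrite xe.
Qed.

Lemma sscan_cscan X i : labels X -> i <= size X ->
  sscan p n k (tucker_input p X) (i * p) = cscan X i.
Proof.
move=> HX; elim: i => [|i IH] iX //.
rewrite mulSn addnC (sscan_coord HX iX (leqnn p)) ?IH ?(ltnW iX) //=.
by case Ex : (nth None X i) => [x|] //; rewrite (HX _ _ Ex).
Qed.

Record scan_ok (s : scan) : Prop := ScanOk {
  ok_last : forall e, s_last s = Some e -> e < p;
  ok_first : forall e, s_first s = Some e -> e < p;
  ok_win : forall e, s_win s = Some e -> e < p;
  ok_alt : (0 < s_alt s) = (s_first s != None);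
  ok_fl : s_first s = None -> s_last s = None;
  ok_cnt : forall e, s_cnt s e <= k;
  ok_full : forall e, s_win s = Some e -> s_cnt s e = k;
  ok_none : forall e, s_win s = None -> s_cnt s e < k }.

Lemma scan_ok_step s c e : e < p -> scan_ok s -> scan_ok (scan_step k c e s).
Proof.
move=> ep H; have Hc x : s_cnt s x + [&& x == e, c & selects k e s] <= k.
  case: (x == e) / eqP => [->|_] /=; last by rewrite addn0 (ok_cnt H).
  by rewrite /selects; case: c; case: (fresh _ _) => /=; have := ok_cnt H e;
    case: (ltnP (s_cnt s e) k) => /=; rewrite ?addn1 ?addn0.
split=> //=.
- by move=> x [<-].
- by move=> x; case E : (s_first s) => [f|] [<-] //; apply: ok_first E.
- move=> x; case E : (s_win s) => [f|]; first by case=> <-; apply: ok_win E.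
  by case: ifP => // _ [<-].
- have := ok_alt H; case E : (s_first s) => [f|] h; first by rewrite addn_gt0 h.
  by rewrite /fresh (ok_fl H E) addn1.
- by case: (s_first s).
- move=> x; case E : (s_win s) => [f|].
    by case=> <-; apply/eqP; rewrite eqn_leq Hc (leq_trans _ (leq_addr _ _)) // (ok_full H E).
  by case: ifP => // h [<-]; apply/eqP; rewrite eqn_leq Hc.
- move=> x; case E : (s_win s) => [f|] //; case: ifP => // /negbT; rewrite -ltnNge => h _.
    case: (eqVneq x e) => [->|_]; first by move: h; rewrite eqxx.
  by rewrite addn0; apply: ok_none.
Qed.

Lemma cscan_ok X i : labels X -> scan_ok (cscan X i).
Proof.
move=> HX; elim: i => [|i IH] /=; first by split.
by case E : (nth None X i) => [e|] //; apply: scan_ok_step => //; apply: HX E.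
Qed.

Lemma cscan_alt_mono X i j : i <= j -> s_alt (cscan X i) <= s_alt (cscan X j).
Proof.
elim: j => [|j IH]; first by rewrite leqn0 => /eqP ->.
rewrite leq_eqVlt ltnS => /orP[/eqP -> //|/IH h] /=.
by case: (nth None X j) => [e|] //=; apply: leq_trans h (leq_addr _ _).
Qed.

Lemma cscan_alt_gt0 X j : labels X -> nth None X j != None -> 0 < s_alt (cscan X (size X)).
Proof.
move=> HX Hj; have jX : j < size X by rewrite ltnNge; apply/negP => h; rewrite nth_default in Hj.
apply: leq_trans (cscan_alt_mono X jX) => /=.
case E : (nth None X j) Hj => [e|] // _.
by rewrite (ok_alt (scan_ok_step _ (HX _ _ E) (cscan_ok j HX))) /=; case: (s_first _).
Qed.

Definition sign (s : scan) : option nat := if s_win s is Some f then Some f else s_first s.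

(** * Equivariance under rotation of the signs *)

Section Relabel.
Variable t : nat.
Let tau e := (e + t) %% p.

Lemma tau_inj e e' : e < p -> e' < p -> (tau e == tau e') = (e == e').
Proof.
by move=> ep ep'; rewrite /tau eqn_modDr !modn_small.
Qed.

Record relabel (s s' : scan) : Prop := Relabel {
  rl_last : s_last s' = omap tau (s_last s);
  rl_first : s_first s' = omap tau (s_first s);
  rl_win : s_win s' = omap tau (s_win s);
  rl_alt : s_alt s' = s_alt s;
  rl_cnt : forall e, e < p -> s_cnt s' (tau e) = s_cnt s e }.

Lemma relabel_fresh s s' e : scan_ok s -> relabel s s' -> e < p -> fresh (tau e) s' = fresh e s.
Proof.
move=> ok H ep; rewrite /fresh (rl_last H); case E : (s_last s) => [f|] //=.
by rewrite -[in RHS](inj_eq (@Some_inj _)) /= !(inj_eq Some_inj) tau_inj // (ok_last ok).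
Qed.

Lemma relabel_selects s s' e : scan_ok s -> relabel s s' -> e < p ->
  selects k (tau e) s' = selects k e s.
Proof. by move=> ok H ep; rewrite /selects (relabel_fresh ok H) // (rl_cnt H). Qed.

Lemma relabel_step s s' c e : scan_ok s -> relabel s s' -> e < p ->
  relabel (scan_step k c e s) (scan_step k c (tau e) s').
Proof.
move=> ok H ep; split=> //=.
- by rewrite (rl_first H); case: (s_first s).
- rewrite (rl_win H); case: (s_win s) => //=.
  by rewrite (rl_cnt H) // (relabel_selects ok H) // !eqxx; case: ifP.
- by rewrite (rl_alt H) (relabel_fresh ok H).
- by move=> x xp; rewrite (rl_cnt H) // (relabel_selects ok H) // tau_inj.
Qed.

Lemma nth_omega_mul X i : nth None (omega_mul p t X) i = omap tau (nth None X i).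
Proof.
case: (ltnP i (size X)) => h; last by rewrite !nth_default ?size_map.
by rewrite (nth_map None) //; case: (nth None X i).
Qed.

Lemma relabel_cscan X i : labels X -> relabel (cscan X i) (cscan (omega_mul p t X) i).
Proof.
move=> HX; elim: i => [|i IH] /=; first by split.
rewrite nth_omega_mul; case E : (nth None X i) => [e|] //=.
by apply: relabel_step => //; [apply: cscan_ok | apply: HX E].
Qed.

Lemma relabel_selected X j : labels X -> selected (omega_mul p t X) j = selected X j.
Proof.
move=> HX; rewrite /selected nth_omega_mul; case E : (nth None X j) => [e|] //=.
have ep := HX _ _ E.
rewrite (relabel_selects (cscan_ok j HX) (relabel_cscan j HX)) // size_map.
rewrite (rl_win (relabel_cscan _ HX)); case Ew : (s_win _) => [f|] //=.
by rewrite !(inj_eq Some_inj) tau_inj // (ok_win (cscan_ok _ HX) Ew).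
Qed.

Lemma relabel_sign X i : labels X ->
  sign (cscan (omega_mul p t X) i) = omap tau (sign (cscan X i)).
Proof.
move=> HX; have H := relabel_cscan i HX; rewrite /sign (rl_win H) (rl_first H).
by case: (s_win _).
Qed.
End Relabel.

(** Without a winner all counts are below [k], so every start among the first [n] coordinates is
    selected and counted; the other coordinates contribute at most [i - n]. *)
Lemma cscan_alt_cnt X i : labels X -> s_win (cscan X i) = None ->
  s_alt (cscan X i) <= \sum_(e < p) s_cnt (cscan X i) e + (i - n).
Proof.
move=> HX; elim: i => [|i IH] /=; first by [].
case E : (nth None X i) => [e|]; last by move=> /IH h; apply: leq_trans h _; rewrite leq_add2l; lia.
rewrite /=; case Ew : (s_win _) => [|] //; move: (IH Ew) => h _.
have ep := HX _ _ E; have ok := cscan_ok i HX.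
set s := cscan X i in Ew h ok *.
have -> : \sum_(e' < p) (s_cnt s e' + [&& val e' == e, i < n & selects k e s]) =
    \sum_(e' < p) s_cnt s e' + ((i < n) && selects k e s).
  rewrite big_split /=; congr (_ + _).
  rewrite (bigD1 (Ordinal ep)) //= eqxx big1 ?addn0 // => x; rewrite -val_eqE /= => /negbTE ->.
  by [].
rewrite /selects (ok_none ok) // andbT.
move: (\sum_(e' < p) s_cnt s e') h => S h.
by case: (ltnP i n) => hin /=; case: (fresh e s) => /=; lia.
Qed.

Lemma cscan_alt_bound X : labels X -> size X = dim p n k -> s_win (cscan X (size X)) = None ->
  s_alt (cscan X (size X)) <= (p - 1) * nu k.
Proof.
move=> HX sX Ew; apply: leq_trans (cscan_alt_cnt HX Ew) _.
have h : \sum_(e < p) s_cnt (cscan X (size X)) e <= p * (k - 1).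
  rewrite -[p in p * _]card_ord -sum_nat_const; apply: leq_sum => e _.
  by have := ok_none (cscan_ok (size X) HX) e Ew; lia.
rewrite sX in h *; rewrite /dim addKn /nu.
have -> : (p - 1) * (2 * (k - 1)) = p * (k - 1) + (k - 1) * (p - 2).
  rewrite mulnC -mulnA mulnCA [p * _]mulnC -mulnDr; congr (_ * _); lia.
by rewrite leq_add2r.
Qed.
End Combinatorics.

(** * Validity and soundness of the labelling *)

Section Reduction.
Variables (p n k : nat) (ty ga gb : nat -> nat) (og : nat -> nat) (gs : seq gate) (o : seq nat).
Hypotheses (p_gt1 : 1 < p) (k_gt0 : 0 < k) (pk_n : p * k <= n).
Let g j := nth (GConst false) gs j.
Hypotheses (tyE : forall i, i < size gs -> ty i = gtype (g i))
  (gaE : forall i, i < size gs -> ga i = garg1 (g i))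
  (gbE : forall i, i < size gs -> gb i = garg2 (g i))
  (ogE : forall b, b < size o -> og b = nth 0 o b).
Let C := {| c_gates := gs; c_outs := [:: o] |}.
Let TC := tucker_circuit p n k ty ga gb (size gs) og (size o).
Hypothesis color_lt : forall B, size B = n -> kneser_color C B < ncol p n k.

Definition selection (X : seq (option nat)) : seq bool := mkseq (selected n k X) n.

Definition color (X : seq (option nat)) : nat :=
  let s := cscan n k X (size X) in
  if s_win s is Some _ then kneser_color C (selection X)
  else ncol p n k + minn (nu k) ((s_alt s - 1) %/ (p - 1)).

Lemma selset_selection X : labels p X -> size X = dim p n k ->
  selset p n k ty ga gb (size gs) og (size o) (tucker_input p X) = selection X.
Proof.
move=> HX sX; have pp : p.-1 < p by rewrite prednK // ltnW.
apply/eq_in_map => j; rewrite mem_iota add0n => /= jn.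
have jX : j < size X by rewrite sX (leq_trans jn) // leq_addr.
rewrite cv_select // /selected.
have Ej i : i <= p -> sscan p n k (tucker_input p X) (j * p + i) =
    if nth None X j is Some x then if x < i then scan_step k (j < n) x (cscan n k X j) else cscan n k X j
    else cscan n k X j.
  by move=> ip; apply: sscan_coord => //; apply: sscan_cscan => //; apply: ltnW.
have -> : nrow p n k = size X * p by rewrite sX.
rewrite (sscan_cscan n k HX (leqnn _)).
case Ex : (nth None X j) => [x|]; last first.
  rewrite (@chain_unique _ _ 0 false) ?andbF // => i ip.
  by rewrite nth_tucker_input ?Ex //; [rewrite andbF | apply: leq_ltn_trans pp].
have xp := HX _ _ Ex.
rewrite (@chain_unique _ _ x (selects k x (cscan n k X j))) => [|i ip].
  by rewrite -ltnS prednK ?xp // ltnW.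
have ip' : i < p by apply: leq_ltn_trans pp.
(* When the bit of [x] is read, no earlier bit of the block has been on, so the state is still that
   before coordinate [j]. *)
rewrite nth_tucker_input // Ej ?(ltnW ip') // Ex (inj_eq Some_inj) eq_sym.
by case: eqP => // ->; rewrite ltnn.
Qed.

Lemma lam_eval X : nonzero_vec p (dim p n k) X -> exists x,
  [/\ sign (cscan n k X (size X)) = Some x, x < p & tucker_lam p TC X = (x, color X)].
Proof.
case=> sX [HX [j Hj]]; have ok := cscan_ok n k_gt0 (size X) HX.
have a0 : 0 < s_alt (cscan n k X (size X)) by exact: (cscan_alt_gt0 n k_gt0 HX Hj).
have [x Ex] : exists x, sign (cscan n k X (size X)) = Some x.
  rewrite /sign; case: (s_win _) => [f|]; first by exists f.
  by move: a0; rewrite (ok_alt ok); case: (s_first _) => // f _; exists f.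
have xp : x < p.
  move: Ex; rewrite /sign; case Ew : (s_win _) => [f|]; first by case=> <-; apply: (ok_win ok) Ew.
  exact: (ok_first ok).
exists x; split=> //.
have Ef : sscan p n k (tucker_input p X) (nrow p n k) = cscan n k X (size X).
  by rewrite /nrow -sX; apply: sscan_cscan.
rewrite /tucker_lam (@tucker_eval p n k ty ga gb (size gs) og (size o) p_gt1 k_gt0 _ C _ _ _ _ o x) ?Ef //.
by rewrite /= selset_selection // /color.
Qed.

Lemma color_relabel t X : labels p X -> color (omega_mul p t X) = color X.
Proof.
move=> HX; rewrite /color size_map.
have H := relabel_cscan n k_gt0 t (size X) HX; rewrite (rl_win H) (rl_alt H).
case: (s_win _) => //= _; congr (kneser_color C _).
by apply: eq_map => j; apply: relabel_selected.
Qed.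

Lemma color_win X f : s_win (cscan n k X (size X)) = Some f -> color X < ncol p n k.
Proof. by rewrite /color => ->; apply: color_lt; rewrite size_mkseq. Qed.

Lemma color_alt X : nonzero_vec p (dim p n k) X -> s_win (cscan n k X (size X)) = None ->
  color X = ncol p n k + (s_alt (cscan n k X (size X)) - 1) %/ (p - 1) /\
  color X < ncol p n k + nu k.
Proof.
case=> sX [HX [j Hj]] Ew; rewrite /color Ew.
have a0 : 0 < s_alt (cscan n k X (size X)) by exact: (cscan_alt_gt0 n k_gt0 HX Hj).
have h : (s_alt (cscan n k X (size X)) - 1) %/ (p - 1) < nu k.
  rewrite ltn_divLR ?subn_gt0 // mulnC.
  have := cscan_alt_bound p_gt1 k_gt0 HX sX Ew; move: a0; clear; lia.
by rewrite (minn_idPr (ltnW h)) ltn_add2l.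
Qed.

Lemma nonzero_omega_mul t X : nonzero_vec p (dim p n k) X -> nonzero_vec p (dim p n k) (omega_mul p t X).
Proof.
case=> sX [HX [j Hj]]; split; first by rewrite size_map.
split; last by exists j; rewrite nth_omega_mul; case: (nth None X j) Hj.
move=> i e; rewrite nth_omega_mul; case: (nth None X i) => //= x [<-].
by rewrite ltn_mod ltnW.
Qed.

Lemma reduction_valid : tucker_valid p (dim p n k) (ncol p n k + nu k) TC.
Proof.
split.
  (* The color labels take at most [n - p * k + p - 1] and the alternation labels exactly
     [p * (k - 1) + (k - 1) * (p - 2)]; together with the additional 1 this is [dim]. *)
  have := leq_divM (n - p * k + p - 1) (p - 1).
  rewrite -/(kneser_m p n k) -/(ncol p n k) mulnDl /dim.
  have -> : nu k * (p - 1) = p * (k - 1) + (k - 1) * (p - 2).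
    by rewrite /nu -mulnA mulnCA [p * _]mulnC -mulnDr; congr (_ * _); lia.
  have : p * (k - 1) + p = p * k by rewrite -mulnSr subn1 prednK.
  by move: pk_n p_gt1; clear; lia.
split=> // X NX; have [x [Sx xp ->]] := lam_eval NX; split=> //.
split.
  case Ew : (s_win (cscan n k X (size X))) => [f|]; last by case: (color_alt NX Ew).
  exact: leq_trans (color_win Ew) (leq_addr _ _).
move=> t tp; have [y [Sy yp ->]] := lam_eval (nonzero_omega_mul t NX).
have [_ [HX _]] := NX.
rewrite /= color_relabel //; congr (_, _).
by move: Sy; rewrite size_map (relabel_sign n k_gt0) // Sx => -[].
Qed.

(** * Growth of the number of starts along a chain *)

Lemma neq_triangle (T : eqType) (a b c : T) : (a != c) <= (a != b) + (b != c).
Proof. by case: (eqVneq a b) => [->|_] //=; apply: leq_trans (leq_b1 _) (leq_addr _ _). Qed.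

(* The differences of the first and the last signs are the slack that makes the
   monotonicity of the number of starts an invariant of the scan. *)
Lemma alt_prec X Y i : labels p X -> labels p Y -> vprec X Y ->
  let sX := cscan n k X i in let sY := cscan n k Y i in
  if s_first sX is None then (0 < s_alt sY) + (s_first sY != s_last sY) <= s_alt sY
  else s_alt sX + (s_first sX != s_first sY) + (s_last sX != s_last sY) <= s_alt sY.
Proof.
move=> HX HY XY; elim: i => //= i.
have okX := cscan_ok n k_gt0 i HX; have okY := cscan_ok n k_gt0 i HY.
move: (cscan n k X i) (cscan n k Y i) okX okY => sX sY okX okY.
have := ok_alt okX; have := ok_alt okY; have := ok_fl okX; have := ok_fl okY.
(* A zero of [Y] is a zero of [X], so neither scan moves. *)
case Ey : (nth None Y i) => [e|]; last first.
  by case Ex : (nth None X i) => [e|] //; have := XY i; rewrite Ex Ey => /(_ isT).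
(* If both vectors carry [e], a start gained only by [X] is paid for by the former difference of the
   last signs. If only [Y] carries [e], a new difference of the last signs is paid for by the start
   that [Y] gains. *)
have T1 := neq_triangle (s_last sX) (s_last sY) (Some e).
have T2 := neq_triangle (s_first sY) (s_last sY) (Some e).
have Ex : nth None X i = Some e \/ nth None X i = None.
  by case Ex : (nth None X i) (XY i) => [x|]; [rewrite Ey => /(_ isT) ->; left | right].
case: Ex => -> /=; rewrite /fresh ?eqxx ?addn0; move: T1 T2.
- case: (s_first sX) => [f|]; case: (s_first sY) => [f'|] /= T1 T2 L1 L2 aY aX.
  + by move: T1; lia.
  + by move: aX aY; lia.
  + by rewrite L2 // (_ : s_alt sX = 0) /= ?add0n; move: T2 aX; rewrite 1?eq_sym; lia.
  + by rewrite L1 // L2 // (_ : s_alt sX = 0) ?eqxx /=; move: aX; lia.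
- case: (s_first sX) => [f|]; case: (s_first sY) => [f'|] /= T1 T2 L1 L2 aY aX.
  + by move: T1; lia.
  + by move: aX aY; lia.
  + by move: T2; lia.
  + have -> : s_alt sY = 0 by move: aY; lia.
    by rewrite L1 // !eqxx.
Qed.

Lemma alt_lt X Y : labels p X -> labels p Y -> vprec X Y -> size X = size Y ->
  let sX := cscan n k X (size X) in let sY := cscan n k Y (size Y) in
  0 < s_alt sX -> s_first sX <> s_first sY -> s_alt sX < s_alt sY.
Proof.
move=> HX HY XY sXY /= a0 ne; have := alt_prec (size X) HX HY XY; rewrite /= sXY.
have := ok_alt (cscan_ok n k_gt0 (size X) HX); rewrite a0 sXY in ne *.
case: (s_first (cscan n k X (size Y))) ne => // f ne _.
by rewrite (introN eqP ne) /=; lia.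
Qed.

Lemma cnt_count X e i : s_cnt (cscan n k X i) e =
  count (fun j => (nth None X j == Some e) && selects k e (cscan n k X j)) (iota 0 (minn i n)).
Proof.
elim: i => [|i IH] /=; first by rewrite min0n.
have E : count (fun j => (nth None X j == Some e) && selects k e (cscan n k X j)) (iota 0 (minn i.+1 n)) =
    s_cnt (cscan n k X i) e + [&& i < n, nth None X i == Some e & selects k e (cscan n k X i)].
  rewrite IH; case: (ltnP i n) => h.
    by rewrite (minn_idPl h) -[i.+1]addn1 iotaD count_cat /= addn0.
  by rewrite (minn_idPr (leqW h)) addn0.
rewrite E; case: (nth None X i) => [x|] /=; last by rewrite andbF addn0.
rewrite (inj_eq Some_inj) [x == e]eq_sym andbCA; case: eqP => [->|_] //.
Qed.

Lemma count_selection X e : size X = dim p n k -> labels p X ->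
  s_win (cscan n k X (size X)) = Some e -> count id (selection X) = k.
Proof.
move=> sX HX Ew; rewrite -(ok_full (cscan_ok n k_gt0 (size X) HX) Ew) cnt_count.
have -> : minn (size X) n = n by apply/minn_idPr; rewrite sX leq_addr.
rewrite /selection /mkseq count_map; apply: eq_count => j /=.
rewrite /selected Ew; case: (nth None X j) => [x|] //=.
rewrite [Some e == _]eq_sym andbC; case: eqP => [[->]|] //.
Qed.

(** After a selected position the last sign is the winning one, so the next position cannot be a
    start of the same sign. *)
Lemma selection_stable X : almost_stable (selection X).
Proof.
move=> j; rewrite size_mkseq => jn; rewrite !nth_mkseq ?(ltnW jn) //; apply/negP => /andP[].
rewrite /selected; case Ej : (nth None X j) => [e|] // /andP[_ /eqP Ew].
case Ej' : (nth None X j.+1) => [e'|] // /andP[/andP[]].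
rewrite /fresh /= Ej /= => /negP h _; rewrite Ew => /eqP[ee]; apply: h.
by rewrite ee.
Qed.

Lemma selection_color X e j : s_win (cscan n k X (size X)) = Some e ->
  nth false (selection X) j -> nth None X j = Some e.
Proof.
move=> Ew; case: (ltnP j n) => jn; last by rewrite nth_default // size_mkseq.
rewrite nth_mkseq // /selected Ew; case: (nth None X j) => [x|] //.
by move=> /andP[_ /eqP[->]].
Qed.

(** The first conclusion serves the backward map: it may take each winning sign from the
    permutation. *)
Lemma reduction_sound Xs pi l :
  tucker_is_sol p (dim p n k) (ncol p n k + nu k) TC Xs pi l ->
  (forall t, t < p -> s_win (cscan n k (nth [::] Xs t) (size (nth [::] Xs t))) = Some (nth 0 pi t)) /\
  kneser_is_sol p n k C (mkseq (fun t => selection (nth [::] Xs t)) p).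
Proof.
case=> sXs [NX [XX [Hpi [ls Hlam]]]]; pose X t := nth [::] Xs t; pose s t := cscan n k (X t) (size (X t)).
have szpi : size pi = p by rewrite (perm_size Hpi) size_iota.
have pi_inj t u : t < p -> u < p -> nth 0 pi t = nth 0 pi u -> t = u.
  move=> tp up /eqP; rewrite nth_uniq ?szpi //; first by move/eqP.
  by rewrite (perm_uniq Hpi) iota_uniq.
have Hs t : t < p -> sign (s t) = Some (nth 0 pi t) /\ color (X t) = l.
  by move=> tp; have [x [Sx xp]] := lam_eval (NX t tp); rewrite Hlam // => -[-> ->].
have HX t : t < p -> labels p (X t) by move=> /NX[_ []].
have sX t : t < p -> size (X t) = dim p n k by move=> /NX[].
have prec t u : t <= u -> u < p -> vprec (X t) (X u).
  elim: u => [|u IH]; first by rewrite leqn0 => /eqP -> _ j.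
  rewrite leq_eqVlt => /orP[/eqP -> _ j //|tu] up j Hj.
  rewrite -XX // -?IH // ltnW //.
have p0 : 0 < p by apply: ltnW.
have Hw t : t < p -> s_win (s t) = Some (nth 0 pi t).
  case Ew : (s_win (s t)) (Hs t) => [f|] Ht tp.
    by case: (Ht tp); rewrite /sign Ew.
  (* The common label is at least [ncol] for a vector without winner and below [ncol] for one with a
     winner, so one vector without winner forces the same for all. *)
  have Nw u : u < p -> s_win (s u) = None.
    move=> up; case Eu : (s_win (s u)) => [f|] //.
    have := color_win Eu; have [_ ->] := Hs u up; have [_ <-] := Ht tp.
    by have [-> _] := color_alt (NX t tp) Ew; rewrite ltnNge leq_addr.
  have Fu u : u < p -> s_first (s u) = Some (nth 0 pi u).
    by move=> up; have [] := Hs u up; rewrite /sign Nw.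
  have A0 u : u < p -> 0 < s_alt (s u).
    by move=> up; rewrite (ok_alt (cscan_ok n k_gt0 _ (HX u up))) Fu.
  (* Without winners the signs are the first signs, and consecutive ones differ because the
     permutation is injective. *)
  have inc u : u < p -> s_alt (s 0) + u <= s_alt (s u).
    elim: u => [|u IH] up; first by rewrite addn0.
    rewrite addnS; apply: leq_ltn_trans (IH (ltnW up)) _.
    apply: (alt_lt (HX u (ltnW up)) (HX _ up) (prec _ _ (leqnSn u) up)).
    - by rewrite !sX // ltnW.
    - exact: A0 (ltnW up).
    - rewrite -/(s u) -/(s u.+1) !Fu ?(ltnW up) // => -[h].
      by have := pi_inj _ _ (ltnW up) up h; lia.
  have lp : p - 1 < p by rewrite subn1 prednK.
  have [c0 _] := color_alt (NX 0 p0) (Nw 0 p0).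
  have [c1 _] := color_alt (NX _ lp) (Nw _ lp).
  have := inc _ lp; have := A0 0 p0; rewrite /s /X.
  move: c0 c1; rewrite -/(X 0) -/(X (p - 1)); have [_ ->] := Hs 0 p0; have [_ ->] := Hs _ lp => ->.
  rewrite -/(s 0) -/(s (p - 1)); set a := s_alt (s 0); set b := s_alt _ => /addnI E a0 ab.
  (* Growth by [p - 1] raises the quotient by at least one, whereas equal labels make the quotients
     of the first and the last vector equal. *)
  have : (a - 1 + (p - 1)) %/ (p - 1) <= (b - 1) %/ (p - 1) by apply: leq_div2r; lia.
  by rewrite divnDr // divnn subn_gt0 p_gt1 addn1 E ltnn.
split=> //; split; first by rewrite size_mkseq.
split.
  move=> t tp; rewrite nth_mkseq //; split; first by rewrite size_mkseq.
  split; first exact: selection_stable.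
  exact: count_selection (sX t tp) (HX t tp) (Hw t tp).
split.
  move=> t u tu up i; have tp : t < p by apply: ltn_trans up.
  rewrite (nth_mkseq [::] _ tp) (nth_mkseq [::] _ up); apply/negP => /andP[a1 a2].
  have h1 := selection_color (Hw t tp) a1; have h2 := selection_color (Hw u up) a2.
  have := prec t u (ltnW tu) up i; rewrite h1 h2 => /(_ isT) [h].
  by have := pi_inj _ _ tp up h; move: tu; lia.
move=> t tp; rewrite !nth_mkseq //.
have E u : u < p -> kneser_color C (selection (X u)) = l.
  by move=> up; have [_ <-] := Hs u up; rewrite /color -/(s u) Hw.
by rewrite -!/(X _) !E.
Qed.

(** The last nonzero sign before [j] is expressed by bounded quantifiers instead of a scan, so that
    the backward map can evaluate it directly on the encoded vectors. *)
Definition seen (X : seq (option nat)) (e j : nat) : bool :=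
  has (fun i => (nth None X i == Some e) &&
    all (fun i' => (i' <= i) || (nth None X i' == None)) (iota 0 j)) (iota 0 j).

Lemma seen_last X e j : (s_last (cscan n k X j) == Some e) = seen X e j.
Proof.
elim: j => [|j IH] //=; rewrite /seen -addn1 iotaD has_cat /= orbF add0n.
set A := has _ _; have -> : A = (nth None X j == None) && seen X e j.
  rewrite /A /seen; case E : (nth None X j) => [x|] /=.
    apply/negbTE/hasPn => i; rewrite mem_iota => /andP[_ ij].
    by rewrite all_cat /= E orbF leqNgt ij /= !andbF.
  apply: eq_in_has => i; rewrite mem_iota => /andP[_ ij].
  by rewrite all_cat /= E orbT !andbT.
rewrite all_cat /= leqnn /= andbT.
have -> : all (fun i' => (i' <= j) || (nth None X i' == None)) (iota 0 j).
  by apply/allP => i; rewrite mem_iota => /andP[_ /ltnW ->].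
rewrite andbT; case E : (nth None X j) => [x|] //=.
by rewrite orbF -IH; case: (nth None X j) E.
Qed.

Definition starts (X : seq (option nat)) (e j : nat) : bool :=
  (nth None X j == Some e) && ~~ seen X e j.

Lemma selected_starts X e j : j < n -> s_win (cscan n k X (size X)) = Some e ->
  selected n k X j = starts X e j && (count (starts X e) (iota 0 j) < k).
Proof.
move=> jn Ew; rewrite /selected Ew /starts -seen_last.
(* The counter of the scan stops at [k], while the number of starts goes on growing. *)
have Ec i : i <= n -> s_cnt (cscan n k X i) e = minn k (count (starts X e) (iota 0 i)).
  elim: i => [|i IH] hi; first by rewrite minn0.
  rewrite -addn1 iotaD count_cat addn1 /= addn0 add0n; have IH' := IH (ltnW hi).
  rewrite {2}/starts -seen_last; case: (nth None X i) => [x|] /=; last by rewrite addn0.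
  rewrite (inj_eq Some_inj) [x == e]eq_sym hi /=; case: eqP => [<-|_] /=; last by rewrite !addn0.
  rewrite /selects /fresh IH'; case: (s_last _ == _) => /=; first by rewrite !addn0.
  by case: (ltnP (count (starts X e) (iota 0 i)) k); rewrite ?addn0; lia.
case Ej : (nth None X j) => [x|] //=; rewrite [Some e == _]eq_sym andbC -andbA.
case: eqP => [[->]|] //=; rewrite /selects /fresh Ec ?(ltnW jn) //.
by congr (_ && _); rewrite gtn_min ltnn.
Qed.
End Reduction.

(** * The reduction *)

Definition in_n (x : seq bool) : nat := numelt (behead x).
Definition in_k (x : seq bool) : nat := numelt (skipe (behead x)).
(** The four bits are the entry mark and the opening bit of the circuit, then those of its list of
    gates. *)
Definition in_gates (x : seq bool) : seq bool := drop 4 (skipe (skipe (behead x))).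
Definition in_outs (x : seq bool) : seq bool := drop 2 (endm (in_gates x)).

(* The instances with [k = 0] are replaced by [n = p] and [k = 1] with a single
   color, for which the empty list of output bits stands. *)
Definition red_n (p : nat) (x : seq bool) : nat := if in_k x == 0 then p else in_n x.
Definition red_k (x : seq bool) : nat := if in_k x == 0 then 1 else in_k x.
Definition red_ty (x : seq bool) (i : nat) : nat := num (row (in_gates x) i) 0.
Definition red_ga (x : seq bool) (i : nat) : nat := num (row (in_gates x) i) 1.
Definition red_gb (x : seq bool) (i : nat) : nat :=
  if 2 < len (row (in_gates x) i) then num (row (in_gates x) i) 2 else 0.
Definition red_ng (x : seq bool) : nat := nrows (in_gates x).
Definition red_og (x : seq bool) (b : nat) : nat := num (row (in_outs x) 0) b.
Definition red_no (x : seq bool) : nat := if in_k x == 0 then 0 else len (row (in_outs x) 0).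

Definition red_circuit (p : nat) (x : seq bool) : circuit :=
  tucker_circuit p (red_n p x) (red_k x) (red_ty x) (red_ga x) (red_gb x) (red_ng x)
    (red_og x) (red_no x).

Definition red_f (p : nat) (x : seq bool) : seq bool :=
  tucker_enc (dim p (red_n p x) (red_k x)) (ncol p (red_n p x) (red_k x) + nu (red_k x))
    (red_circuit p x).

(** The address is quantified because a multiplexer block refers to its own gates; with it fixed
    from outside, cells are closed under case distinctions. *)
Definition ptcell (A : Type) (xs : seq (A -> seq bool)) (K : A -> cell) : Prop :=
  forall I, ptn xs I -> ptl xs (fun a => map gate_data (cell_gates (I a) (K a))).

(** * Polynomial time of the forward map *)

Section CellClosure.
Variables (A : Type) (xs : seq (A -> seq bool)).

Ltac pt_data := repeat first
  [ apply ptd_nat | apply ptd_list | apply ptl_cons | exact ptl_nil ]; pt.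

Lemma ptcell_in N : ptn xs N -> ptcell xs (fun a => CIn (N a)).
Proof. by move=> HN I HI; rewrite /cell_gates /=; pt_data. Qed.

Lemma ptcell_const b : ptb xs b -> ptcell xs (fun a => CConst (b a)).
Proof. by move=> Hb I HI; rewrite /cell_gates /=; pt_data. Qed.

Lemma ptcell_mux S M N : ptn xs S -> ptn xs M -> ptn xs N -> ptcell xs (fun a => CMux (S a) (M a) (N a)).
Proof. by move=> HS HM HN I HI; rewrite /cell_gates /=; pt_data. Qed.

Lemma ptcell_if b K1 K2 : ptb xs b -> ptcell xs K1 -> ptcell xs K2 ->
  ptcell xs (fun a => if b a then K1 a else K2 a).
Proof.
move=> Hb H1 H2 I HI; apply: pts_ext (ptl_if Hb (H1 _ HI) (H2 _ HI)) _ => a.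
by case: (b a).
Qed.
End CellClosure.

Lemma pts_in_gates A (xs : seq (A -> seq bool)) F : pts xs F -> pts xs (fun a => in_gates (F a)).
Proof. by move=> H; rewrite /in_gates; pt. Qed.

Lemma pts_in_outs A (xs : seq (A -> seq bool)) F : pts xs F -> pts xs (fun a => in_outs (F a)).
Proof.
by move=> H; rewrite /in_outs; apply: pts_drop; [exact: ptn_const | apply: pts_endm; apply: pts_in_gates].
Qed.

Lemma ptn_in_n A (xs : seq (A -> seq bool)) F : pts xs F -> ptn xs (fun a => in_n (F a)).
Proof. by move=> H; rewrite /in_n; pt. Qed.

Lemma ptn_in_k A (xs : seq (A -> seq bool)) F : pts xs F -> ptn xs (fun a => in_k (F a)).
Proof. by move=> H; rewrite /in_k; pt. Qed.

Ltac pt_cells := lazymatch goal with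
  | |- ptcell _ (fun _ => if _ then _ else _) => apply ptcell_if
  | |- ptcell _ (fun a => CIn (@?N a)) => apply (ptcell_in (N := N))
  | |- ptcell _ (fun a => CConst (@?b a)) => apply (ptcell_const (b := b))
  | |- ptcell _ (fun a => CMux (@?S a) (@?M a) (@?N a)) => apply (ptcell_mux (S := S) (M := M) (N := N))
  | |- pts _ (fun a => in_gates (@?F a)) => apply (pts_in_gates (F := F))
  | |- pts _ (fun a => in_outs (@?F a)) => apply (pts_in_outs (F := F))
  | |- pts _ (fun a => row (@?F a) (@?N a)) => apply (pts_row (F := F) (N := N))
  | |- ptn _ (fun a => in_n (@?F a)) => apply (ptn_in_n (F := F))
  | |- ptn _ (fun a => in_k (@?F a)) => apply (ptn_in_k (F := F))
  | |- ptn _ (fun a => num (@?F a) (@?N a)) => apply (ptn_num (F := F) (N := N))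
  | |- ptn _ (fun a => len (@?F a)) => apply (ptn_len (F := F))
  | |- ptn _ (fun a => nrows (@?F a)) => apply (ptn_nrows (F := F))
  | |- ptb _ (fun a => bitn _ _) => unfold bitn
  | |- ptn _ (fun a => red_n _ _) => unfold red_n
  | |- ptn _ (fun a => red_k _) => unfold red_k
  | |- ptn _ (fun a => red_ty _ _) => unfold red_ty
  | |- ptn _ (fun a => red_ga _ _) => unfold red_ga
  | |- ptn _ (fun a => red_gb _ _) => unfold red_gb
  | |- ptn _ (fun a => red_ng _) => unfold red_ng
  | |- ptn _ (fun a => red_og _ _) => unfold red_og
  | |- ptn _ (fun a => red_no _) => unfold red_no
  | |- ptn _ (fun a => nu _) => unfold nu
  | |- ptn _ (fun a => dim _ _ _) => unfold dim
  | |- ptn _ (fun a => ncol _ _ _) => unfold ncol, kneser_m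
  | |- ptn _ (fun a => nalt _ _) => unfold nalt
  | |- ptn _ (fun a => cLAST _) => unfold cLAST
  | |- ptn _ (fun a => cFIRST _ _) => unfold cFIRST
  | |- ptn _ (fun a => cALT _ _) => unfold cALT
  | |- ptn _ (fun a => cTRUE _) => unfold cTRUE
  | |- ptn _ (fun a => cGE _ _ _ _) => unfold cGE
  | |- ptn _ (fun a => cDONE _ _) => unfold cDONE
  | |- ptn _ (fun a => cWIN _ _ _) => unfold cWIN
  | |- ptn _ (fun a => width _ _) => unfold width
  | |- ptn _ (fun a => nrow _ _ _) => unfold nrow
  | |- ptn _ (fun a => bS _ _ _) => unfold bS
  | |- ptn _ (fun a => bC _ _ _) => unfold bC
  | |- ptn _ (fun a => bZ _ _ _ _) => unfold bZ
  | |- ptn _ (fun a => bO _ _ _ _) => unfold bO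
  | |- ptn _ (fun a => bL _ _ _ _) => unfold bL
  | |- ptn _ (fun a => nbits _ _ _ _) => unfold nbits
  | |- ptn _ (fun a => bF _ _ _ _ _) => unfold bF
  | |- ptn _ (fun a => ncells _ _ _ _ _) => unfold ncells
  | |- ptn _ (fun a => final _ _ _ _) => unfold final
  end.
Ltac pt_user ::= pt_cells.

Section CircuitClosure.
Variable p : nat.
Hypothesis p_gt1 : 1 < p.

Let p_gt0 : 0 < p. Proof. exact: ltnW. Qed.
Let pred_gt0 : 0 < p - 1. Proof. by rewrite subn_gt0. Qed.

Lemma ptcell_rowcell A (xs : seq (A -> seq bool)) N K T I :
  ptn xs N -> ptn xs K -> ptn xs T -> ptn xs I ->
  ptcell xs (fun a => rowcell p (N a) (K a) (T a) (I a)).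
Proof. by move=> HN HK HT HI; rewrite /rowcell; cbv zeta; pt. Qed.

Lemma ptcell_gatecell A (xs : seq (A -> seq bool)) F I :
  pts xs F -> ptn xs I ->
  ptcell xs (fun a => gatecell p (red_n p (F a)) (red_k (F a)) (red_ty (F a)) (red_ga (F a))
    (red_gb (F a)) (I a)).
Proof. by move=> HF HI; rewrite /gatecell; pt. Qed.

Ltac pt_regions := lazymatch goal with
  | |- ptcell _ (fun _ => if _ then _ else _) => apply ptcell_if
  | |- ptcell _ (fun a => CMux (@?S a) (@?M a) (@?N a)) => apply (ptcell_mux (S := S) (M := M) (N := N))
  | |- ptcell _ (fun a => rowcell _ (@?N a) (@?K a) (@?T a) (@?I a)) =>
      apply (ptcell_rowcell (N := N) (K := K) (T := T) (I := I))
  | |- ptcell _ (fun a => gatecell _ _ _ _ _ _ (@?I a)) => apply (ptcell_gatecell (I := I))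
  | |- ptb _ (fun a => bitn _ _) => unfold bitn
  | |- ptn _ (fun a => red_og _ _) => unfold red_og
  | |- ptn _ (fun a => num (@?F a) (@?N a)) => apply (ptn_num (F := F) (N := N))
  | |- pts _ (fun a => row (@?F a) (@?N a)) => apply (pts_row (F := F) (N := N))
  | |- pts _ (fun a => in_outs (@?F a)) => apply (pts_in_outs (F := F))
  | |- ptn _ (fun a => nalt _ _) => unfold nalt
  | |- ptn _ (fun a => cLAST _) => unfold cLAST
  | |- ptn _ (fun a => cFIRST _ _) => unfold cFIRST
  | |- ptn _ (fun a => cALT _ _) => unfold cALT
  | |- ptn _ (fun a => cDONE _ _) => unfold cDONE
  | |- ptn _ (fun a => cWIN _ _ _) => unfold cWIN
  end.

Lemma ptcell_cellf A (xs : seq (A -> seq bool)) F J : pts xs F -> ptn xs J ->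
  ptcell xs (fun a => cellf p (red_n p (F a)) (red_k (F a)) (red_ty (F a)) (red_ga (F a))
    (red_gb (F a)) (red_ng (F a)) (red_og (F a)) (red_no (F a)) (J a)).
Proof.
move=> HF HJ.
(* The region boundaries are treated once and kept as hypotheses, so the search on [cellf] stops at
   them instead of unfolding them at every occurrence. *)
have Hn : ptn xs (fun a => red_n p (F a)) by pt.
have Hk : ptn xs (fun a => red_k (F a)) by pt.
have Hg : ptn xs (fun a => red_ng (F a)) by pt.
have Hw : ptn xs (fun a => width p (red_k (F a))) by pt.
have HS : ptn xs (fun a => bS p (red_n p (F a)) (red_k (F a))) by pt.
have HC : ptn xs (fun a => bC p (red_n p (F a)) (red_k (F a))) by pt.
have HZ : ptn xs (fun a => bZ p (red_n p (F a)) (red_k (F a)) (red_ng (F a))) by pt.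
have HO : ptn xs (fun a => bO p (red_n p (F a)) (red_k (F a)) (red_ng (F a))) by pt.
have HL : ptn xs (fun a => bL p (red_n p (F a)) (red_k (F a)) (red_ng (F a))) by pt.
have HB : ptn xs (fun a => bF p (red_n p (F a)) (red_k (F a)) (red_ng (F a)) (red_no (F a))).
  by rewrite /bF; pt.
have Hv : ptn xs (fun a => nu (red_k (F a))) by pt.
have Hr : ptn xs (fun a => nrow p (red_n p (F a)) (red_k (F a))) by pt.
have Ho : ptn xs (fun a => red_no (F a)) by pt.
have Hc : ptn xs (fun a => ncol p (red_n p (F a)) (red_k (F a))) by pt.
rewrite /cellf /final; pt_with ltac:(fun _ => pt_regions).
Qed.
End CircuitClosure.

Section ReductionProgram.
Variable p : nat.
Hypothesis p_gt1 : 1 < p.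
Let p_gt0 : 0 < p. Proof. exact: ltnW. Qed.
Let pred_gt0 : 0 < p - 1. Proof. by rewrite subn_gt0. Qed.

Lemma ptd_list_data A (xs : seq (A -> seq bool)) N (G : A -> nat -> nat) : ptn xs N ->
  ptn (lift unary xs) (fun a => G a.1 a.2) -> ptd xs (fun a => DList (map DNat (mkseq (G a) (N a)))).
Proof.
move=> HN HG; apply: ptd_list; apply: pts_ext (ptl_mkseq (D := fun a i => DNat (G a i)) HN (ptd_nat HG)) _ => a.
by rewrite /mkseq -map_comp.
Qed.

Lemma map_cells_gates (F : nat -> cell) m : map gate_data (cells_gates F m) =
  flatten (mkseq (fun i => map gate_data (cell_gates i (F i))) m).
Proof. by rewrite /cells_gates map_flatten /mkseq -map_comp. Qed.

Lemma pts_red_f A (xs : seq (A -> seq bool)) F : pts xs F -> pts xs (fun a => red_f p (F a)).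
Proof.
move=> HF.
have Hn : ptn xs (fun a => red_n p (F a)) by pt.
have Hk : ptn xs (fun a => red_k (F a)) by pt.
have Hnu : ptn xs (fun a => nu (red_k (F a))) by pt.
have Hno : ptn xs (fun a => red_no (F a)) by pt.
have Hc : ptn xs (fun a => ncol p (red_n p (F a)) (red_k (F a))) by pt.
have HB : ptn xs (fun a => bF p (red_n p (F a)) (red_k (F a)) (red_ng (F a)) (red_no (F a))) by pt.
have HO : ptn xs (fun a => bO p (red_n p (F a)) (red_k (F a)) (red_ng (F a))) by pt.
have HM : ptn xs (fun a => ncells p (red_n p (F a)) (red_k (F a)) (red_ng (F a)) (red_no (F a))) by pt.
apply: ptd_list; apply: ptl_cons; first by apply: ptd_nat; pt.
apply: ptl_cons; first by apply: ptd_nat; pt.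
apply: ptl_cons; last exact: ptl_nil.
apply: ptd_list; apply: ptl_cons.
  apply: ptd_list.
  apply: (pts_ext (F := fun a => encl (flatten (mkseq (fun i => map gate_data (cell_gates i
     (cellf p (red_n p (F a)) (red_k (F a)) (red_ty (F a)) (red_ga (F a)) (red_gb (F a)) (red_ng (F a))
        (red_og (F a)) (red_no (F a)) i)))
     (ncells p (red_n p (F a)) (red_k (F a)) (red_ng (F a)) (red_no (F a))))))).
    by apply: ptl_flatten HM _; apply: (ptcell_cellf p_gt1 (pts_weak HF) ptn_top ptn_top).
  by move=> a; congr encl; apply/esym; apply: map_cells_gates.
apply: ptl_cons; last exact: ptl_nil.
apply: ptd_list; apply: ptl_cons.
  by apply: ptd_list_data; pt.
apply: ptl_cons; last exact: ptl_nil.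
by apply: ptd_list_data; [rewrite /nbits; pt | pt].
Qed.
End ReductionProgram.

(** * The backward map *)

Definition pair_row (z : seq bool) (i : nat) : seq bool :=
  mkseq (fun j => 0 < num (row (behead z) i) j) (len (row (behead z) i)).

(** The three bits open the solution, mark its first entry and open the list of vectors. *)
Definition sol_rows (y : seq bool) : seq bool := drop 3 y.
Definition sol_entry (y : seq bool) (t i : nat) : nat := num (row (sol_rows y) t) i.
Definition sol_sign (y : seq bool) (t : nat) : nat := num (drop 2 (endm (sol_rows y))) t.

Definition sol_seen (y : seq bool) (t j : nat) : bool :=
  has (fun i => (sol_entry y t i == (sol_sign y t).+1) &&
    all (fun i' => (i' <= i) || (sol_entry y t i' == 0)) (iota 0 j)) (iota 0 j).

Definition sol_starts (y : seq bool) (t j : nat) : bool :=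
  (sol_entry y t j == (sol_sign y t).+1) && ~~ sol_seen y t j.

Definition sol_bit (k : nat) (y : seq bool) (t j : nat) : bool :=
  sol_starts y t j && (count (sol_starts y t) (iota 0 j) < k).

Definition sol_sets (p : nat) (x y : seq bool) : seq (seq bool) :=
  mkseq (fun t => mkseq (sol_bit (in_k x) y t) (in_n x)) p.

Definition red_g (p : nat) (x y : seq bool) : seq bool := kneser_sol_data (sol_sets p x y).

Lemma pts_pair_row A (xs : seq (A -> seq bool)) F i : pts xs F -> pts xs (fun a => pair_row (F a) i).
Proof. by move=> HF; rewrite /pair_row; pt. Qed.

Lemma ptn_sol_entry A (xs : seq (A -> seq bool)) F T I : pts xs F -> ptn xs T -> ptn xs I ->
  ptn xs (fun a => sol_entry (F a) (T a) (I a)).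
Proof. by move=> HF HT HI; rewrite /sol_entry /sol_rows; pt. Qed.

Lemma ptn_sol_sign A (xs : seq (A -> seq bool)) F T : pts xs F -> ptn xs T ->
  ptn xs (fun a => sol_sign (F a) (T a)).
Proof.
move=> HF HT; rewrite /sol_sign /sol_rows.
by apply: ptn_num HT; apply: pts_drop (ptn_const _) _; apply: pts_endm; pt.
Qed.

Ltac pt_sol := lazymatch goal with
  | |- ptn _ (fun a => sol_entry (@?F a) (@?T a) (@?I a)) => apply (ptn_sol_entry (F := F) (T := T) (I := I))
  | |- ptn _ (fun a => sol_sign (@?F a) (@?T a)) => apply (ptn_sol_sign (F := F) (T := T))
  end.

Lemma ptb_sol_starts A (xs : seq (A -> seq bool)) F T I : pts xs F -> ptn xs T -> ptn xs I ->
  ptb xs (fun a => sol_starts (F a) (T a) (I a)).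
Proof. by move=> HF HT HI; rewrite /sol_starts /sol_seen; pt_with ltac:(fun _ => pt_sol). Qed.

Lemma ptb_sol_bit A (xs : seq (A -> seq bool)) K F T I : ptn xs K -> pts xs F -> ptn xs T -> ptn xs I ->
  ptb xs (fun a => sol_bit (K a) (F a) (T a) (I a)).
Proof.
move=> HK HF HT HI; rewrite /sol_bit; apply: ptb_and; first exact: ptb_sol_starts.
apply: ptb_leq HK; apply: ptn_succ; apply: (ptn_count (P := fun a => sol_starts (F a) (T a)) HI).
exact: ptb_sol_starts (pts_weak HF) (ptn_weak HT) ptn_top.
Qed.

Lemma pts_red_g A (xs : seq (A -> seq bool)) p F G : pts xs F -> pts xs G ->
  pts xs (fun a => red_g p (F a) (G a)).
Proof.
move=> HF HG; apply: (pts_ext (F := fun a => enc (DList (mkseq (fun t => DList (map DNat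
   (mkseq (fun j => nat_of_bool (sol_bit (in_k (F a)) (G a) t j)) (in_n (F a))))) p)))).
  apply: ptd_list; apply: ptl_mkseq (ptn_const _) _.
  apply: (@ptd_list_data _ _ (fun a => in_n (F a.1))
    (fun a j => nat_of_bool (sol_bit (in_k (F a.1)) (G a.1) a.2 j))).
    exact: ptn_in_n (pts_weak HF).
  apply: ptb_sol_bit.
  - exact: ptn_in_k (pts_weak (pts_weak HF)).
  - exact: pts_weak (pts_weak HG).
  - exact: ptn_weak ptn_top.
  - exact: ptn_top.
move=> a; rewrite /red_g /kneser_sol_data /sol_sets; congr (enc (DList _)).
rewrite /mkseq -map_comp; apply: eq_map => t /=; rewrite /bits_data -map_comp.
by rewrite -map_comp.
Qed.

(** * Injectivity of the encodings *)

Fixpoint data_nested_ind (P : data -> Prop) (Hn : forall k, P (DNat k))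
    (Hl : forall l, List.Forall P l -> P (DList l)) (d : data) : P d :=
  match d with
  | DNat k => Hn k
  | DList l => Hl l ((fix F (l : seq data) : List.Forall P l :=
      match l with
      | [::] => @List.Forall_nil _ P
      | d :: l' => @List.Forall_cons _ P d l' (data_nested_ind Hn Hl d) (F l')
      end) l)
  end.

(** The code is self-delimiting; arbitrary continuations are needed for the induction to pass
    through the entries of a list. *)
Lemma enc_prefix_inj d1 d2 r1 r2 : enc d1 ++ r1 = enc d2 ++ r2 -> d1 = d2 /\ r1 = r2.
Proof.
elim/data_nested_ind: d1 d2 r1 r2 => [k|l Hl] [k'|l'] r1 r2 //.
  rewrite /= !cat_rcons => -[]; elim: k k' => [|k IH] [|k'] //= [].
    by move=> ->.
  by move=> /IH[[->] ->].
rewrite !enc_list /= !cat_rcons => -[].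
elim: Hl l' => [|d {}l Hd _ IH] [|d' l'] //; first by case=> ->.
rewrite !encl_cons !cat_cons -!catA => -[/Hd[-> /IH[[->] ->]]].
by [].
Qed.

Lemma enc_inj : injective enc.
Proof. by move=> d1 d2 E; have [] := @enc_prefix_inj d1 d2 [::] [::]; rewrite ?E. Qed.

Lemma gate_data_inj : injective gate_data.
Proof. by case=> [j|[]|a|a b|a b] [j'|[]|a'|a' b'|a' b'] //= [] // -> // ->. Qed.

Lemma circuit_data_inj : injective circuit_data.
Proof.
have Hn : injective DNat by move=> a b [].
case=> g1 o1 [g2 o2] [/(inj_map gate_data_inj) -> /= /inj_map -> //].
by move=> a b [/(inj_map Hn)].
Qed.

(** A solution refers to some instance with the given code; injectivity identifies it with the
    instance that the reduction built. *)
Lemma tucker_enc_inj n s C n' s' C' : tucker_enc n s C = tucker_enc n' s' C' ->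
  [/\ n = n', s = s' & C = C'].
Proof.
move=> /enc_inj E; have [-> -> EC] : [/\ n = n', s = s' & circuit_data C = circuit_data C'].
  by case: E => -> -> E1 E2; split=> //; rewrite /circuit_data E1 E2.
by split=> //; apply: circuit_data_inj.
Qed.

Definition gate_nums (g : gate) : seq nat :=
  match g with
  | GIn j => [:: 0; j]
  | GConst b => [:: 1; nat_of_bool b]
  | GNot a => [:: 2; a]
  | GAnd a b => [:: 3; a; b]
  | GOr a b => [:: 4; a; b]
  end.

Lemma gate_data_nums g : gate_data g = list_data (gate_nums g).
Proof. by case: g. Qed.

Lemma enc_list_cat l r : enc (DList l) ++ r = true :: encl l ++ false :: r.
Proof. by rewrite enc_list cat_cons cat_rcons. Qed.

Lemma encl_cons_cat d l r : encl (d :: l) ++ r = true :: enc d ++ encl l ++ r.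
Proof. by rewrite encl_cons [LHS]cat_cons -catA. Qed.

(** * Decoding instances and solutions *)

Section ParseInstance.
Variables (n k : nat) (C : circuit).
Let x := kneser_enc n k C.

Lemma behead_instance : behead x =
  true :: enc (DNat n) ++ true :: enc (DNat k) ++ true :: enc (circuit_data C) ++ [:: false].
Proof. by rewrite /x /kneser_enc -[enc _]cats0 enc_list_cat !encl_cons_cat. Qed.

Lemma in_nE : in_n x = n.
Proof. by rewrite /in_n behead_instance numelt_cons. Qed.

Lemma in_kE : in_k x = k.
Proof. by rewrite /in_k behead_instance skipe_cons numelt_cons. Qed.

Lemma in_gatesE : in_gates x = ml (map gate_nums (c_gates C))
  (true :: enc (DList (map list_data (c_outs C))) ++ [:: false; false]).
Proof.
rewrite /in_gates behead_instance !skipe_cons /circuit_data enc_list_cat !encl_cons_cat.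
rewrite enc_list_cat /ml [drop _ _]drop0; congr (encl _ ++ _).
by rewrite -map_comp; apply: eq_map => g; rewrite gate_data_nums.
Qed.

Lemma in_outsE : in_outs x = ml (c_outs C) [:: false; false].
Proof. by rewrite /in_outs in_gatesE endm_ml enc_list_cat [drop _ _]drop0. Qed.

Lemma red_ngE : red_ng x = size (c_gates C).
Proof. by rewrite /red_ng in_gatesE nrows_ml size_map. Qed.

Lemma gate_row i : i < size (c_gates C) ->
  exists r, row (in_gates x) i = nl (gate_nums (nth (GConst false) (c_gates C) i)) r.
Proof.
move=> h; rewrite in_gatesE; have [|r ->] := @row_ml (map gate_nums (c_gates C)) 
   (true :: enc (DList (map list_data (c_outs C))) ++ [:: false; false]) i; first by rewrite size_map.
by exists r; rewrite (nth_map (GConst false)).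
Qed.

Lemma red_tyE i : i < size (c_gates C) -> red_ty x i = gtype (nth (GConst false) (c_gates C) i).
Proof. by move=> /gate_row[r E]; rewrite /red_ty E num_nl //; case: (nth (GConst false) _ _). Qed.

Lemma red_gaE i : i < size (c_gates C) -> red_ga x i = garg1 (nth (GConst false) (c_gates C) i).
Proof. by move=> /gate_row[r E]; rewrite /red_ga E num_nl //; case: (nth (GConst false) _ _). Qed.

Lemma red_gbE i : i < size (c_gates C) -> red_gb x i = garg2 (nth (GConst false) (c_gates C) i).
Proof.
by move=> /gate_row[r E]; rewrite /red_gb E len_nl; case: ltnP => h; rewrite ?num_nl //; move: h;
  case: (nth (GConst false) _ _).
Qed.

Lemma out_row : size (c_outs C) = 1 -> exists r, row (in_outs x) 0 = nl (nth [::] (c_outs C) 0) r.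
Proof. by move=> h; rewrite in_outsE; apply: row_ml; rewrite h. Qed.
End ParseInstance.

Definition letter (o : option nat) : nat := if o is Some e then e.+1 else 0.

Lemma letter_some o e : (letter o == e.+1) = (o == Some e).
Proof. by case: o. Qed.

Lemma letter_none o : (letter o == 0) = (o == None).
Proof. by case: o. Qed.

Section ParseSolution.
Variables (Xs : seq (seq (option nat))) (pi : seq nat) (l : nat).
Let y := tucker_sol_data Xs pi l.

Lemma zvec_data_letter X : zvec_data X = list_data (map letter X).
Proof. by rewrite /zvec_data /list_data -map_comp; congr DList; apply: eq_map => -[]. Qed.

Lemma sol_rowsE : exists r, sol_rows y = ml (map (map letter) Xs) (true :: enc (list_data pi) ++ r).
Proof.
exists (true :: enc (DNat l) ++ [:: false]).
rewrite /sol_rows /y /tucker_sol_data -[enc _]cats0 enc_list_cat !encl_cons_cat enc_list_cat.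
rewrite [drop _ _]drop0 /ml -map_comp; congr (encl _ ++ _).
by apply: eq_map => X; rewrite zvec_data_letter.
Qed.

Lemma sol_entryE t i : t < size Xs -> i < size (nth [::] Xs t) ->
  sol_entry y t i = letter (nth None (nth [::] Xs t) i).
Proof.
move=> ts iX; rewrite /sol_entry; have [r ->] := sol_rowsE.
have [|r' ->] := @row_ml (map (map letter) Xs) (true :: enc (list_data pi) ++ r) t; first by rewrite size_map.
by rewrite (nth_map [::]) // num_nl ?size_map // (nth_map None).
Qed.

Lemma sol_signE t : t < size pi -> sol_sign y t = nth 0 pi t.
Proof.
move=> ts; rewrite /sol_sign; have [r ->] := sol_rowsE.
by rewrite endm_ml enc_list_data /= drop0 num_nl.
Qed.

Lemma sol_startsE n' t j : t < size Xs -> t < size pi -> n' <= size (nth [::] Xs t) -> j < n' ->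
  sol_starts y t j = starts (nth [::] Xs t) (nth 0 pi t) j.
Proof.
move=> tX tp nX jn; rewrite /sol_starts /starts sol_signE // sol_entryE ?(leq_trans jn) //.
rewrite letter_some; congr (_ && ~~ _); rewrite /sol_seen /seen sol_signE //.
have E i : i < j -> sol_entry y t i = letter (nth None (nth [::] Xs t) i).
  by move=> ij; rewrite sol_entryE // (leq_trans (ltn_trans ij jn)).
apply: eq_in_has => i; rewrite mem_iota => /andP[_ ij]; rewrite E // letter_some; congr (_ && _).
by apply: eq_in_all => i'; rewrite mem_iota => /andP[_ ij']; rewrite E // letter_none.
Qed.
End ParseSolution.

Lemma pair_row_bits x y : pair_row (pair_bits x y) 0 = x /\ pair_row (pair_bits x y) 1 = y.
Proof.
have E : behead (pair_bits x y) = ml [:: map nat_of_bool x; map nat_of_bool y] [::].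
  rewrite /pair_bits -[enc _]cats0 enc_list_cat /ml; congr (encl _ ++ _).
  by rewrite /= /bits_data /list_data -!map_comp.
have H (s : seq bool) r : mkseq (fun j => 0 < num (nl (map nat_of_bool s) r) j)
    (len (nl (map nat_of_bool s) r)) = s.
  rewrite len_nl size_map; apply: (@eq_from_nth _ false); first by rewrite size_mkseq.
  move=> j; rewrite size_mkseq => js; rewrite nth_mkseq // num_nl ?size_map // (nth_map false) //.
  by case: (nth _ _ _).
rewrite /pair_row E; split.
  by have [//|r ->] := @row_ml [:: map nat_of_bool x; map nat_of_bool y] [::] 0; apply: H.
by have [//|r ->] := @row_ml [:: map nat_of_bool x; map nat_of_bool y] [::] 1; apply: H.
Qed.

Theorem theorem5p9 (p : nat) : prime p -> poly_reducible (Kneser_astab p) (Zp_Tucker p).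
Proof.
move=> /prime_gt1 p_gt1; exists (red_f p), (red_g p); split.
  by apply: pts_poly_time; apply: (pts_red_f p_gt1 pts_input).
split.
  have [M [B H]] := @pts_poly_time (fun z => red_g p (pair_row z 0) (pair_row z 1))
    (pts_red_g p (pts_pair_row 0 pts_input) (pts_pair_row 1 pts_input)).
  exists M, B => x y; have := H (pair_bits x y).
  by have [-> ->] := pair_row_bits x y.
move=> x [n [k [C [Ex [pk [so col]]]]]].
pose o := if k == 0 then [::] else nth [::] (c_outs C) 0.
pose C1 := {| c_gates := c_gates C; c_outs := [:: o] |}.
have pred_gt0 : 0 < p - 1 by rewrite subn_gt0.
have En : red_n p x = if k == 0 then p else n by rewrite /red_n Ex in_nE in_kE.
have Ek : red_k x = if k == 0 then 1 else k by rewrite /red_k Ex in_kE.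
have Eno : red_no x = size o.
  rewrite /red_no Ex in_kE /o; case: ifP => // _.
  by have [r ->] := out_row n k so; rewrite len_nl.
have Eog b : b < size o -> red_og x b = nth 0 o b.
  rewrite /red_og Ex /o; case: ifP => // _ h.
  by have [r ->] := out_row n k so; rewrite num_nl.
have Eng : red_ng x = size (c_gates C) by rewrite Ex red_ngE.
set n1 := red_n p x in En; set k1 := red_k x in Ek.
have k1_gt0 : 0 < k1 by rewrite Ek; case: (k).
have pk1 : p * k1 <= n1 by rewrite En Ek; case: (k) pk => //= _; rewrite muln1.
have colE : k != 0 -> C = C1.
  rewrite /C1 /o => /negbTE ->; case: C so {col Ex C1 o Eno Eog Eng} => gs [|o0 []] //.
have col1 B : size B = n1 -> kneser_color C1 B < ncol p n1 k1.
  rewrite En Ek; case: (eqVneq k 0) => [k0|k0] sB; last by rewrite -colE //; apply: col.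
  (* For [k = 0] the empty list of output bits evaluates to 0, which is a color since [ncol p p 1]
     is positive. *)
  rewrite /C1 /o k0 /= /kneser_color /= /ncol /kneser_m muln1 subnn add0n divn_gt0 //.
have tyE i : i < size (c_gates C) -> red_ty x i = gtype (nth (GConst false) (c_gates C) i).
  by rewrite Ex; apply: red_tyE.
have gaE i : i < size (c_gates C) -> red_ga x i = garg1 (nth (GConst false) (c_gates C) i).
  by rewrite Ex; apply: red_gaE.
have gbE i : i < size (c_gates C) -> red_gb x i = garg2 (nth (GConst false) (c_gates C) i).
  by rewrite Ex; apply: red_gbE.
have Ef : red_circuit p x = tucker_circuit p n1 k1 (red_ty x) (red_ga x) (red_gb x)
    (size (c_gates C)) (red_og x) (size o) by rewrite /red_circuit Eng Eno.
split.
  exists (dim p n1 k1), (ncol p n1 k1 + nu k1), (red_circuit p x); split=> //.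
  by rewrite Ef; apply: reduction_valid.
rewrite /= /red_f => y [n' [s' [C' [/tucker_enc_inj[<- <- <-] [Xs [pi [l [Ey Hsol]]]]]]]].
exists n, k, C; split=> //; exists (sol_sets p x y); split=> //.
rewrite -/n1 -/k1 Ef in Hsol.
have [Hw Hk] := reduction_sound p_gt1 k1_gt0 pk1 tyE gaE gbE Eog col1 Hsol.
(* For [k = 0] the vectors belong to a substitute instance, but the count below [0] fails at every
   bit, so the output consists of [p] empty sets: disjoint, of size 0, and equal, hence of one
   color. *)
case: (eqVneq k 0) => [k0|k0].
  have E : sol_sets p x y = nseq p (nseq n false).
    rewrite /sol_sets Ex in_kE in_nE k0; apply: (@eq_from_nth _ [::]); first by rewrite size_mkseq size_nseq.
    move=> t; rewrite size_mkseq => tp; rewrite nth_mkseq // nth_nseq tp.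
    apply: (@eq_from_nth _ false); first by rewrite size_mkseq size_nseq.
    by move=> j; rewrite size_mkseq => jn; rewrite nth_mkseq // nth_nseq jn /sol_bit ltn0 andbF.
  rewrite E; split; first by rewrite size_nseq.
  split.
    move=> i ip B; have -> : B = nseq n false by rewrite /B nth_nseq ip.
    rewrite size_nseq; split=> //; split; first by move=> j _; rewrite !nth_nseq !if_same.
    by rewrite k0 count_nseq mul0n.
  split; first by move=> i j ij jp t; rewrite !nth_nseq; case: (i < p); rewrite ?nth_nseq ?nth_nil ?if_same.
  by move=> i ip; rewrite !nth_nseq ip (leq_ltn_trans _ ip).
have [sX [NX [_ [Hpi _]]]] := Hsol.
have spi : size pi = p by rewrite (perm_size Hpi) size_iota.
have Ek1 : k1 = k by rewrite Ek (negbTE k0).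
have En1 : n1 = n by rewrite En (negbTE k0).
(* The starts of the sign given by the permutation are those of the winner by [Hw], so the decoded
   sets are the sets that the circuit colored. *)
have -> : sol_sets p x y = mkseq (fun t => selection n1 k1 (nth [::] Xs t)) p.
  apply/eq_in_map => t; rewrite mem_iota add0n => /= tp.
  have [sXt _] := NX t tp; have nX : n1 <= size (nth [::] Xs t) by rewrite sXt leq_addr.
  have tX : t < size Xs by rewrite sX.
  have tpi : t < size pi by rewrite spi.
  have Es j : j < n1 -> sol_starts y t j = starts (nth [::] Xs t) (nth 0 pi t) j.
    by move=> jn; rewrite Ey (sol_startsE l tX tpi nX jn).
  rewrite /selection Ex in_kE in_nE -En1 -Ek1; apply/eq_in_map => j; rewrite mem_iota add0n => /= jn.
  rewrite /sol_bit Es // (selected_starts p_gt1 k1_gt0 pk1 jn (Hw t tp)); congr (_ && (_ < _)).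
  by apply: eq_in_count => i; rewrite mem_iota => /andP[_ ij]; rewrite Es // (ltn_trans ij).
by move: Hk; rewrite -/C1 -colE // Ek1 En1.
Qed.
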